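(* Let $\Omega\subset\mathbb{C}$ be a simply connected or an infinitely connected domain. Then: (1) $\Omega$ belongs to the class $\mathcal{S}$. (2) If for a holomorphic mapping $\varphi:\Omega\to\Omega$ the operator $C_\varphi$ is hypercyclic, then it is hereditarily hypercyclic.
   Context: A domain is a connected non-empty open set. A domain in $\mathbb{C}$ is simply connected (resp. infinitely connected) if its complement in the Riemann sphere is connected (resp. has infinitely many connected components). Every domain in $\mathbb{C}$ is a connected Stein manifold. $\mathcal{O}(\Omega)$ is the space of holomorphic functions $\Omega\to\mathbb{C}$ with the topology of uniform convergence on compact sets. For holomorphic $\varphi:\Omega\to\Omega$, $C_\varphi:\mathcal{O}(\Omega)\to\mathcal{O}(\Omega)$ is $C_\varphi(f)=f\circ\varphi$. For a self-map $T$, $T^{[n]}$ denotes its $n$-th iterate. ''Increasing'' means strictly increasing. A sequence $(T_l)_l$ of continuous self-maps of a topological space $X$ is universal if there is $x\in X$ with $\{T_l(x): l\in\mathbb{N}\}$ dense in $X$; it is hereditarily universal if each of its subsequences is universal. A continuous linear operator $T$ on a topological vector space is hypercyclic (resp. hereditarily hypercyclic) with respect to an increasing sequence $(n_l)_l\subset\mathbb{N}$ if $(T^{[n_l]})_l$ is universal (resp. hereditarily universal); it is hypercyclic (resp. hereditarily hypercyclic) if this holds for the full sequence $n_l=l$. A domain $U\subset\Omega$ is a Runge domain with respect to $\Omega$ if every function in $\mathcal{O}(U)$ can be approximated locally uniformly on $U$ by functions from $\mathcal{O}(\Omega)$. $\mathcal{S}$ is the class of all connected Stein manifolds $\Omega$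 such that for every holomorphic $\varphi:\Omega\to\Omega$ and every increasing sequence $(n_l)_l$ of natural numbers: if (c1) $\varphi$ is injective, (c2) $\varphi(\Omega)$ is a Runge domain with respect to $\Omega$, and (c3) the sequence $(\varphi^{[n_l]})_l$ is run-away, i.e. for every compact $K\subset\Omega$ there is $l$ with $\varphi^{[n_l]}(K)\cap K=\varnothing$, then $C_\varphi$ is hypercyclic with respect to $(n_l)_l$. *)

(* Defs.v *)
From HB Require Import structures.
From mathcomp Require Import all_boot all_order all_algebra.
From mathcomp Require Import complex.
From mathcomp Require Import all_classical all_reals all_analysis.

Set Implicit Arguments.
Unset Strict Implicit.
Unset Printing Implicit Defensive.

Import Order.TTheory GRing.Theory Num.Theory.
Import numFieldNormedType.Exports.

Local Open Scope classical_set_scope.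
Local Open Scope ring_scope.

(* The complex numbers as a bare numFieldType: this is what gives them their
   topology and makes them a normed module over themselves, so that [derivable]
   below is complex differentiability. *)
Definition plane (R : realType) : numFieldType := R[i].

Definition domain (R : realType) (U : set (plane R)) : Prop :=
  [/\ open U, connected U & U !=set0].

(* None is the point at infinity. *)
Definition sphere_complement (R : realType) (U : set (plane R)) :
    set (one_point_compactification (plane R)) :=
  ~` (Some @` U).

Definition simply_connected (R : realType) (U : set (plane R)) : Prop :=
  connected (sphere_complement U).

Definition infinitely_connected (R : realType) (U : set (plane R)) : Prop :=
  infinite_set
    (connected_component (sphere_complement U) @` sphere_complement U).

(* [derivable] needs a function defined on the whole plane. For open U the
   choice of the extension g is irrelevant, and this says that f is complex
   differentiable at every point of U. *)
Definition holomorphic (R : realType) (U : set (plane R)) (f : U -> plane R) :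
    Prop :=
  exists2 g : plane R -> plane R,
    forall z, U z -> derivable g z 1 & forall u : U, f u = g (\val u).

(* O(U). As a type, it carries the topology induced by that of uniform
   convergence on the compact subsets of U. *)
Definition hol (R : realType) (U : set (plane R)) :
    set {family compact, U -> plane R} :=
  [set f | holomorphic f].
Arguments hol {R} U _.

Definition hol_self (R : realType) (U : set (plane R)) (phi : U -> U) : Prop :=
  holomorphic (fun u => \val (phi u)).

Lemma holomorphic_comp (R : realType) (U : set (plane R)) (phi : U -> U)
    (f : U -> plane R) :
  hol_self phi -> holomorphic f -> holomorphic (f \o phi).
Proof.
move=> [p dp pE] [g dg gE]; exists (g \o p); last first.
  by move=> u /=; rewrite gE pE.
move=> z Uz; have Upz : U (p z).
  by rewrite -(pE (exist _ z (mem_set Uz))); exact: set_valP.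
apply/derivable1_diffP/differentiable_comp; apply/derivable1_diffP.
  exact: dp.
exact: dg.
Qed.

Definition comp_op (R : realType) (U : set (plane R)) (phi : U -> U)
    (hphi : hol_self phi) (f : hol U) : hol U :=
  exist _ (\val f \o phi)
    (mem_set (holomorphic_comp hphi (set_mem (valP f)))).

Definition increasing (n : nat -> nat) : Prop :=
  forall k l : nat, (k < l)%N -> (n k < n l)%N.

Definition universal (X : topologicalType) (T : nat -> X -> X) : Prop :=
  exists x : X, dense (range (fun l => T l x)).

Definition hereditarily_universal (X : topologicalType) (T : nat -> X -> X) :
    Prop :=
  forall s : nat -> nat, increasing s -> universal (fun l => T (s l)).

Definition hypercyclic_wrt (X : topologicalType) (T : X -> X)
    (n : nat -> nat) : Prop :=
  universal (fun l => iter (n l) T).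

Definition hereditarily_hypercyclic_wrt (X : topologicalType) (T : X -> X)
    (n : nat -> nat) : Prop :=
  hereditarily_universal (fun l => iter (n l) T).

Definition hypercyclic (X : topologicalType) (T : X -> X) : Prop :=
  hypercyclic_wrt T id.

Definition hereditarily_hypercyclic (X : topologicalType) (T : X -> X) : Prop :=
  hereditarily_hypercyclic_wrt T id.

(* The density is in O(U): every f in O(U) is a limit, locally uniformly on U,
   of restrictions of elements of O(Omega). *)
Definition runge_domain (R : realType) (U Omega : set (plane R)) : Prop :=
  [/\ domain U, U `<=` Omega &
    dense [set f : hol U | exists g : hol Omega,
      forall (u : U) (w : Omega), \val u = \val w -> \val f u = \val g w]].

Definition run_away (X : topologicalType) (s : nat -> X -> X) : Prop :=
  forall K : set X, compact K -> exists l, (s l @` K) `&` K = set0.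

Definition hol_hull (R : realType) (U : set (plane R)) (K : set U) : set U :=
  [set z | forall (f : hol U) (M : plane R),
    (forall w, K w -> `|\val f w| <= M) -> `|\val f z| <= M].

(* Holomorphic convexity and separation of points; the other requirements made
   on an abstract Stein manifold (second countability, global functions as
   local coordinates) hold trivially for an open subset of the plane. *)
Definition stein (R : realType) (U : set (plane R)) : Prop :=
  [/\ open U,
      forall K : set U, compact K -> compact (hol_hull K) &
      forall z w : U, z <> w -> exists f : hol U, \val f z <> \val f w].

(* Membership in the class S of connected Stein manifolds, for a manifold which
   is an open subset of the plane. *)
Definition class_S (R : realType) (Omega : set (plane R)) : Prop :=
  [/\ domain Omega, stein Omega &
    forall (phi : Omega -> Omega) (hphi : hol_self phi) (n : nat -> nat),
      increasing n ->
      injective phi ->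
      runge_domain (range (fun z => \val (phi z))) Omega ->
      run_away (fun l => iter (n l) phi) ->
      hypercyclic_wrt (comp_op hphi) n].

(* Main.v *)
Require Import Defs.
From HB Require Import structures.
From mathcomp Require Import all_boot all_order all_algebra.
From mathcomp Require Import complex.
From mathcomp Require Import all_classical all_reals all_analysis.
From mathcomp Require Import ring lra zify.

Set Implicit Arguments.
Unset Strict Implicit.
Unset Printing Implicit Defensive.

Import Order.TTheory GRing.Theory Num.Theory.
Import numFieldNormedType.Exports.

Local Open Scope classical_set_scope.
Local Open Scope ring_scope.

(* The Runge condition on phi(Omega) is pulled back to Omega: every g in O(Omega) is a limit
   of functions f o phi with f in O(Omega).

   By Birkhoff transitivity, (1) asks for Runge approximation on the union of K and u(K), where K is
   compact and u = phi^[n_l] moves K off itself.  Such a union fails to be convex only if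
   some p outside it is separated from the complement of Omega.  Separation by a compact X
   is measured by the relation p ~ q: (z - p) / (z - q) has a logarithm near X.  If the
   complement of Omega in the sphere is connected, all its points are equivalent to infinity
   for K and for u(K), and no p is bad.  If it splits into three pieces and K is large, a bad
   p leaves at most two classes for u(K); then a nontrivial combination of the periods
   around two of the pieces annihilates f o u for all f, hence, by the Runge condition, all
   of O(Omega), which is absurd.

   For (2), a hypercyclic C_phi forces phi to be injective and to satisfy the Runge
   condition.  If Omega is not C, the supremum of | ln|g x| - ln|g y| | over univalent
   zero-free g is a distance decreased by phi, whose balls are relatively compact (Bloch and
   Harnack estimates); by Calka's argument, an orbit of phi returning infinitely often to
   a bounded set would produce a bounded orbit, impossible if C_phi is hypercyclic.  If
   Omega = C then phi is affine without fixed point.  So the whole sequence (phi^[n])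
   runs away, hence each of its subsequences does, and the argument of (1) applies. *)

(** * Real modulus, limits and complex derivatives in the plane *)

Section Plane.
Context {R : realType}.
Local Notation C := (plane R).
Implicit Types (z w x y : C) (r e : R).

(** Topology enters only through logarithms: [logeq] stands in for complementary components and
    winding numbers. Its classes are open, also near infinity, so connectedness is always used
    through clopen sets. Why three pieces: for q outside Omega, the pair of periods of the kernel at
    q along the images of two contours, one around each piece off infinity, depends only on the
    class of q and vanishes at infinity. With two classes it takes at most one nonzero value, which
    a nontrivial combination of the two contours kills. With a single contour no such combination
    need exist. That K is large means two nested sets. The outside classes of [K0] are finite in
    number, and [K1] splits each of them that some compact set splits. If u moves [K1] off itself
    and p is bad for [K0], the outside points in the [K0]-class of p are not split by [K1], hence by
    no compact set, in particular not by the image of [K0]. This is why [K1] is fixed before u. The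
    distance in (2) is never formed as a supremum: [dle x y s] states the bound s for every test
    function. *)

Definition nm z : R := Normc.normc z.
Definition rc r : C := r%:C%C.

Lemma nmE z : `|z| = (nm z)%:C%C.
Proof. by []. Qed.

Lemma nmM x y : nm (x * y) = nm x * nm y.
Proof. exact: Normc.normcM. Qed.

Lemma nmV x : nm (x^-1) = (nm x)^-1.
Proof. exact: Normc.normcV. Qed.

Lemma nmD x y : nm (x + y) <= nm x + nm y.
Proof. exact: le_normcD. Qed.

Lemma nm0 : nm 0 = 0.
Proof. exact: Normc.normc0. Qed.

Lemma nm1 : nm 1 = 1.
Proof. exact: Normc.normc1. Qed.

Lemma nmN x : nm (- x) = nm x.
Proof. exact: normcN. Qed.

Lemma nmB x y : nm (x - y) = nm (y - x).
Proof. by rewrite -nmN opprB. Qed.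

Lemma nm_ge0 x : 0 <= nm x.
Proof. by case: x => a b; exact: sqrtr_ge0. Qed.

Lemma nm_eq0 x : (nm x == 0) = (x == 0).
Proof.
apply/eqP/eqP => [|->]; last exact: nm0.
by move=> /Normc.eq0_normc.
Qed.

Lemma nm_gt0 x : (0 < nm x) = (x != 0).
Proof. by rewrite lt_def nm_ge0 andbT nm_eq0. Qed.

Lemma nmX x n : nm (x ^+ n) = nm x ^+ n.
Proof. by elim: n => [|n IH]; rewrite ?expr0 ?nm1// !exprS nmM IH. Qed.

Lemma nm_rc r : nm (rc r) = `|r|.
Proof. by rewrite /nm /rc /= expr0n /= addr0 sqrtr_sqr. Qed.

Lemma nm_triangle y x z : nm (x - z) <= nm (x - y) + nm (y - z).
Proof. by rewrite (_ : x - z = (x - y) + (y - z)) ?nmD//; ring. Qed.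

Lemma nm_subl x y : nm x - nm y <= nm (x - y).
Proof. by rewrite lerBlDr -{1}(subrK y x) nmD. Qed.

Lemma nm_sum (I : Type) (s : seq I) (P : pred I) (F : I -> C) :
  nm (\sum_(i <- s | P i) F i) <= \sum_(i <- s | P i) nm (F i).
Proof.
elim/big_rec2: _ => [|i y x _ h]; first by rewrite nm0.
by rewrite (le_trans (nmD _ _))// lerD2l.
Qed.

Lemma rcD r s : rc (r + s) = rc r + rc s.
Proof. by rewrite /rc rmorphD. Qed.
Lemma rcB r s : rc (r - s) = rc r - rc s.
Proof. by rewrite /rc rmorphB. Qed.
Lemma rcN r : rc (- r) = - rc r.
Proof. by rewrite /rc rmorphN. Qed.
Lemma rcM r s : rc (r * s) = rc r * rc s.
Proof. by rewrite /rc rmorphM. Qed.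
Lemma rcV r : rc (r^-1) = (rc r)^-1.
Proof. by rewrite /rc fmorphV. Qed.
Lemma rc0 : rc 0 = 0. Proof. by []. Qed.
Lemma rc1 : rc 1 = 1. Proof. by []. Qed.
Lemma rc_eq0 r : (rc r == 0) = (r == 0).
Proof. by rewrite -nm_eq0 nm_rc normr_eq0. Qed.
Lemma rc_nat n : rc n%:R = n%:R.
Proof. by rewrite /rc rmorph_nat. Qed.

Definition cI : C := 'i%C.
Lemma nm_cI : nm cI = 1.
Proof. by rewrite /nm /= expr0n /= add0r expr1n sqrtr1. Qed.
Lemma cI_sqr : cI * cI = -1.
Proof. by rewrite -expr2; exact: sqr_i. Qed.
Lemma cI_neq0 : cI != 0.
Proof. by rewrite -nm_eq0 nm_cI oner_eq0. Qed.

Definition mk (a b : R) : C := (a +i* b)%C.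
Definition re z : R := complex.Re z.
Definition im z : R := complex.Im z.
Lemma mkE a b : mk a b = rc a + cI * rc b.
Proof. by rewrite /mk /rc /cI; simpc. Qed.
Lemma re_mk a b : re (mk a b) = a. Proof. by []. Qed.
Lemma im_mk a b : im (mk a b) = b. Proof. by []. Qed.
Lemma mk_re_im z : mk (re z) (im z) = z. Proof. by case: z. Qed.
Lemma reD x y : re (x + y) = re x + re y. Proof. by case: x y => a b []. Qed.
Lemma imD x y : im (x + y) = im x + im y. Proof. by case: x y => a b []. Qed.
Lemma reN x : re (- x) = - re x. Proof. by case: x. Qed.
Lemma imN x : im (- x) = - im x. Proof. by case: x. Qed.
Lemma re0 : re 0 = 0. Proof. by []. Qed.
Lemma im0 : im 0 = 0. Proof. by []. Qed.

Lemma nm_sqr z : nm z ^+ 2 = re z ^+ 2 + im z ^+ 2.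
Proof. by case: z => a b; rewrite /nm /= sqr_sqrtr// addr_ge0// sqr_ge0. Qed.

Lemma re_le_nm z : `|re z| <= nm z.
Proof.
rewrite -ler_sqr ?nnegrE ?nm_ge0//.
by rewrite nm_sqr real_normK ?num_real// lerDl sqr_ge0.
Qed.

Lemma im_le_nm z : `|im z| <= nm z.
Proof.
rewrite -ler_sqr ?nnegrE ?nm_ge0//.
by rewrite nm_sqr real_normK ?num_real// lerDr sqr_ge0.
Qed.

Lemma nm_le_reim z : nm z <= `|re z| + `|im z|.
Proof.
rewrite -{1}(mk_re_im z) mkE (le_trans (nmD _ _))// nmM nm_cI mul1r.
by rewrite !nm_rc.
Qed.

(** The radius of a ball of the plane is itself a complex number; positivity forces its imaginary
    part to vanish, so real radii suffice. *)
Lemma nbhs_planeP z (A : set C) :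
  nbhs z A <-> exists2 e : R, 0 < e & forall w, nm (w - z) < e -> A w.
Proof.
split.
- move=> /nbhs_ballP[e e0 eA].
  move: e0 eA; case: e => a b; rewrite /= ltcE /= => /andP[/eqP b0 a0] eA.
  subst b; exists a => // w wz; apply: eA; rewrite /ball /=.
  by rewrite distrC nmE ltcR.
- case=> e e0 eA; apply/nbhs_ballP; exists e%:C%C => /=; first by rewrite ltcR.
  move=> w; rewrite /ball /= distrC nmE ltcR; exact: eA.
Qed.

Lemma open_planeP (U : set C) :
  open U <-> forall z, U z -> exists2 e : R, 0 < e & forall w, nm (w - z) < e -> U w.
Proof.
rewrite openE; split=> [oU z /oU /nbhs_planeP//|h z Uz].
by apply/nbhs_planeP; exact: h.
Qed.

Definition ccont (f : C -> C) z := forall e, 0 < e ->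
  exists2 d : R, 0 < d & forall w, nm (w - z) < d -> nm (f w - f z) < e.

Lemma ccontP f z : ccont f z <-> f @ z --> f z.
Proof.
split=> h.
- move=> A /nbhs_planeP[e e0 eA]; have [d d0 dh] := h _ e0.
  by apply/nbhs_planeP; exists d => // w /dh; exact: eA.
- move=> e e0.
  have /h/nbhs_planeP[d d0 dh] : nbhs (f z) [set w | nm (w - f z) < e].
    by apply/nbhs_planeP; exists e.
  by exists d.
Qed.

Lemma ccont_cst c z : ccont (fun=> c) z.
Proof. by move=> e e0; exists 1 => // w _; rewrite subrr nm0. Qed.

Lemma ccont_id z : ccont id z.
Proof. by move=> e e0; exists e. Qed.

Lemma ccontD f g z : ccont f z -> ccont g z -> ccont (fun w => f w + g w) z.
Proof.
move=> cf cg e e0; have e20 : 0 < e / 2 by rewrite divr_gt0.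
have [d d0 hd] := cf _ e20; have [d' d'0 hd'] := cg _ e20.
exists (Num.min d d'); first by rewrite lt_min d0.
move=> w; rewrite lt_min => /andP[/hd h /hd' h'].
rewrite opprD addrACA (le_lt_trans (nmD _ _))// [e]splitr.
exact: ltrD.
Qed.

Lemma ccontN f z : ccont f z -> ccont (fun w => - f w) z.
Proof.
move=> cf e /cf[d d0 hd]; exists d => // w /hd.
by rewrite -opprD nmN.
Qed.

Lemma ccontB f g z : ccont f z -> ccont g z -> ccont (fun w => f w - g w) z.
Proof. by move=> cf cg; apply: ccontD => //; exact: ccontN. Qed.

Lemma ccontM f g z : ccont f z -> ccont g z -> ccont (fun w => f w * g w) z.
Proof.
move=> cf cg e e0.
have k0 : 0 < nm (g z) + 1 by rewrite ltr_wpDl ?nm_ge0.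
have l0 : 0 < nm (f z) + 1 by rewrite ltr_wpDl ?nm_ge0.
have [d d0 hd] := cf (e / 2 / (nm (g z) + 1)) ltac:(by rewrite !divr_gt0).
have [d' d'0 hd'] := cg (Num.min 1 (e / 2 / (nm (f z) + 1)))
  ltac:(by rewrite lt_min !divr_gt0// ltr01).
exists (Num.min d d'); first by rewrite lt_min d0.
move=> w; rewrite lt_min => /andP[/hd h /hd']; rewrite lt_min => /andP[h1 h2].
have h3 : nm (g w) <= nm (g z) + 1.
  by rewrite -lerBlDl (le_trans (nm_subl _ _))// ltW.
rewrite (_ : _ - _ = (f w - f z) * g w + f z * (g w - g z)); last by ring.
rewrite (le_lt_trans (nmD _ _))// [e]splitr !nmM ltr_leD//.
  rewrite (le_lt_trans (ler_wpM2l (nm_ge0 _) h3))//.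
  by rewrite -ltr_pdivlMr.
rewrite (le_trans (ler_wpM2l (nm_ge0 _) (ltW h2)))// mulrCA ler_piMr//.
  by rewrite divr_ge0// ltW.
by rewrite ler_pdivrMr// mul1r lerDl.
Qed.

Lemma ccontV f z : f z != 0 -> ccont f z -> ccont (fun w => (f w)^-1) z.
Proof.
move=> fz cf e e0; have n0 : 0 < nm (f z) by rewrite nm_gt0.
have [d d0 hd] := cf (Num.min (nm (f z) / 2) (e * (nm (f z) * (nm (f z) / 2))))
  ltac:(by rewrite lt_min !(mulr_gt0, divr_gt0)).
exists d => // w /hd; rewrite lt_min => /andP[h1 h2].
have h3 : nm (f z) / 2 < nm (f w).
  have := nm_subl (f z) (f w); rewrite nmB => h4.
  by move: h1 h4; lra.
have w0 : 0 < nm (f w) by rewrite (lt_trans _ h3)// divr_gt0.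
rewrite (_ : _ - _ = (f z - f w) / (f z * f w)); last first.
  by field; rewrite fz -(nm_gt0 (f w)) w0.
rewrite nmM nmV nmM ltr_pdivrMr ?mulr_gt0// nmB (lt_trans h2)//.
by rewrite !ltr_pM2l.
Qed.

Lemma ccont_comp f g z : ccont f z -> ccont g (f z) -> ccont (fun w => g (f w)) z.
Proof.
move=> cf cg e e0; have [d d0 gd] := cg _ e0.
by have [d' d'0 fd] := cf _ d0; exists d' => // w /fd /gd.
Qed.

(** Complex differentiability in a form without division, which makes sense at [w = z] too. *)
Definition hasd (f : C -> C) z (d : C) := forall e, 0 < e ->
  exists2 r : R, 0 < r & forall w, nm (w - z) < r ->
    nm (f w - f z - d * (w - z)) <= e * nm (w - z).

Lemma hasd_is_derive f z d : hasd f z d <-> is_derive z 1 f d.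
Proof.
have key w : w != z -> (w - z)^-1 *: (f w - f z) - d =
    (w - z)^-1 * (f w - f z - d * (w - z)).
  rewrite -subr_eq0 => wz; rewrite /GRing.scale /=; field; exact: wz.
split=> [h|[df dE] e e0].
- have dfz : (fun h => h^-1 *: ((f \o shift z) (h *: 1) - f z)) @ (0 : C)^' --> d.
    apply/cvgrPdist_lt => -[a b]; rewrite ltcE => /= /andP[/eqP b0 a0]; subst b.
    have a20 : 0 < a / 2 by rewrite divr_gt0.
    have [r r0 hr] := h _ a20.
    apply/nbhs_planeP; exists r => // w; rewrite subr0 => wr /= w0.
    rewrite distrC nmE ltcR /GRing.scale /= mulr1.
    have := hr (w + z); rewrite addrK => /(_ wr) hw.
    have wz : w + z != z by rewrite -subr_eq0 addrK.
    have := key _ wz; rewrite addrK /GRing.scale /= => ->.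
    rewrite nmM nmV mulrC ltr_pdivrMr ?nm_gt0//.
    rewrite (le_lt_trans hw)// ltr_pM2r ?nm_gt0//.
    by rewrite ltr_pdivrMr// ltr_pMr// ltr1n.
  by split; [apply/cvg_ex; exists d|exact: cvg_lim].
- have := df; rewrite /derivable => /cvgrPdist_lt /(_ e%:C%C).
  rewrite ltcR => /(_ e0) /nbhs_planeP[r r0 hr]; exists r => // w wr.
  have [->|wz] := eqVneq w z; first by rewrite !subrr mulr0 subr0 nm0 mulr0.
  have := hr (w - z); rewrite subr0 => /(_ wr) /=; rewrite subr_eq0 => /(_ wz).
  rewrite -/('D_1 f z) dE distrC nmE ltcR /GRing.scale /= mulr1 subrK => hh.
  have := key _ wz; rewrite /GRing.scale /= => kw.
  move: hh; rewrite kw nmM nmV mulrC ltr_pdivrMr ?nm_gt0 ?subr_eq0//.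
  exact: ltW.
Qed.

Lemma hasd_derivable f z : (exists d, hasd f z d) <-> derivable f z 1.
Proof.
split=> [[d /hasd_is_derive[]]//|df]; exists ('D_1 f z).
by apply/hasd_is_derive; exact/derivableP.
Qed.

Lemma hasd_uniq f z d d' : hasd f z d -> hasd f z d' -> d = d'.
Proof. by move=> /hasd_is_derive[_ <-] /hasd_is_derive[_ <-]. Qed.

Lemma hasd_cst c z : hasd (fun=> c) z 0.
Proof. by apply/hasd_is_derive; exact: is_derive_cst. Qed.

Lemma hasd_id z : hasd id z 1.
Proof. by apply/hasd_is_derive; exact: is_derive_id. Qed.

Lemma hasdD f g z a b : hasd f z a -> hasd g z b ->
  hasd (fun w => f w + g w) z (a + b).
Proof.
by move=> /hasd_is_derive fa /hasd_is_derive gb; apply/hasd_is_derive;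
  exact: is_deriveD.
Qed.

Lemma hasdN f z a : hasd f z a -> hasd (fun w => - f w) z (- a).
Proof.
by move=> /hasd_is_derive fa; apply/hasd_is_derive; exact: is_deriveN.
Qed.

Lemma hasdB f g z a b : hasd f z a -> hasd g z b ->
  hasd (fun w => f w - g w) z (a - b).
Proof. by move=> fa gb; apply: hasdD => //; exact: hasdN. Qed.

Lemma hasdM f g z a b : hasd f z a -> hasd g z b ->
  hasd (fun w => f w * g w) z (a * g z + f z * b).
Proof.
move=> /hasd_is_derive fa /hasd_is_derive gb; apply/hasd_is_derive.
have := is_deriveM fa gb; rewrite /GRing.scale /= addrC (mulrC (g z)).
exact.
Qed.

Lemma hasdMl f c z a : hasd f z a -> hasd (fun w => c * f w) z (c * a).
Proof.
move=> fa; have := hasdM (hasd_cst c z) fa.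
by rewrite mul0r add0r.
Qed.

Lemma hasd_bound f z d : hasd f z d -> exists2 r : R, 0 < r &
  forall w, nm (w - z) < r -> nm (f w - f z) <= (nm d + 1) * nm (w - z).
Proof.
move=> /(_ 1 ltr01)[r r0 h]; exists r => // w /h hw.
rewrite -[f w - f z](subrK (d * (w - z))) (le_trans (nmD _ _))//.
by rewrite mulrDl addrC nmM lerD2l.
Qed.

Lemma hasd_ccont f z d : hasd f z d -> ccont f z.
Proof.
move=> /hasd_bound[r r0 h] e e0.
have k0 : 0 < nm d + 1 by rewrite ltr_wpDl ?nm_ge0.
exists (Num.min r (e / (nm d + 1))); first by rewrite lt_min r0 divr_gt0.
move=> w; rewrite lt_min => /andP[/h hw we]; rewrite (le_lt_trans hw)//.
by rewrite mulrC -ltr_pdivlMr.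
Qed.

Lemma hasd_comp f g z a b : hasd f z a -> hasd g (f z) b ->
  hasd (fun w => g (f w)) z (b * a).
Proof.
move=> fa gb e e0.
have k0 : 0 < nm a + 1 by rewrite ltr_wpDl ?nm_ge0.
have l0 : 0 < nm b + 1 by rewrite ltr_wpDl ?nm_ge0.
have [r1 r10 h1] := hasd_bound fa.
have [r2 r20 h2] := gb (e / 2 / (nm a + 1)) ltac:(by rewrite !divr_gt0).
have [r3 r30 h3] := fa (e / 2 / (nm b + 1)) ltac:(by rewrite !divr_gt0).
have [r4 r40 h4] := hasd_ccont fa r20.
exists (Num.min (Num.min r1 r3) r4); first by rewrite !lt_min r10 r30.
move=> w; rewrite !lt_min => /andP[/andP[w1 w3] w4].
have := h1 _ w1; have := h2 _ (h4 _ w4); have := h3 _ w3 => H3 H2 H1.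
rewrite (_ : _ - _ - _ = (g (f w) - g (f z) - b * (f w - f z)) +
   b * (f w - f z - a * (w - z))); last by ring.
have E1 : e / 2 / (nm a + 1) * ((nm a + 1) * nm (w - z)) = e / 2 * nm (w - z).
  by field; rewrite gt_eqF.
have E2 : e / 2 * nm (w - z) = (nm b + 1) * (e / 2 / (nm b + 1) * nm (w - z)).
  by field; rewrite gt_eqF.
rewrite (le_trans (nmD _ _))// [e]splitr mulrDl lerD//.
  rewrite (le_trans H2)// -E1 ler_wpM2l// !divr_ge0// ltW//.
rewrite nmM (le_trans (ler_wpM2l (nm_ge0 _) H3))// E2.
by rewrite ler_wpM2r ?lerDl// !mulr_ge0 ?nm_ge0 ?invr_ge0 ?ltW.
Qed.

Lemma hasdV f z a : f z != 0 -> hasd f z a ->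
  hasd (fun w => (f w)^-1) z (- a / f z ^+ 2).
Proof.
move=> fz fa; have := fa => /hasd_is_derive [dfz dE].
apply/hasd_is_derive; split; first exact: derivableV.
by rewrite deriveV// dE /GRing.scale /= mulNr mulrC mulNr.
Qed.

Lemma hasd_near f g z d : hasd f z d ->
  (exists2 r : R, 0 < r & forall w, nm (w - z) < r -> f w = g w) -> hasd g z d.
Proof.
move=> fd [r r0 fg] e e0; have [r' r'0 h] := fd _ e0.
exists (Num.min r r'); first by rewrite lt_min r0.
move=> w; rewrite lt_min => /andP[w1 w2].
by rewrite -fg// -fg ?subrr ?nm0//; exact: h.
Qed.

Lemma hasd_eq f z d d' : hasd f z d -> d = d' -> hasd f z d'.
Proof. by move=> h <-. Qed.

Definition holo (U : set C) (f : C -> C) := forall z, U z -> exists d, hasd f z d.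

Lemma holo_sub (U V : set C) f : V `<=` U -> holo U f -> holo V f.
Proof. by move=> VU h z /VU /h. Qed.
Lemma holo_ccont U f z : holo U f -> U z -> ccont f z.
Proof. by move=> h /h[d]; exact: hasd_ccont. Qed.
Lemma holo_cst U c : holo U (fun=> c).
Proof. by move=> z _; exists 0; exact: hasd_cst. Qed.
Lemma holo_id U : holo U id.
Proof. by move=> z _; exists 1; exact: hasd_id. Qed.
Lemma holoD U f g : holo U f -> holo U g -> holo U (fun w => f w + g w).
Proof. by move=> hf hg z Uz; have [a fa] := hf _ Uz; have [b gb] := hg _ Uz;
  exists (a + b); exact: hasdD. Qed.
Lemma holoB U f g : holo U f -> holo U g -> holo U (fun w => f w - g w).
Proof. by move=> hf hg z Uz; have [a fa] := hf _ Uz; have [b gb] := hg _ Uz;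
  exists (a - b); exact: hasdB. Qed.
Lemma holoM U f g : holo U f -> holo U g -> holo U (fun w => f w * g w).
Proof. by move=> hf hg z Uz; have [a fa] := hf _ Uz; have [b gb] := hg _ Uz;
  exists (a * g z + f z * b); exact: hasdM. Qed.
Lemma holoX U f n : holo U f -> holo U (fun w => f w ^+ n).
Proof.
move=> hf; elim: n => [|n IH]; first exact: holo_cst.
by rewrite (_ : (fun _ => _) = fun w => f w * f w ^+ n);
  [exact: holoM|apply/funext => w; rewrite exprS].
Qed.
Lemma holoV U f : (forall z, U z -> f z != 0) -> holo U f ->
  holo U (fun w => (f w)^-1).
Proof. by move=> f0 hf z Uz; have [a fa] := hf _ Uz; eexists; apply: hasdV;
  [exact: f0|exact: fa]. Qed.
Lemma holo_comp U V f g : (forall z, U z -> V (f z)) -> holo U f -> holo V g ->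
  holo U (fun w => g (f w)).
Proof. by move=> fUV hf hg z Uz; have [a fa] := hf _ Uz;
  have [b gb] := hg _ (fUV _ Uz); exists (b * a); exact: hasd_comp. Qed.
Lemma holo_sum U (I : Type) (s : seq I) (F : I -> C -> C) :
  (forall i, holo U (F i)) -> holo U (fun w => \sum_(i <- s) F i w).
Proof.
move=> hF; elim: s => [|i s IH].
  by rewrite (_ : (fun _ => _) = fun=> 0); [exact: holo_cst|
    apply/funext => w; rewrite big_nil].
rewrite (_ : (fun _ => _) = fun w => F i w + \sum_(j <- s) F j w);
  [exact: holoD|by apply/funext => w; rewrite big_cons].
Qed.

Lemma holo_inv_sub (U : set C) q : ~ U q -> holo U (fun w => (w - q)^-1).
Proof.
move=> Uq; apply: holoV; last by apply: holoB; [exact: holo_id|exact: holo_cst].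
by move=> z Uz; rewrite subr_eq0; apply: contra_not_neq Uq => <-.
Qed.

End Plane.

(** * Bisection of rectangles *)

Section Bisection.
Context {R : realType}.
Implicit Types (a b c d x y : R).

Let quarter (t u : R * R * R * R) := let: (a, b, c, d) := t in
  let: (a', b', c', d') := u in
  [/\ a <= a', b' <= b, c <= c', d' <= d &
  [/\ b' - a' = (b - a) / 2 & d' - c' = (d - c) / 2]].

(** In each coordinate the common point is the supremum of the lower ends of the nested quarters.
    Intervals are handled by taking the second side to be [[0, 0]]. *)
Lemma bisection (P : nat -> R -> R -> R -> R -> Prop) a b c d :
  a <= b -> c <= d -> P 0%N a b c d ->
  (forall n a b c d, a <= b -> c <= d -> P n a b c d ->
    let m := (a + b) / 2 in let m' := (c + d) / 2 in
    [\/ P n.+1 a m c m', P n.+1 m b c m', P n.+1 a m m' d | P n.+1 m b m' d]) ->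
  exists x y, forall n, exists a' b' c' d',
    [/\ a <= a' <= x, x <= b' <= b, c <= c' <= y, y <= d' <= d &
     [/\ b' - a' = (b - a) / 2 ^+ n, d' - c' = (d - c) / 2 ^+ n &
         P n a' b' c' d']].
Proof.
move=> ab cd P0 step.
pose ok n (t : R * R * R * R) := let: (a, b, c, d) := t in
  [/\ a <= b, c <= d & P n a b c d].
(* The implication stands under the existential so that choice yields a total function. *)
have next n t : exists u, ok n t -> ok n.+1 u /\ quarter t u.
  have [okt|nok] := pselect (ok n t); last by exists t => /nok.
  move: t okt => [[[a1 b1] c1] d1] [ab1 cd1 P1].
  have [h|h|h|h] := step _ _ _ _ _ ab1 cd1 P1;
    [exists (a1, (a1 + b1) / 2, c1, (c1 + d1) / 2)
    |exists ((a1 + b1) / 2, b1, c1, (c1 + d1) / 2)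
    |exists (a1, (a1 + b1) / 2, (c1 + d1) / 2, d1)
    |exists ((a1 + b1) / 2, b1, (c1 + d1) / 2, d1)] => _;
    do !split => //; clear -ab1 cd1; lra.
pose nx n t := projT1 (cid (next n t)).
have nxP n t : ok n t -> ok n.+1 (nx n t) /\ quarter t (nx n t).
  by rewrite /nx; case: cid.
pose s := fix s n := if n is m.+1 then nx m (s m) else (a, b, c, d).
have oks n : ok n (s n) by elim: n => [|n /nxP[]].
have qs n : quarter (s n) (s n.+1) by have [] := nxP _ _ (oks n).
pose sa n := (s n).1.1.1; pose sb n := (s n).1.1.2.
pose sc n := (s n).1.2; pose sd n := (s n).2.
have sE n : s n = (sa n, sb n, sc n, sd n).
  by rewrite /sa /sb /sc /sd; case: (s n) => [[[]]].
have okE n : [/\ sa n <= sb n, sc n <= sd n & P n (sa n) (sb n) (sc n) (sd n)].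
  by have := oks n; rewrite sE.
have qE n : [/\ sa n <= sa n.+1, sb n.+1 <= sb n, sc n <= sc n.+1,
   sd n.+1 <= sd n & [/\ sb n.+1 - sa n.+1 = (sb n - sa n) / 2
   & sd n.+1 - sc n.+1 = (sd n - sc n) / 2]].
  by have := qs n; rewrite !sE.
have incr (u : nat -> R) : (forall n, u n <= u n.+1) ->
    forall m n, (m <= n)%N -> u m <= u n.
  move=> h m n /subnK <-; elim: (n - m)%N => // k IH.
  by rewrite addSn (le_trans IH).
have decr (u : nat -> R) : (forall n, u n.+1 <= u n) ->
    forall m n, (m <= n)%N -> u n <= u m.
  move=> h m n mn; rewrite -lerN2; apply: (incr (fun n => - u n)) => // k.
  by rewrite lerN2.
have lim (u v : nat -> R) : (forall n, u n <= u n.+1) ->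
    (forall n, v n.+1 <= v n) -> (forall n, u n <= v n) ->
    exists x, forall n, u n <= x <= v n.
  move=> hu hv uv.
  have cross m n : u m <= v n.
    have := leq_total m n => /orP[mn|nm].
      by rewrite (le_trans (incr _ hu _ _ mn)).
    by rewrite (le_trans (uv _))// (decr _ hv).
  have hs : has_sup (range u).
    by split; [exists (u 0%N), 0%N|exists (v 0%N) => _ [n _ <-]].
  exists (sup (range u)) => n; apply/andP; split.
    by apply: sup_upper_bound => //; exists n.
  by apply: ge_sup; [case: hs|move=> _ [m _ <-]].
have [x xP] := lim sa sb (fun n => let: And5 h _ _ _ _ := qE n in h)
  (fun n => let: And5 _ h _ _ _ := qE n in h)
  (fun n => let: And3 h _ _ := okE n in h).
have [y yP] := lim sc sd (fun n => let: And5 _ _ h _ _ := qE n in h)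
  (fun n => let: And5 _ _ _ h _ := qE n in h)
  (fun n => let: And3 _ h _ := okE n in h).
exists x, y => n; exists (sa n), (sb n), (sc n), (sd n).
have /andP[xa xb] := xP n; have /andP[yc yd] := yP n.
have a0 : a <= sa n.
  by apply: (incr sa _ 0%N n) => // k; have [] := qE k.
have b0 : sb n <= b.
  by apply: (decr sb _ 0%N n) => // k; have [] := qE k.
have c0 : c <= sc n.
  by apply: (incr sc _ 0%N n) => // k; have [] := qE k.
have d0 : sd n <= d.
  by apply: (decr sd _ 0%N n) => // k; have [] := qE k.
rewrite xa xb yc yd a0 b0 c0 d0; split => //; split.
- elim: n {xa xb yc yd a0 b0 c0 d0} => [|n IH]; first by rewrite expr0 divr1.
  have [_ _ _ _ [-> _]] := qE n; rewrite IH exprS invfM mulrA mulrAC.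
  by rewrite -!mulrA.
- elim: n {xa xb yc yd a0 b0 c0 d0} => [|n IH]; first by rewrite expr0 divr1.
  have [_ _ _ _ [_ ->]] := qE n; rewrite IH exprS invfM mulrA mulrAC.
  by rewrite -!mulrA.
- by have [] := okE n.
Qed.

Lemma exp2_small (M r : R) : 0 < r -> exists n, M / 2 ^+ n < r.
Proof.
move=> r0; have [M0|M0] := leP M 0.
  by exists 0%N; rewrite expr0 divr1 (le_lt_trans M0).
have [n nP] : exists n : nat, M / r < n%:R.
  by exists (Num.truncn (M / r)).+1; exact: truncnS_gt.
exists n; rewrite ltr_pdivrMr ?exprn_gt0// mulrC -ltr_pdivrMr//.
by rewrite (lt_le_trans nP)// -natrX ler_nat ltnW// ltn_expl.
Qed.

End Bisection.

(** * Integrals of complex-valued functions on an interval *)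

Section Integral.
Context {R : realType}.
Local Notation C := (plane R).
Implicit Types (a b c t s : R) (F G g f : R -> C) (z k : C).

Lemma re_mulrc z t : re (z * rc t) = re z * t.
Proof. by case: z => x y; rewrite /re /rc /GRing.mul /= mulr0 subr0. Qed.

Lemma im_mulrc z t : im (z * rc t) = im z * t.
Proof. by case: z => x y; rewrite /im /rc /GRing.mul /= mulr0 add0r. Qed.

(** One-sided at the end points: nothing is asked of [F] outside [[a, b]]. *)
Definition wder F a b t (d : C) := forall e : R, 0 < e ->
  exists2 r : R, 0 < r & forall s, a <= s <= b -> `|s - t| < r ->
    nm (F s - F t - d * rc (s - t)) <= e * `|s - t|.

(** If the bound failed with some slack [e'], it would fail with the same slack on one half of the
    interval; on short intervals around the limit point this contradicts differentiability there. *)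
Lemma mean_value F g a b (M : R) : a <= b ->
  (forall t, a <= t <= b -> wder F a b t (g t)) ->
  (forall t, a <= t <= b -> nm (g t) <= M) ->
  nm (F b - F a) <= M * (b - a).
Proof.
move=> ab dF gM; apply/ler_addgt0Pr => e e0.
have [->|neq] := eqVneq a b; first by rewrite !subrr nm0 mulr0 add0r ltW.
have ab' : 0 < b - a by rewrite subr_gt0 lt_neqAle neq.
pose e' := e / (b - a); have e'0 : 0 < e' by rewrite divr_gt0.
rewrite -(divfK (lt0r_neq0 ab') e) -/e' -mulrDl leNgt; apply/negP => bad.
have [n a1 b1 c1 d1 ab1 _ bad1 m m'|x [y h]] := @bisection R
    (fun _ a b _ _ => (M + e') * (b - a) < nm (F b - F a)) a b 0 0 ab (lexx 0) bad.
- have [h1|h1] := ltP ((M + e') * (m - a1)) (nm (F m - F a1)); first by constructor 1.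
  constructor 2; rewrite ltNge; apply/negP => h2; move: bad1; apply/negP.
  rewrite -leNgt (le_trans (nm_triangle (F m) _ _))// (le_trans (lerD h2 h1))//.
  by rewrite -mulrDr addrA subrK.
have [a0 [b0 [c0 [d0 [/andP[aa0 a0x] /andP[xb0 b0b] _ _ _]]]]] := h 0%N.
have xab : a <= x <= b by rewrite (le_trans aa0 a0x) (le_trans xb0 b0b).
have [r r0 hr] := dF _ xab _ e'0.
have [n nr] := exp2_small (b - a) r0.
have [a' [b' [c' [d' [/andP[aa' a'x] /andP[xb' b'b] _ _ [l _]]]]]] := h n.
apply/negP; rewrite -leNgt.
have H1 := hr b' ltac:(by rewrite b'b andbT (le_trans _ xb')//; case/andP: xab)
  ltac:(by move: nr; rewrite -l ger0_norm; clear -a'x xb'; lra).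
have H2 := hr a' ltac:(by rewrite aa'/= (le_trans a'x)//; case/andP: xab)
  ltac:(by move: nr; rewrite -l ler0_norm; clear -a'x xb'; lra).
rewrite (_ : F b' - F a' = (F b' - F x - g x * rc (b' - x)) -
  (F a' - F x - g x * rc (a' - x)) + g x * rc (b' - a')); last first.
  by rewrite !rcB; ring.
rewrite (le_trans (nmD _ _))// mulrDl addrC lerD//.
  rewrite nmM nm_rc ger0_norm ?subr_ge0 ?(le_trans a'x)// ler_wpM2r ?gM//.
  by rewrite subr_ge0 (le_trans a'x).
rewrite (le_trans (nmD _ _))// nmN (le_trans (lerD H1 H2))// -mulrDr.
rewrite ler_pM2l// ger0_norm ?subr_ge0// ler0_norm ?subr_le0//; lra.
Qed.

Definition prim g a b F := forall t, a <= t <= b -> wder F a b t (g t).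

(** The increment of a primitive, the zero function replacing a missing one. By the mean value
    inequality the choice does not matter, and linearity and splitting become algebra. *)
Definition cint g a b : C :=
  let F := xget (fun=> 0) [set F | prim g a b F] in F b - F a.

Lemma wderB F G a b t z k : wder F a b t z -> wder G a b t k ->
  wder (fun s => F s - G s) a b t (z - k).
Proof.
move=> hF hG e e0; have e20 : 0 < e / 2 by rewrite divr_gt0.
have [r r0 h] := hF _ e20; have [r' r'0 h'] := hG _ e20.
exists (Num.min r r'); first by rewrite lt_min r0.
move=> s sab; rewrite lt_min => /andP[/(h _ sab) H /(h' _ sab) H'].
rewrite (_ : _ - _ - _ = (F s - F t - z * rc (s - t)) -
  (G s - G t - k * rc (s - t))); last by ring.
by rewrite (le_trans (nmD _ _))// nmN [e]splitr mulrDl lerD.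
Qed.

Lemma wderMl F a b t z k : wder F a b t z ->
  wder (fun s => k * F s) a b t (k * z).
Proof.
move=> hF e e0; have k0 : 0 < nm k + 1 by rewrite ltr_wpDl ?nm_ge0.
have [r r0 h] := hF (e / (nm k + 1)) ltac:(by rewrite divr_gt0).
exists r => // s sab /(h _ sab) H.
rewrite (_ : _ - _ - _ = k * (F s - F t - z * rc (s - t))); last by ring.
rewrite nmM (le_trans (ler_wpM2l (nm_ge0 _) H))//.
rewrite mulrA ler_wpM2r// mulrCA ler_piMr ?ltW//.
by rewrite ltr_pdivrMr// mul1r ltrDl.
Qed.

Lemma wder_sub F a b a' b' t z : a <= a' -> b' <= b ->
  wder F a b t z -> wder F a' b' t z.
Proof.
move=> aa' bb' h e /h[r r0 hr]; exists r => // s /andP[s1 s2]; apply: hr.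
by rewrite (le_trans aa')//= (le_trans s2).
Qed.

Lemma cintE g a b F : a <= b -> prim g a b F -> cint g a b = F b - F a.
Proof.
move=> ab gF; rewrite /cint; case: xgetP => [G _ gG|/(_ F)]; last by case.
apply/eqP; rewrite -subr_eq0 -nm_eq0 eq_le nm_ge0 andbT.
have := @mean_value (fun s => G s - F s) (fun t => g t - g t) a b 0 ab.
rewrite mul0r (_ : _ - _ = G b - G a - (F b - F a)); last by ring.
by apply=> t tab; [exact: wderB (gG _ tab) (gF _ tab)|rewrite subrr nm0].
Qed.

Definition cintable g a b := exists F, prim g a b F.

Lemma eq_cint g g' a b : a <= b -> (forall t, a <= t <= b -> g t = g' t) ->
  cintable g a b -> cint g a b = cint g' a b.
Proof.
move=> ab gg' [F gF]; rewrite !(@cintE _ _ _ F)// => t tab.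
by rewrite -gg'//; exact: gF.
Qed.

Lemma cintB g g' a b : a <= b -> cintable g a b -> cintable g' a b ->
  cint (fun t => g t - g' t) a b = cint g a b - cint g' a b.
Proof.
move=> ab [F gF] [G gG]; rewrite (cintE ab gF) (cintE ab gG).
rewrite (@cintE _ _ _ (fun s => F s - G s))//; first by ring.
by move=> t tab; exact: wderB (gF _ tab) (gG _ tab).
Qed.

Lemma cintMl g k a b : a <= b -> cintable g a b ->
  cint (fun t => k * g t) a b = k * cint g a b.
Proof.
move=> ab [F gF]; rewrite (cintE ab gF) (@cintE _ _ _ (fun s => k * F s))//.
  by rewrite mulrBr.
by move=> t tab; exact: wderMl (gF _ tab).
Qed.

Lemma cint_split g a b c : a <= b -> b <= c -> cintable g a c ->
  cint g a c = cint g a b + cint g b c.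
Proof.
move=> ab bc [F gF]; rewrite !(@cintE _ _ _ F)//; first by ring.
- by move=> t /andP[bt tc]; apply: wder_sub (gF _ _) => //; rewrite (le_trans ab bt).
- by move=> t /andP[bt tc]; apply: wder_sub (gF _ _) => //; rewrite bt (le_trans tc bc).
- exact: le_trans bc.
Qed.

Lemma cintableB g g' a b : cintable g a b -> cintable g' a b ->
  cintable (fun t => g t - g' t) a b.
Proof.
move=> [F gF] [G gG]; exists (fun s => F s - G s) => t tab.
exact: wderB (gF _ tab) (gG _ tab).
Qed.

Lemma cint_bound g a b (M : R) : a <= b -> cintable g a b ->
  (forall t, a <= t <= b -> nm (g t) <= M) -> nm (cint g a b) <= M * (b - a).
Proof. by move=> ab [F gF] gM; rewrite (cintE ab gF); exact: mean_value gM. Qed.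

Lemma cint_point g a : cint g a a = 0.
Proof. by rewrite /cint subrr. Qed.

Lemma cint_cst k a b : a <= b -> cint (fun=> k) a b = k * rc (b - a).
Proof.
move=> ab; rewrite (@cintE _ _ _ (fun s => k * rc s))// ?rcB ?mulrBr//.
move=> t tab e e0; exists 1 => // s _ _.
by rewrite !rcB mulrBr subrr nm0 mulr_ge0// ltW.
Qed.

Definition wcont g a b t := forall e : R, 0 < e -> exists2 r : R, 0 < r &
  forall s, a <= s <= b -> `|s - t| < r -> nm (g s - g t) < e.

Lemma is_derive_real_eps (F : R -> R) t (d : R) : is_derive t 1 F d ->
  forall e : R, 0 < e -> exists2 r : R, 0 < r & forall s, `|s - t| < r ->
    `|F s - F t - d * (s - t)| <= e * `|s - t|.
Proof.
move=> [dF F'] e e0.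
have := dF; rewrite /derivable => /cvgrPdist_lt /(_ _ e0) /nbhs_ballP[r /= r0 hr].
exists r => // s sr.
have [->|st] := eqVneq s t; first by rewrite !subrr mulr0 subr0 normr0 mulr0.
have := hr (s - t); rewrite /ball /= sub0r normrN => /(_ sr).
rewrite subr_eq0 => /(_ st); rewrite -/('D_1 _ t) F' /GRing.scale /= mulr1 subrK.
move=> /ltW h; rewrite (_ : _ - _ = - ((d - (s - t)^-1 * (F s - F t)) * (s - t))).
  by rewrite normrN normrM ler_wpM2r.
by field; rewrite subr_eq0.
Qed.

Let real_prim (g : R -> R) a b : continuous g ->
  exists F : R -> R, forall t, a <= t <= b -> is_derive t 1 F (g t).
Proof.
(* The integral starts at [a - 1] so that [a] is an interior point and the derivative there is
   two-sided. *)
move=> cg; pose F x := (\int[@lebesgue_measure R]_(t in `[a - 1, x]) g t)%R.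
exists F => t /andP[at' tb].
have ig : (@lebesgue_measure R).-integrable `[a - 1, b + 1] (EFin \o g).
  apply: continuous_compact_integrable; first exact: segment_compact.
  exact: continuous_subspaceT.
have tb1 : t < b + 1 by rewrite (le_lt_trans tb)// ltrDl.
have {tb1 ig} [dF] : derivable F t 1 /\ derive1 F t = g t.
  apply: (continuous_FTC1 tb1 ig _ (cg t)).
  by rewrite /Order.lt /= /lteBSide /=; lra.
by rewrite derive1E.
Qed.

(** Clamping the argument to [[a, b]] extends the real and imaginary parts continuously to the line,
    where the fundamental theorem of calculus applies. *)
Lemma cont_cintable g a b : a <= b ->
  (forall t, a <= t <= b -> wcont g a b t) -> cintable g a b.
Proof.
move=> ab cg; pose clamp t := Num.max a (Num.min b t).
have clab t : a <= clamp t <= b by rewrite /clamp; case: (leP b t) => h; [case: (leP a b)|case: (leP a t)] => h'; lra.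
have clE t : a <= t <= b -> clamp t = t.
  by rewrite /clamp; case: (leP b t) => h; [case: (leP a b)|case: (leP a t)] => h'; lra.
have cl1 s t : `|clamp s - clamp t| <= `|s - t|.
  rewrite /clamp !maxEge; have h (x y u : R) : `|(if x <= u then u else x) -
      (if y <= u then u else y)| <= `|x - y|.
    rewrite ler_norml; have := ler_norm (x - y); have := ler_norm (y - x).
    by rewrite (distrC y x); case: (leP x u) => ?; case: (leP y u) => ?; lra.
  rewrite (le_trans (h _ _ _))// !minEle; clear.
  rewrite ler_norml; have := ler_norm (s - t); have := ler_norm (t - s).
  by rewrite (distrC t s); case: (leP b s) => ?; case: (leP b t) => ?; lra.
have key (p : C -> R) : (forall x y, `|p x - p y| <= nm (x - y)) ->
    continuous (fun t => p (g (clamp t))).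
  move=> p1 t; apply/cvgrPdist_lt => e e0.
  have [r r0 hr] := cg _ (clab t) _ e0.
  apply/nbhs_ballP; exists r => // s; rewrite /ball /= distrC => sr.
  rewrite distrC (le_lt_trans (p1 _ _))// hr//.
  by rewrite (le_lt_trans (cl1 _ _)).
have [F1 h1] := @real_prim _ a b (key (@re R) ltac:(by
  move=> x y; rewrite -reN -reD; exact: re_le_nm)).
have [F2 h2] := @real_prim _ a b (key (@im R) ltac:(by
  move=> x y; rewrite -imN -imD; exact: im_le_nm)).
exists (fun t => mk (F1 t) (F2 t)) => t tab e e0.
have e20 : 0 < e / 2 by rewrite divr_gt0.
have [r1 r10 H1] := is_derive_real_eps (h1 _ tab) e20.
have [r2 r20 H2] := is_derive_real_eps (h2 _ tab) e20.
exists (Num.min r1 r2); first by rewrite lt_min r10.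
move=> s _; rewrite lt_min => /andP[/H1 + /H2]; rewrite !clE// => h3 h4.
rewrite (le_trans (nm_le_reim _))// [e]splitr mulrDl lerD//.
- by rewrite !(reD, reN, re_mk) re_mulrc.
- by rewrite !(imD, imN, im_mk) im_mulrc.
Qed.

End Integral.

(** * Rectangles: Goursat, Morera and the integral of 1/z *)

Section Rectangle.
Context {R : realType}.
Local Notation C := (plane R).
Implicit Types (a b c d x y : R) (F f g : C -> C) (z w p : C).

Lemma mkBh s t y : mk s y - mk t y = rc (s - t) :> C.
Proof. by rewrite !mkE rcB; ring. Qed.

Lemma mkBv x s t : mk x s - mk x t = cI * rc (s - t) :> C.
Proof. by rewrite !mkE rcB; ring. Qed.

Definition hint f y a b : C := cint (fun t => f (mk t y)) a b.
Definition vint f x c d : C := cI * cint (fun t => f (mk x t)) c d.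
Definition rint f a b c d : C :=
  hint f c a b + vint f b c d - hint f d a b - vint f a c d.
Definition rect a b c d : set C :=
  [set z | a <= re z <= b /\ c <= im z <= d].

Lemma rect_sub a b c d a' b' c' d' : a <= a' -> b' <= b -> c <= c' -> d' <= d ->
  rect a' b' c' d' `<=` rect a b c d.
Proof. by rewrite /rect => ? ? ? ? z /= [/andP[? ?] /andP[? ?]]; split; lra. Qed.

Lemma rect_mk a b c d x y : a <= x <= b -> c <= y <= d -> rect a b c d (mk x y).
Proof. by []. Qed.

Lemma hcintable f y a b : a <= b -> (forall t, a <= t <= b -> ccont f (mk t y)) ->
  cintable (fun t => f (mk t y)) a b.
Proof.
move=> ab cf; apply: cont_cintable => // t /cf ct e /ct[r r0 hr]; exists r => //.
by move=> s _ st; apply: hr; rewrite mkBh nm_rc.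
Qed.

Lemma vcintable f x c d : c <= d -> (forall t, c <= t <= d -> ccont f (mk x t)) ->
  cintable (fun t => f (mk x t)) c d.
Proof.
move=> ab cf; apply: cont_cintable => // t /cf ct e /ct[r r0 hr]; exists r => //.
by move=> s _ st; apply: hr; rewrite mkBv nmM nm_cI mul1r nm_rc.
Qed.

Lemma hint_ftc F f y a b : a <= b ->
  (forall t, a <= t <= b -> hasd F (mk t y) (f (mk t y))) ->
  hint f y a b = F (mk b y) - F (mk a y).
Proof.
move=> ab dF; apply: (@cintE _ _ _ _ (fun t => F (mk t y))) => // t /dF dFt.
move=> e /dFt[r r0 hr]; exists r => // s _; rewrite -nm_rc -(mkBh _ _ y).
exact: hr.
Qed.

Lemma vint_ftc F f x c d : c <= d ->
  (forall t, c <= t <= d -> hasd F (mk x t) (f (mk x t))) ->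
  vint f x c d = F (mk x d) - F (mk x c).
Proof.
move=> cd dF; rewrite /vint (@cintE _ _ _ _ (fun t => - cI * F (mk x t)))//.
  by rewrite -mulrBr mulNr mulrN mulrA cI_sqr mulN1r opprK.
move=> t /dF dFt e /dFt[r r0 hr]; exists r => // s _ st.
rewrite (_ : _ - _ - _ = - cI * (F (mk x s) - F (mk x t) -
    f (mk x t) * (mk x s - mk x t))).
  have := hr (mk x s); rewrite mkBv !nmM nmN nm_cI !mul1r nm_rc; exact.
rewrite mkBv; set I := cI; rewrite -[f _ in LHS]mul1r -[1 in LHS]opprK -cI_sqr -/I.
by ring.
Qed.

Lemma rint_ftc F f a b c d : a <= b -> c <= d ->
  (forall z, rect a b c d z -> hasd F z (f z)) -> rint f a b c d = 0.
Proof.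
move=> ab cd dF; rewrite /rint !(@hint_ftc F) ?(@vint_ftc F)//; first by ring.
all: by move=> t ht; apply: dF; apply: rect_mk; rewrite ?lexx ?ab ?cd.
Qed.

Section Cont.
Variables (f : C -> C) (a b c d : R).
Hypothesis cf : forall z, rect a b c d z -> ccont f z.

Lemma rint_splith m : a <= m <= b -> c <= d ->
  rint f a b c d = rint f a m c d + rint f m b c d.
Proof.
move=> /andP[am mb] cd; rewrite /rint /hint (@cint_split _ _ a m b)//; last first.
  apply: hcintable => [|t tab]; first exact: le_trans mb.
  by apply: cf; apply: rect_mk => //; rewrite lexx.
rewrite [cint _ a b](@cint_split _ _ a m b)//; last first.
  apply: hcintable => [|t tab]; first exact: le_trans mb.
  by apply: cf; apply: rect_mk => //; rewrite lexx cd.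
by ring.
Qed.

Lemma rint_splitv m : a <= b -> c <= m <= d ->
  rint f a b c d = rint f a b c m + rint f a b m d.
Proof.
move=> ab /andP[cm md]; rewrite /rint /vint (@cint_split _ _ c m d)//; last first.
  apply: vcintable => [|t tab]; first exact: le_trans md.
  by apply: cf; apply: rect_mk => //; rewrite lexx ab.
rewrite [cint _ c d](@cint_split _ _ c m d)//; last first.
  apply: vcintable => [|t tab]; first exact: le_trans md.
  by apply: cf; apply: rect_mk => //; rewrite lexx ab.
by ring.
Qed.

Lemma rintB g : a <= b -> c <= d -> (forall z, rect a b c d z -> ccont g z) ->
  rint (fun z => f z - g z) a b c d = rint f a b c d - rint g a b c d.
Proof.
move=> ab cd cg; rewrite /rint /hint /vint !cintB//; first by ring.
all: (apply: hcintable => // t tab || apply: vcintable => // t tab);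
  (apply: cf || apply: cg); apply: rect_mk => //; by rewrite ?lexx ?ab ?cd.
Qed.

Lemma rint_bound (M : R) : a <= b -> c <= d ->
  (forall z, rect a b c d z -> nm (f z) <= M) ->
  nm (rint f a b c d) <= M * (2 * ((b - a) + (d - c))).
Proof.
move=> ab cd fM.
have hb y : c <= y <= d -> nm (hint f y a b) <= M * (b - a).
  move=> yd; apply: cint_bound => // [|t tab]; last by apply: fM; apply: rect_mk.
  by apply: hcintable => // t tab; apply: cf; apply: rect_mk.
have vb x : a <= x <= b -> nm (vint f x c d) <= M * (d - c).
  move=> xb; rewrite nmM nm_cI mul1r.
  apply: cint_bound => // [|t tab]; last by apply: fM; apply: rect_mk.
  by apply: vcintable => // t tab; apply: cf; apply: rect_mk.
have h1 := hb c ltac:(by rewrite lexx cd); have h2 := hb d ltac:(by rewrite lexx cd).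
have h3 := vb a ltac:(by rewrite lexx ab); have h4 := vb b ltac:(by rewrite lexx ab).
rewrite /rint (le_trans (nmD _ _))// nmN.
have := nmD (hint f c a b + vint f b c d) (- hint f d a b).
have := nmD (hint f c a b) (vint f b c d); rewrite nmN => h5 h6.
move: h1 h2 h3 h4 h5 h6; lra.
Qed.

End Cont.

Lemma rint_degh f a c d : rint f a a c d = 0.
Proof. by rewrite /rint /hint !cint_point; ring. Qed.

Lemma rint_degv f a b c : rint f a b c c = 0.
Proof. by rewrite /rint /vint !cint_point; ring. Qed.

(** Some quarter keeps at least a fourth of the integral, while near the limit point the affine part
    [A] of [f] has a primitive and contributes nothing. *)
Lemma goursat f a b c d : a <= b -> c <= d -> holo (rect a b c d) f ->
  rint f a b c d = 0.
Proof.
move=> ab cd hf; apply/eqP; apply/negPn/negP; rewrite -nm_gt0.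
set eta := nm _ => eta0.
have cf z : rect a b c d z -> ccont f z by exact: holo_ccont.
have P0 : eta / 4 ^+ 0 <= nm (rint f a b c d) /\
    [/\ a <= a, b <= b, c <= c & d <= d] by rewrite expr0 divr1.
have [n a1 b1 c1 d1 ab1 cd1 [bad1 [s1 s2 s3 s4]] m m'|x [y h]] := @bisection R
  (fun n a' b' c' d' => eta / 4 ^+ n <= nm (rint f a' b' c' d') /\
    [/\ a <= a', b' <= b, c <= c' & d' <= d]) a b c d ab cd P0.
- have am : a1 <= m <= b1 by rewrite /m; clear -ab1; apply/andP; split; lra.
  have cm : c1 <= m' <= d1 by rewrite /m'; clear -cd1; apply/andP; split; lra.
  have [[am1 mb1] [cm1 md1]] := (andP am, andP cm).
  have cf1 z : rect a1 b1 c1 d1 z -> ccont f z.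
    by move=> rz; apply: cf; apply: rect_sub rz.
  have := rint_splith cf1 am cd1.
  rewrite (@rint_splitv f a1 m c1 d1 _ m')//; last first.
    by move=> z rz; apply: cf1; apply: rect_sub rz.
  rewrite (@rint_splitv f m b1 c1 d1 _ m')//; last first.
    by move=> z rz; apply: cf1; apply: rect_sub rz.
  set q1 := rint f a1 m c1 m'; set q2 := rint f a1 m m' d1.
  set q3 := rint f m b1 c1 m'; set q4 := rint f m b1 m' d1 => E.
  have E4 : eta / 4 ^+ n = 4 * (eta / 4 ^+ n.+1).
    by rewrite exprS; field; rewrite expf_neq0.
  have [h1|h1] := leP (eta / 4 ^+ n.+1) (nm q1).
    by constructor 1; split => //; split => //; clear -s1 s2 s3 s4 am1 mb1 cm1 md1; lra.
  have [h2|h2] := leP (eta / 4 ^+ n.+1) (nm q2).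
    by constructor 3; split => //; split => //; clear -s1 s2 s3 s4 am1 mb1 cm1 md1; lra.
  have [h3|h3] := leP (eta / 4 ^+ n.+1) (nm q3).
    by constructor 2; split => //; split => //; clear -s1 s2 s3 s4 am1 mb1 cm1 md1; lra.
  have [h4|h4] := leP (eta / 4 ^+ n.+1) (nm q4).
    by constructor 4; split => //; split => //; clear -s1 s2 s3 s4 am1 mb1 cm1 md1; lra.
  exfalso; move: bad1; rewrite E E4.
  have := nmD (q1 + q2) (q3 + q4); have := nmD q1 q2; have := nmD q3 q4.
  by move: h1 h2 h3 h4; clear; lra.
have rz0 : rect a b c d (mk x y).
  have [a0 [b0 [c0 [d0 [? ? ? ? _]]]]] := h 0%N.
  by apply: rect_mk; apply/andP; split; lra.
have [D hD] := hf _ rz0.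
pose S := (b - a) + (d - c); have S0 : 0 <= S by rewrite /S; lra.
(* The remainder will be at most [2 * e * S ^+ 2 / 4 ^+ n]; this [e] makes it smaller than
   [eta / 4 ^+ n]. *)
pose e := eta / (4 * (S ^+ 2 + 1)).
have S1 : 0 < S ^+ 2 + 1 by rewrite ltr_wpDl ?sqr_ge0.
have e0 : 0 < e by rewrite divr_gt0 ?mulr_gt0.
have [r r0 hr] := hD _ e0.
have [n nr] := exp2_small S r0.
have [a' [b' [c' [d' [h1 h2 h3 h4 [w1 w2 [bad [s1 s2 s3 s4]]]]]]]] := h n.
have ab' : a' <= b' by lra.
have cd' : c' <= d' by lra.
pose A z := f (mk x y) + D * (z - mk x y).
pose AF z := f (mk x y) * z + D * (z - mk x y) ^+ 2 / 2.
have dA z : hasd AF z (A z).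
  apply: hasd_eq.
    apply: hasdD; first exact: hasdMl (hasd_id _).
    apply: hasdM; last exact: hasd_cst.
    apply: hasdMl; apply: hasdM; (apply: hasdB; [exact: hasd_id|exact: hasd_cst]).
  by rewrite /A; field.
have A0 : rint A a' b' c' d' = 0 by apply: (@rint_ftc AF).
have cA z : ccont A z.
  apply: ccontD; first exact: ccont_cst.
  apply: ccontM; first exact: ccont_cst.
  by apply: ccontB; [exact: ccont_id|exact: ccont_cst].
have S'E : (b' - a') + (d' - c') = S / 2 ^+ n by rewrite w1 w2 -mulrDl.
have := @rint_bound (fun z => f z - A z) a' b' c' d' _ (e * (S / 2 ^+ n)) ab' cd' _.
rewrite rintB// ?A0 ?subr0; last by move=> z rz; apply: cf; apply: rect_sub rz.
have cf' z : rect a' b' c' d' z -> ccont f z.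
  by move=> rz; apply: cf; apply: rect_sub rz.
move=> /(_ (fun z rz => ccontB (cf' z rz) (cA z))).
move=> H.
rewrite S'E in H.
have /H{}H : forall z, rect a' b' c' d' z -> nm (f z - A z) <= e * (S / 2 ^+ n).
  move=> z [/andP[z1 z2] /andP[z3 z4]].
  rewrite /A opprD addrA.
  have zn : nm (z - mk x y) <= S / 2 ^+ n.
    rewrite (le_trans (nm_le_reim _))// reD imD reN imN re_mk im_mk -S'E.
    by rewrite lerD// ler_norml; clear -z1 z2 z3 z4 h1 h2 h3 h4; apply/andP; split; lra.
  rewrite (le_trans (hr _ _))//; first exact: le_lt_trans nr.
  by rewrite ler_wpM2l// ltW.
have := le_trans bad H; apply/negP; rewrite -ltNge.
rewrite (_ : e * _ * _ = 2 * e * S ^+ 2 / 4 ^+ n); last first.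
  have -> : (4 : R) ^+ n = 2 ^+ n * 2 ^+ n by rewrite -exprMn; congr (_ ^+ _); clear; lra.
  by field; rewrite expf_neq0.
rewrite ltr_pM2r ?invr_gt0 ?exprn_gt0// /e.
rewrite (_ : 2 * _ * _ = eta * (S ^+ 2 / (2 * (S ^+ 2 + 1)))); last first.
  by field; rewrite gt_eqF.
rewrite -[ltRHS]mulr1 ltr_pM2l// ltr_pdivrMr ?mulr_gt0// mul1r.
by have := sqr_ge0 S; clear; lra.
Qed.

(** The disjunction says that the strip cut off is degenerate or misses the point. *)
Lemma clip_lo (a p e : R) : a <= p -> 0 < e ->
  exists a', [/\ a <= a', p - e <= a' <= p & a' = a \/ a' < p].
Proof.
move=> ap e0; exists (Num.max a (p - e)).
by case: (leP a (p - e)) => h; split; first [lra|by left; lra|by right; lra].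
Qed.

Lemma clip_hi (b p e : R) : p <= b -> 0 < e ->
  exists b', [/\ b' <= b, p <= b' <= p + e & b' = b \/ p < b'].
Proof.
move=> ap e0; exists (Num.min b (p + e)).
by case: (leP b (p + e)) => h; split; first [lra|by left; lra|by right; lra].
Qed.

(** Strips missing [p] are cut off on four sides; what remains is a rectangle around [p] on which
    [f] is bounded and whose perimeter is arbitrarily small. *)
Lemma goursat_except f a b c d p : a <= b -> c <= d ->
  (forall z, rect a b c d z -> ccont f z) ->
  (forall z, rect a b c d z -> z != p -> exists D, hasd f z D) ->
  rint f a b c d = 0.
Proof.
move=> ab cd cf hf.
have [rp|nrp] := pselect (rect a b c d p); last first.
  by apply: goursat => // z rz; apply: hf => //; apply: contra_not_neq nrp => <-.
have g0 a' b' c' d' : a <= a' -> a' <= b' -> b' <= b -> c <= c' -> c' <= d' ->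
    d' <= d -> ~ rect a' b' c' d' p -> rint f a' b' c' d' = 0.
  move=> h1 h2 h3 h4 h5 h6 np; apply: goursat => // z rz; apply: hf.
    exact: rect_sub rz.
  by apply: contra_not_neq np => <-.
apply/eqP; rewrite -nm_eq0 eq_le nm_ge0 andbT; apply/ler_addgt0Pr => e e0.
rewrite add0r; have [r r0 hr] := cf _ rp _ ltr01.
pose k := nm (f p) + 1; have k0 : 0 < k by rewrite ltr_wpDl ?nm_ge0.
(* Points of the small rectangle are within [2 * dl], less than [r], of [p], and its perimeter is at
   most [8 * dl]. *)
pose dl := Num.min (r / 3) (e / (8 * k)).
have dl0 : 0 < dl by rewrite lt_min !divr_gt0// mulr_gt0.
have dlr : dl * 3 <= r by rewrite -ler_pdivlMr// ge_min lexx.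
have dle : k * (8 * dl) <= e.
  by rewrite mulrA mulrC (mulrC k) -ler_pdivlMr ?mulr_gt0// ge_min lexx orbT.
move: rp => [/andP[pa pb] /andP[pc pd]].
have [a' [aa' pda' a'E]] := clip_lo pa dl0.
have [b' [bb' pdb' b'E]] := clip_hi pb dl0.
have [c' [cc' pdc' c'E]] := clip_lo pc dl0.
have [d' [dd' pdd' d'E]] := clip_hi pd dl0.
have [h1 h2 h3 h4] : [/\ a' <= re p, re p <= b', c' <= im p & im p <= d'].
  by split; [case/andP: pda'|case/andP: pdb'|case/andP: pdc'|case/andP: pdd'].
have ab' := le_trans h1 h2; have cd' := le_trans h3 h4.
have cs a1 b1 c1 d1 : a <= a1 -> b1 <= b -> c <= c1 -> d1 <= d ->
    forall z, rect a1 b1 c1 d1 z -> ccont f z.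
  by move=> ? ? ? ? z rz; apply: cf; apply: rect_sub rz.
have -> : rint f a b c d = rint f a' b' c' d'.
  have a'b := le_trans ab' bb'; have c'd := le_trans cd' dd'.
  rewrite (@rint_splith f a b c d _ a')//; last by rewrite aa'.
  rewrite (_ : rint f a a' c d = 0) ?add0r; last first.
    case: a'E => [->|h]; first exact: rint_degh.
    by apply: g0; rewrite ?lexx// => -[/andP[_]]; rewrite leNgt h.
  rewrite (@rint_splith f a' b c d _ b'); [|exact: cs|by rewrite ab'|done].
  rewrite (_ : rint f b' b c d = 0) ?addr0; last first.
    case: b'E => [->|h]; first exact: rint_degh.
    apply: g0; rewrite ?lexx//; first exact: le_trans ab'.
    by move=> [/andP[]]; rewrite leNgt h.
  rewrite (@rint_splitv f a' b' c d _ c'); [|exact: cs|done|by rewrite cc'].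
  rewrite (_ : rint f a' b' c c' = 0) ?add0r; last first.
    case: c'E => [->|h]; first exact: rint_degv.
    by apply: g0; rewrite ?lexx// => -[_ /andP[_]]; rewrite leNgt h.
  rewrite (@rint_splitv f a' b' c' d _ d'); [|exact: cs|done|by rewrite cd'].
  rewrite (_ : rint f a' b' d' d = 0) ?addr0//.
  case: d'E => [->|h]; first exact: rint_degv.
  apply: g0; rewrite ?lexx//; first exact: le_trans cd'.
  by move=> [_ /andP[]]; rewrite leNgt h.
have cf' := cs a' b' c' d' aa' bb' cc' dd'.
have fk z : rect a' b' c' d' z -> nm (f z) <= k.
  move=> [/andP[z1 z2] /andP[z3 z4]]; rewrite /k -lerBlDl.
  rewrite (le_trans (nm_subl _ _))// ltW// hr//.
  rewrite (le_lt_trans (nm_le_reim _))// reD imD reN imN.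
  have : `|re z - re p| <= dl.
    by rewrite ler_norml; clear -z1 z2 pda' pdb'; lra.
  have : `|im z - im p| <= dl.
    by rewrite ler_norml; clear -z3 z4 pdc' pdd'; lra.
  by clear -dlr dl0; lra.
have := rint_bound cf' ab' cd' fk.
move=> H; apply: le_trans dle; rewrite (le_trans H)// ler_wpM2l ?(ltW k0)//.
by clear -pda' pdb' pdc' pdd'; lra.
Qed.

(** The primitive integrates along the bottom side and then vertically. Vanishing over rectangles
    gives its increments along every horizontal segment, and a nearby point is reached by one
    vertical and one horizontal step. *)
Lemma morera_square f a b c d :
  (forall z, rect a b c d z -> ccont f z) ->
  (forall a' b' c' d', a <= a' -> a' <= b' -> b' <= b -> c <= c' -> c' <= d' ->
    d' <= d -> rint f a' b' c' d' = 0) ->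
  exists F, forall z, a < re z < b -> c < im z < d -> hasd F z (f z).
Proof.
move=> cf f0; pose F z := hint f c a (re z) + vint f (re z) c (im z).
have Fh x x' y : a <= x -> x <= x' -> x' <= b -> c <= y <= d ->
    F (mk x' y) - F (mk x y) = hint f y x x'.
  move=> ax xx' x'b /andP[cy yd]; rewrite /F !re_mk !im_mk.
  have := f0 x x' c y ax xx' x'b (lexx _) cy yd; rewrite /rint.
  rewrite {2 3}/hint (@cint_split _ _ a x x')// -?/(hint _ _ _ _); last first.
    apply: hcintable; first exact: le_trans xx'.
    move=> t /andP[at' tx']; apply: cf; apply: rect_mk; last by rewrite lexx (le_trans cy).
    by rewrite at' (le_trans tx').
  set u := hint f c x x'; set v := vint f x' c y; set w := hint f y x x'.
  set s := vint f x c y; rewrite -/(hint f c a x) => E.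
  have {E} : u + v - s = w by move/eqP: E; rewrite addrAC subr_eq0 => /eqP <-; ring.
  by move=> <-; ring.
have Fv x y y' : c <= y -> y <= y' -> y' <= d -> a <= x <= b ->
    F (mk x y') - F (mk x y) = vint f x y y'.
  move=> cy yy' y'd /andP[ax xb]; rewrite /F !re_mk !im_mk.
  rewrite {1}/vint (@cint_split _ _ c y y')//; first by rewrite /vint; ring.
  apply: vcintable; first exact: le_trans yy'.
  move=> t /andP[ct ty']; apply: cf; apply: rect_mk; first by rewrite ax.
  by rewrite ct (le_trans ty').
have bh x x' y k e : a <= x <= b -> a <= x' <= b -> c <= y <= d ->
    (forall t, `|t - x| <= `|x' - x| -> a <= t <= b -> nm (f (mk t y) - k) <= e) ->
    nm (F (mk x' y) - F (mk x y) - k * rc (x' - x)) <= e * `|x' - x|.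
  move=> xab x'ab ycd hk.
  have key u v : a <= u <= b -> a <= v <= b -> u <= v ->
    (forall t, u <= t <= v -> nm (f (mk t y) - k) <= e) ->
      nm (F (mk v y) - F (mk u y) - k * rc (v - u)) <= e * (v - u).
    move=> uab vab uv huv; rewrite Fh//; [|clear -uab; lra|clear -vab; lra].
    have ci : cintable (fun t => f (mk t y)) u v.
      apply: hcintable => // t tuv; apply: cf; apply: rect_mk => //.
      by move: uab vab tuv; clear; lra.
    have cc : cintable (fun=> k) u v.
      apply: cont_cintable => // t _ e1 e10; exists 1 => // s _ _.
      by rewrite subrr nm0.
    rewrite -cint_cst// -cintB//; apply: cint_bound => //.
    case: ci cc => G1 g1 [G2 g2]; exists (fun s => G1 s - G2 s) => t tuv.
    exact: wderB (g1 _ tuv) (g2 _ tuv).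
  have [xx'|x'x] := leP x x'.
    rewrite ger0_norm ?subr_ge0//; apply: key => // t /andP[t1 t2]; apply: hk.
      by rewrite !ger0_norm ?subr_ge0// lerD2r.
    by clear -xab x'ab t1 t2; lra.
  rewrite -nmN (_ : - _ = F (mk x y) - F (mk x' y) - k * rc (x - x')).
    rewrite ltr0_norm ?subr_lt0// opprB; apply: key => //; first exact: ltW.
    move=> t /andP[t1 t2]; apply: hk.
      by rewrite !ler0_norm ?subr_le0 ?(ltW x'x)//; lra.
    by clear -xab x'ab t1 t2; lra.
  by rewrite !rcB; ring.
have bv x y y' k e : a <= x <= b -> c <= y <= d -> c <= y' <= d ->
    (forall t, `|t - y| <= `|y' - y| -> c <= t <= d -> nm (f (mk x t) - k) <= e) ->
    nm (F (mk x y') - F (mk x y) - k * (cI * rc (y' - y))) <= e * `|y' - y|.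
  move=> xab ycd y'cd hk.
  have key u v : c <= u <= d -> c <= v <= d -> u <= v ->
    (forall t, u <= t <= v -> nm (f (mk x t) - k) <= e) ->
      nm (F (mk x v) - F (mk x u) - k * (cI * rc (v - u))) <= e * (v - u).
    move=> uab vab uv huv; rewrite Fv//; [|clear -uab; lra|clear -vab; lra].
    have ci : cintable (fun t => f (mk x t)) u v.
      apply: vcintable => // t tuv; apply: cf; apply: rect_mk => //.
      by move: uab vab tuv; clear; lra.
    have cc : cintable (fun=> k) u v.
      apply: cont_cintable => // t _ e1 e10; exists 1 => // s _ _.
      by rewrite subrr nm0.
    rewrite /vint mulrCA -mulrBr nmM nm_cI mul1r -cint_cst// -cintB//.
    apply: cint_bound => //.
    case: ci cc => G1 g1 [G2 g2]; exists (fun s => G1 s - G2 s) => t tuv.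
    exact: wderB (g1 _ tuv) (g2 _ tuv).
  have [xx'|x'x] := leP y y'.
    rewrite ger0_norm ?subr_ge0//; apply: key => // t /andP[t1 t2]; apply: hk.
      by rewrite !ger0_norm ?subr_ge0// lerD2r.
    by clear -ycd y'cd t1 t2; lra.
  rewrite -nmN (_ : - _ = F (mk x y) - F (mk x y') - k * (cI * rc (y - y'))).
    rewrite ltr0_norm ?subr_lt0// opprB; apply: key => //; first exact: ltW.
    move=> t /andP[t1 t2]; apply: hk.
      by rewrite !ler0_norm ?subr_le0 ?(ltW x'x)//; lra.
    by clear -ycd y'cd t1 t2; lra.
  by rewrite !rcB; ring.
exists F => z zab zcd e e0; have e20 : 0 < e / 2 by rewrite divr_gt0.
have rz : rect a b c d z by split; lra.
have [r r0 hr] := cf _ rz _ e20.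
pose r' := Num.min (r / 2) (Num.min (Num.min (re z - a) (b - re z))
  (Num.min (im z - c) (d - im z))).
exists r'; first by rewrite !lt_min divr_gt0//; lra.
move=> w; rewrite !lt_min => /andP[wr /andP[/andP[w1 w2] /andP[w3 w4]]].
have wre : `|re w - re z| <= nm (w - z) by rewrite -reN -reD re_le_nm.
have wim : `|im w - im z| <= nm (w - z) by rewrite -imN -imD im_le_nm.
have rew : a <= re w <= b.
  by move: wre; rewrite ler_norml; clear -w1 w2; lra.
have imw : c <= im w <= d.
  by move: wim; rewrite ler_norml; clear -w3 w4; lra.
have near x y : `|x - re z| <= nm (w - z) -> `|y - im z| <= nm (w - z) ->
    nm (f (mk x y) - f z) <= e / 2.
  move=> h1 h2; rewrite ltW// hr// (le_lt_trans (nm_le_reim _))//.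
  by rewrite reD imD reN imN re_mk im_mk; clear -h1 h2 wr; lra.
have [rz1 rz2] := rz.
have := bh (re z) (re w) (im w) (f z) (e / 2) rz1 rew imw
  (fun t h _ => near _ _ (le_trans h wre) wim).
rewrite mk_re_im => H1.
have zz : `|re z - re z| <= nm (w - z) by rewrite subrr normr0 nm_ge0.
have := bv (re z) (im z) (im w) (f z) (e / 2) rz1 rz2 imw
  (fun t h _ => near _ _ zz (le_trans h wim)).
rewrite mk_re_im => H2.
rewrite (_ : _ - _ - _ = (F w - F (mk (re z) (im w)) - f z * rc (re w - re z)) +
  (F (mk (re z) (im w)) - F z - f z * (cI * rc (im w - im z)))); last first.
  have wz : w - z = rc (re w - re z) + cI * rc (im w - im z).
    by rewrite -{1}(mk_re_im w) -{1}(mk_re_im z) !mkE !rcB; ring.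
  by rewrite wz; ring.
rewrite (le_trans (nmD _ _))// (le_trans (lerD H1 H2))// -mulrDr.
rewrite mulrAC ler_pdivrMr// -mulrA ler_pM2l//; clear -wre wim; lra.
Qed.

(** The number 2 pi i. *)
Definition tpi : C := cI * rc (pi + pi).

Lemma tpi_neq0 : tpi != 0.
Proof. by rewrite mulf_neq0 ?cI_neq0// rc_eq0 gt_eqF// addr_gt0 ?pi_gt0. Qed.

Lemma atan_prim (x0 r : R) a b : 0 < r ->
  prim (fun t => rc (2 * r / ((t - x0) ^+ 2 + r ^+ 2)) : C) a b
    (fun t => rc (2 * atan ((t - x0) / r))).
Proof.
move=> r0 t _ e e0.
have : is_derive t 1 (fun t => 2 * atan ((t - x0) / r))
    (2 * r / ((t - x0) ^+ 2 + r ^+ 2)).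
  apply: is_derive_eq.
  rewrite /GRing.scale /= !(mulr0, addr0, subr0, mulr1).
  have h1 : (t - x0) ^+ 2 + r ^+ 2 != 0.
    by rewrite gt_eqF// ltr_wpDl ?sqr_ge0// exprn_gt0.
  field; rewrite h1 gt_eqF//=.
move=> /is_derive_real_eps /(_ _ e0)[s s0 hs]; exists s => // u _ /hs.
by rewrite -!rcB -rcM -rcB nm_rc.
Qed.

Lemma cint_atan (x0 r : R) (k : C) : 0 < r ->
  cint (fun t => k * rc (2 * r / ((t - x0) ^+ 2 + r ^+ 2))) (x0 - r) (x0 + r) =
  k * rc pi.
Proof.
move=> r0; have ab : x0 - r <= x0 + r by lra.
have P := @atan_prim x0 r (x0 - r) (x0 + r) r0.
rewrite cintMl//; last by eexists; exact: P.
rewrite (cintE ab P); congr (_ * _).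
rewrite -rcB addrAC subrr add0r (addrAC x0) subrr sub0r mulNr divff ?gt_eqF//.
by rewrite atanN atan1; congr rc; field.
Qed.

(** Combining opposite sides leaves [2 * r / (s ^+ 2 + r ^+ 2)] up to a constant factor, with an
    arctangent as primitive; each pair of sides contributes [cI * rc pi]. *)
Lemma rint_inv (x0 y0 r : R) : 0 < r ->
  rint (fun w => (w - mk x0 y0)^-1) (x0 - r) (x0 + r) (y0 - r) (y0 + r) = tpi.
Proof.
move=> r0; set f := fun w => _.
have cf w : w != mk x0 y0 -> ccont f w.
  move=> w0; apply: ccontV; first by rewrite subr_eq0.
  by apply: ccontB; [exact: ccont_id|exact: ccont_cst].
have sq0 (s : R) : rc (s ^+ 2 + r ^+ 2) != 0 :> C.
  by rewrite rc_eq0 gt_eqF// ltr_wpDl ?sqr_ge0// exprn_gt0.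
have facE (u v : C) : (u - cI * v) * (u + cI * v) = u ^+ 2 + v ^+ 2.
  set I := cI; rewrite -[v ^+ 2]mul1r -[1]opprK -cI_sqr -/I; ring.
have fac1 (s : R) : rc (s ^+ 2 + r ^+ 2) = (rc s - cI * rc r) * (rc s + cI * rc r) :> C.
  by rewrite facE rcD !expr2 !rcM.
have fac2 (s : R) : rc (s ^+ 2 + r ^+ 2) = (rc r - cI * rc s) * (rc r + cI * rc s) :> C.
  by rewrite facE rcD !expr2 !rcM addrC.
have n1 (s : R) : rc s - cI * rc r != 0 :> C.
  by apply: contraNneq (sq0 s); rewrite fac1 => ->; rewrite mul0r.
have n2 (s : R) : rc s + cI * rc r != 0 :> C.
  by apply: contraNneq (sq0 s); rewrite fac1 => ->; rewrite mulr0.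
have n3 (s : R) : rc r - cI * rc s != 0 :> C.
  by apply: contraNneq (sq0 s); rewrite fac2 => ->; rewrite mul0r.
have n4 (s : R) : rc r + cI * rc s != 0 :> C.
  by apply: contraNneq (sq0 s); rewrite fac2 => ->; rewrite mulr0.
have hneq t y : y != y0 -> mk t y != mk x0 y0 :> C.
  by apply: contra_neq => /(congr1 (@im R)).
have vneq x t : x != x0 -> mk x t != mk x0 y0 :> C.
  by apply: contra_neq => /(congr1 (@re R)).
have ab : x0 - r <= x0 + r by lra.
have cd : y0 - r <= y0 + r by lra.
have hc y : y != y0 -> cintable (fun t => f (mk t y)) (x0 - r) (x0 + r).
  by move=> yy; apply: hcintable => // t _; apply: cf; exact: hneq.
have vc x : x != x0 -> cintable (fun t => f (mk x t)) (y0 - r) (y0 + r).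
  by move=> xx; apply: vcintable => // t _; apply: cf; exact: vneq.
have r1 (x : R) : x - r != x by rewrite lt_eqF//; lra.
have r2 (x : R) : x + r != x by rewrite gt_eqF//; lra.
have hE : hint f (y0 - r) (x0 - r) (x0 + r) - hint f (y0 + r) (x0 - r) (x0 + r) = cI * rc pi.
  rewrite /hint -cintB//; [|exact: hc|exact: hc].
  rewrite -(@cint_atan x0 r cI r0); apply: eq_cint => //; last first.
    by apply: cintableB; exact: hc.
  move=> t _; rewrite /f !rcM rcV fac1 !mkE !rcB !rcD.
  rewrite (_ : rc t + _ - _ = rc (t - x0) - cI * rc r); last by rewrite rcB; ring.
  rewrite (_ : rc t + _ - _ = rc (t - x0) + cI * rc r); last by rewrite rcB; ring.
  have := n1 (t - x0); have := n2 (t - x0); rewrite !rcB => h1 h2; rewrite !rc1.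
  by field; rewrite h1 h2.
have vE : vint f (x0 + r) (y0 - r) (y0 + r) - vint f (x0 - r) (y0 - r) (y0 + r) = cI * rc pi.
  rewrite /vint -mulrBr -cintB//; [|exact: vc|exact: vc].
  congr (_ * _); rewrite -[RHS]mul1r -(@cint_atan y0 r 1 r0); apply: eq_cint => //; last first.
    by apply: cintableB; exact: vc.
  move=> t _; rewrite /f mul1r !rcM rcV fac2 !mkE !rcB !rcD.
  rewrite (_ : rc x0 + _ + _ - _ = rc r + cI * rc (t - y0)); last by rewrite rcB; ring.
  rewrite (_ : rc x0 - _ + _ - _ = - (rc r - cI * rc (t - y0))); last by rewrite rcB; ring.
  have := n3 (t - y0); have := n4 (t - y0); rewrite !rcB => h1 h2; rewrite !rc1.
  by field; rewrite h1 h2.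
rewrite /rint (_ : forall u v w s : C, u + v - w - s = (u - w) + (v - s)); last by move=> *; ring.
by rewrite hE vE /tpi rcD mulrDr.
Qed.

End Rectangle.

(** * Compact subsets of the plane *)

Section CompactPlane.
Context {R : realType}.
Local Notation C := (plane R).
Implicit Types (z w p : C) (K : set C) (f : C -> C).

Lemma open_ball z (r : R) : open [set w : C | nm (w - z) < r].
Proof.
apply/open_planeP => w /= wz; exists (r - nm (w - z)); first by rewrite subr_gt0.
by move=> u uw; rewrite (le_lt_trans (nm_triangle w _ _))//; lra.
Qed.

Lemma compact_ball_cover K (r : C -> R) : compact K -> (forall z, K z -> 0 < r z) ->
  exists2 s : seq C, (forall z, z \in s -> K z) &
    forall w, K w -> exists2 z, z \in s & nm (w - z) < r z.
Proof.
rewrite compact_cover => cK r0.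
have [|w Kw|D DK KD] := cK _ K (fun z => [set w | nm (w - z) < r z]).
- by move=> z _; exact: open_ball.
- by exists w => //=; rewrite subrr nm0 r0.
exists (finmap.enum_fset D) => [z zD|w /KD[z /= zD wz]]; last by exists z.
by have := DK z zD; rewrite inE.
Qed.

Lemma seq_min_pos (T : eqType) (s : seq T) (r : T -> R) :
  (forall x, x \in s -> 0 < r x) ->
  exists2 e : R, 0 < e & forall x, x \in s -> e <= r x.
Proof.
elim: s => [|x s IH] h; first by exists 1.
have [|e e0 he] := IH; first by move=> y ys; apply: h; rewrite inE ys orbT.
exists (Num.min e (r x)); first by rewrite lt_min e0 h// mem_head.
move=> y; rewrite inE => /orP[/eqP->|/he yr]; first by rewrite ge_min lexx orbT.
by rewrite ge_min yr.
Qed.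

Lemma seq_max_bound (T : eqType) (s : seq T) (r : T -> R) :
  exists2 M : R, 0 <= M & forall x, x \in s -> r x <= M.
Proof.
elim: s => [|x s [M M0 hM]]; first by exists 0.
exists (Num.max M (r x)); first by rewrite le_max M0.
move=> y; rewrite inE => /orP[/eqP->|/hM yr]; first by rewrite le_max lexx orbT.
by rewrite le_max yr.
Qed.

Lemma compact_bound_near K (g : C -> R) : compact K ->
  (forall z, K z -> exists M r : R, 0 < r /\ forall w, K w -> nm (w - z) < r -> g w <= M) ->
  exists2 M : R, 0 <= M & forall z, K z -> g z <= M.
Proof.
move=> cK h.
have h' z : exists Mr : R * R, K z -> 0 < Mr.2 /\
    forall w, K w -> nm (w - z) < Mr.2 -> g w <= Mr.1.
  have [/h[M [r hr]]|nK] := pselect (K z); first by exists (M, r).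
  by exists (0, 0).
pose F z := projT1 (cid (h' z)).
have FP z : K z -> 0 < (F z).2 /\
    forall w, K w -> nm (w - z) < (F z).2 -> g w <= (F z).1.
  exact: projT2 (cid (h' z)).
have [s sK Ks] := compact_ball_cover cK (fun z Kz => proj1 (FP z Kz)).
have [M M0 hM] := seq_max_bound s (fun z => (F z).1).
exists M => // w Kw; have [z zs wz] := Ks _ Kw.
by rewrite (le_trans _ (hM _ zs))//; apply: (proj2 (FP z (sK _ zs))).
Qed.

Lemma compact_pos_near K (g : C -> R) : compact K ->
  (forall z, K z -> exists2 r : R, 0 < r & forall w, K w -> nm (w - z) < r -> r <= g w) ->
  exists2 e : R, 0 < e & forall z, K z -> e <= g z.
Proof.
move=> cK h.
have [|M M0 hM] := @compact_bound_near K (fun z => (g z)^-1) cK.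
  move=> z /h[r r0 hr]; exists r^-1, r; split => // w Kw /(hr _ Kw) rg.
  by rewrite lef_pV2 ?posrE// (lt_le_trans r0).
have g0 z : K z -> 0 < g z.
  move=> Kz; have [r r0 hr] := h _ Kz.
  by rewrite (lt_le_trans r0)// hr// subrr nm0.
exists (M + 1)^-1; first by rewrite invr_gt0; lra.
move=> z Kz; rewrite invf_ple ?posrE ?g0//; last by lra.
by have := hM _ Kz; lra.
Qed.

Lemma compact_cont_bound K f : compact K -> (forall z, K z -> ccont f z) ->
  exists2 M : R, 0 <= M & forall z, K z -> nm (f z) <= M.
Proof.
move=> cK cf; apply: compact_bound_near => // z Kz.
have [r r0 hr] := cf _ Kz _ ltr01; exists (nm (f z) + 1), r; split => // w _ /hr.
by have := nm_subl (f w) (f z); lra.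
Qed.

Lemma compact_cont_pos K f : compact K -> (forall z, K z -> ccont f z) ->
  (forall z, K z -> f z != 0) ->
  exists2 e : R, 0 < e & forall z, K z -> e <= nm (f z).
Proof.
move=> cK cf f0; apply: compact_pos_near => // z Kz.
have n0 : 0 < nm (f z) / 2 by rewrite divr_gt0// nm_gt0 f0.
have [r r0 hr] := cf _ Kz _ n0; exists (Num.min r (nm (f z) / 2)).
  by rewrite lt_min r0.
move=> w _; rewrite lt_min => /andP[/hr h _].
by rewrite ge_min; apply/orP; right; have := nm_subl (f z) (f w); rewrite nmB; lra.
Qed.

Lemma compact_bounded_plane K : compact K ->
  exists2 M : R, 0 <= M & forall z, K z -> nm z <= M.
Proof. by move=> cK; apply: (@compact_cont_bound K id) => // z _; exact: ccont_id. Qed.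

Lemma compact_dist K p : compact K -> ~ K p ->
  exists2 e : R, 0 < e & forall z, K z -> e <= nm (z - p).
Proof.
move=> cK nKp; apply: (@compact_cont_pos K (fun z => z - p)) => // [z _|z Kz].
  by apply: ccontB; [exact: ccont_id|exact: ccont_cst].
by rewrite subr_eq0; apply: contra_not_neq nKp => <-.
Qed.

(** A Lebesgue number: each point gets a radius whose double still fits in [U]. *)
Lemma compact_open_nbhd K (U : set C) : compact K -> open U -> K `<=` U ->
  exists2 e : R, 0 < e & forall z w, K z -> nm (w - z) < e -> U w.
Proof.
move=> cK /open_planeP oU KU.
pose P z (r : R) := 0 < r /\ forall w, nm (w - z) < r + r -> U w.
have h z : exists r : R, K z -> P z r.
  have [/KU/oU[r r0 hr]|nK] := pselect (K z); last by exists 0.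
  exists (r / 2) => _; split; first by rewrite divr_gt0.
  by move=> w; rewrite -splitr; exact: hr.
pose F z := projT1 (cid (h z)).
have FP z : K z -> P z (F z) by exact: projT2 (cid (h z)).
have [s sK Ks] := compact_ball_cover cK (fun z Kz => proj1 (FP z Kz)).
have [e e0 he] := seq_min_pos (fun z zs => proj1 (FP z (sK z zs))).
exists e => // z w /Ks[x xs zx] wz; apply: (proj2 (FP x (sK x xs))).
by rewrite (le_lt_trans (nm_triangle z _ _))// ltrD// (lt_le_trans wz)// he.
Qed.

Lemma closed_planeP K : closed K <->
  forall z, ~ K z -> exists2 e : R, 0 < e & forall w, nm (w - z) < e -> ~ K w.
Proof.
rewrite -openC; split=> [/open_planeP//|h].
by apply/open_planeP.
Qed.

Lemma bounded_closed_compact_plane K (M : R) : closed K ->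
  (forall z, K z -> nm z <= M) -> compact K.
Proof.
move=> cK KM; pose f (xy : R * R) : C := mk xy.1 xy.2.
have cf : continuous f.
  move=> [x y] A /nbhs_planeP[e e0 eA]; rewrite nbhs_simpl.
  have e20 : 0 < e / 2 by rewrite divr_gt0.
  exists (ball x (e / 2), ball y (e / 2)) => /=.
    by split; exact: nbhsx_ballx.
  move=> [x' y'] [/=]; rewrite /ball /= => xx yy; apply: eA.
  rewrite (le_lt_trans (nm_le_reim _))// reD imD reN imN /f !re_mk !im_mk /=.
  by rewrite [e]splitr (distrC x') (distrC y') ltrD.
apply: (@subclosed_compact _ _ (f @` (`[- M, M] `*` `[- M, M]))) => //.
  apply: continuous_compact; first exact: continuous_subspaceT.
  by apply: compact_setX; exact: segment_compact.
move=> z /KM zM; exists (re z, im z); last exact: mk_re_im.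
by split; rewrite /= in_itv /= -ler_norml;
  [exact: le_trans (re_le_nm z) zM|exact: le_trans (im_le_nm z) zM].
Qed.

Lemma compact_closed_plane K : compact K -> closed K.
Proof.
move=> cK; apply/closed_planeP => z /(compact_dist cK)[e e0 he].
by exists e => // w wz /he; rewrite nmB leNgt nmB wz.
Qed.

End CompactPlane.

(** * Cauchy theory on polygonal contours *)

Section Contour.
Context {R : realType}.
Local Notation C := (plane R).
Implicit Types (z w p : C) (K U : set C) (f g F : C -> C).

(* (true, y, a, b) is the horizontal edge from a + iy to b + iy and
   (false, x, c, d) the vertical one from x + ic to x + id. *)
Definition edge := (bool * R * R * R)%type.
(** Complex weights make linear combinations of contours available. Closedness is not part of the
    data; it is expressed by [exact_on]. *)
Definition contour := seq (C * edge).
Implicit Types (e : edge) (G : contour).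

Definition eint f e : C := let: (h, p, a, b) := e in
  if h then hint f p a b else vint f p a b.
Definition ept e (t : R) : C := let: (h, p, a, b) := e in
  if h then mk t p else mk p t.
Definition lo e : R := e.1.2.
Definition hi e : R := e.2.
Definition epts e : set C := [set z | exists2 t, lo e <= t <= hi e & z = ept e t].
Definition Iint G f : C := \sum_(x <- G) x.1 * eint f x.2.
Definition supp G : set C := [set z | exists2 x, x \in G & epts x.2 z].
Definition wfc G := forall x, x \in G -> lo x.2 <= hi x.2.

(** Treats both directions of edges at once: [k] is 1 or [cI]. *)
Lemma eintE f e : exists k, [/\ nm k = 1 :> R,
  forall g, eint g e = k * cint (fun t => g (ept e t)) (lo e) (hi e) &
  forall s t, ept e s - ept e t = k * rc (s - t)].
Proof.
case: e => [[[[] p] a] b]; [exists 1|exists cI]; split.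
- exact: nm1.
- by move=> g; rewrite mul1r.
- by move=> s t; rewrite /= mkBh mul1r.
- exact: nm_cI.
- by [].
- by move=> s t; rewrite /= mkBv.
Qed.

Lemma eptsP e t : lo e <= t <= hi e -> epts e (ept e t).
Proof. by move=> h; exists t. Qed.

Lemma ecintable f e : lo e <= hi e -> (forall z, epts e z -> ccont f z) ->
  cintable (fun t => f (ept e t)) (lo e) (hi e).
Proof.
move=> ab cf; apply: cont_cintable => // t ht eps /(cf _ (eptsP ht))[r r0 hr].
exists r => // s _ st; apply: hr; have [k [k1 _ ->]] := eintE f e.
by rewrite nmM k1 mul1r nm_rc.
Qed.

Lemma epts_compact e : compact (epts e).
Proof.
have [k [k1 _ kE]] := eintE id e.
apply: (@bounded_closed_compact_plane _ _ (nm (ept e 0) + `|lo e| + `|hi e|)).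
  apply/closed_planeP => z nz.
  have [h|h] := leP (lo e) (hi e); last first.
    by exists 1 => // w _ [t ht _]; lra.
  case: e {kE} nz h => [[[h p] a] b] nz /= ab; rewrite /lo /hi /= in nz ab *.
  pose u := if h then re z else im z; pose v := if h then im z else re z.
  have zE : z = ept (h, p, a, b) u -> a <= u <= b -> False by move=> zu ht; apply: nz; exists u.
  have key w : epts (h, p, a, b) w -> exists2 t, a <= t <= b &
      (`|t - u| <= nm (w - z) /\ `|p - v| <= nm (w - z)).
    case=> t ht ->; exists t => //; rewrite /u /v /ept; case: (h).
      by split; [have := re_le_nm (mk t p - z)|have := im_le_nm (mk t p - z)];
        rewrite ?reD ?reN ?imD ?imN.
    by split; [have := im_le_nm (mk p t - z)|have := re_le_nm (mk p t - z)];
      rewrite ?reD ?reN ?imD ?imN.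
  have [pv|pv] := eqVneq p v; last first.
    exists `|p - v|; first by rewrite normr_gt0 subr_eq0.
    by move=> w wz /key[t _ [_]]; rewrite leNgt wz.
  have zz : z = ept (h, p, a, b) u.
    by rewrite /ept pv /u /v; case: (h); rewrite mk_re_im.
  have [ua|ua] := ltP u a.
    exists (a - u); first by rewrite subr_gt0.
    move=> w wz /key[t ht [+ _]]; have := ler_norm (t - u); lra.
  have [ub|ub] := ltP b u.
    exists (u - b); first by rewrite subr_gt0.
    move=> w wz /key[t ht [+ _]]; have := ler_norm (u - t); rewrite (distrC u); lra.
  by exfalso; apply: (zE zz); rewrite ua ub.
move=> z [t ht ->]; rewrite -(subrK (ept e 0) (ept e t)) kE subr0.
rewrite (le_trans (nmD _ _))// nmM k1 mul1r nm_rc addrC -addrA lerD2l ler_norml.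
have := ler_norm (hi e); have := ler_norm (- lo e); rewrite normrN.
by have := normr_ge0 (lo e); have := normr_ge0 (hi e); lra.
Qed.

Lemma supp_compact G : compact (supp G).
Proof.
elim: G => [|x G IH].
  rewrite (_ : supp [::] = set0); first exact: compact0.
  by apply/seteqP; split => // z [].
rewrite (_ : supp (x :: G) = epts x.2 `|` supp G).
  by apply: compactU => //; exact: epts_compact.
apply/seteqP; split => z.
  by case=> y; rewrite inE => /orP[/eqP->|yG]; [left|right; exists y].
case=> [zx|[y yG yz]]; first by exists x => //; rewrite mem_head.
by exists y => //; rewrite inE yG orbT.
Qed.

Lemma Iint_cat G H f : Iint (G ++ H) f = Iint G f + Iint H f.
Proof. by rewrite /Iint big_cat. Qed.

Section Linear.
Variables (G : contour) (wG : wfc G).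

Lemma eq_Iint f g : (forall z, supp G z -> ccont f z) ->
  (forall z, supp G z -> f z = g z) -> Iint G f = Iint G g.
Proof.
move=> cf fg; apply: eq_big_seq => x xG; congr (_ * _).
have [k [_ kE _]] := eintE f x.2; rewrite !kE; congr (_ * _).
apply: eq_cint; first exact: wG.
  by move=> t ht; apply: fg; exists x => //; exact: eptsP.
by apply: ecintable; [exact: wG|move=> z xz; apply: cf; exists x].
Qed.

Lemma IintB f g : (forall z, supp G z -> ccont f z) ->
  (forall z, supp G z -> ccont g z) ->
  Iint G (fun z => f z - g z) = Iint G f - Iint G g.
Proof.
move=> cf cg; rewrite /Iint -sumrB; apply: eq_big_seq => x xG; rewrite -mulrBr.
congr (_ * _); have [k [_ kE _]] := eintE f x.2; rewrite !kE -mulrBr; congr (_ * _).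
rewrite cintB//; first exact: wG.
all: by apply: ecintable; [exact: wG|move=> z xz; (apply: cf || apply: cg); exists x].
Qed.

Lemma IintMl f c : (forall z, supp G z -> ccont f z) ->
  Iint G (fun z => c * f z) = c * Iint G f.
Proof.
move=> cf; rewrite /Iint mulr_sumr; apply: eq_big_seq => x xG; rewrite [RHS]mulrCA.
congr (_ * _); have [k [_ kE _]] := eintE f x.2; rewrite !kE [RHS]mulrCA; congr (_ * _).
rewrite cintMl//; first exact: wG.
by apply: ecintable; [exact: wG|move=> z xz; apply: cf; exists x].
Qed.

Lemma IintD f g : (forall z, supp G z -> ccont f z) ->
  (forall z, supp G z -> ccont g z) ->
  Iint G (fun z => f z + g z) = Iint G f + Iint G g.
Proof.
move=> cf cg; have cNg z : supp G z -> ccont (fun z => -1 * g z) z.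
  by move=> sz; apply: ccontM; [exact: ccont_cst|exact: cg].
rewrite -(@eq_Iint (fun z => f z - -1 * g z)).
- by rewrite IintB// IintMl// mulN1r opprK.
- by move=> z sz; apply: ccontB; [exact: cf|exact: cNg].
- by move=> z _; rewrite mulN1r opprK.
Qed.

Definition clen : R := \sum_(x <- G) nm x.1 * (hi x.2 - lo x.2).

Lemma clen_ge0 : 0 <= clen.
Proof.
rewrite /clen big_seq; apply: sumr_ge0 => x xG.
by rewrite mulr_ge0 ?nm_ge0// subr_ge0 wG.
Qed.

Lemma Iint_bound f (M : R) : (forall z, supp G z -> ccont f z) ->
  (forall z, supp G z -> nm (f z) <= M) -> nm (Iint G f) <= clen * M.
Proof.
move=> cf fM; rewrite (le_trans (nm_sum _ _ _))// /clen mulr_suml.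
rewrite big_seq [leRHS]big_seq; apply: ler_sum => x xG.
rewrite nmM -mulrA ler_wpM2l ?nm_ge0//.
have [k [k1 kE _]] := eintE f x.2; rewrite kE nmM k1 mul1r mulrC.
apply: cint_bound; first exact: wG.
  by apply: ecintable; [exact: wG|move=> z xz; apply: cf; exists x].
by move=> t ht; apply: fM; exists x => //; exact: eptsP.
Qed.

(** Differentiation under the integral sign. For Cauchy kernels the quadratic remainder, uniform on
    the support, is explicit. *)
Lemma Iint_hasd (Phi : C -> C -> C) (Phi' : C -> C) z (r M : R) : 0 < r -> 0 <= M ->
  (forall u, nm (u - z) < r -> forall w, supp G w -> ccont (Phi u) w) ->
  (forall w, supp G w -> ccont Phi' w) ->
  (forall u, nm (u - z) < r -> forall w, supp G w ->
    nm (Phi u w - Phi z w - Phi' w * (u - z)) <= M * nm (u - z) ^+ 2) ->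
  hasd (fun u => Iint G (Phi u)) z (Iint G Phi').
Proof.
move=> r0 M0 cPhi cPhi' h e e0.
have k0 : 0 < clen * M + 1 by rewrite ltr_wpDl// mulr_ge0// clen_ge0.
exists (Num.min r (e / (clen * M + 1))); first by rewrite lt_min r0 divr_gt0.
move=> u; rewrite lt_min => /andP[ur ue].
have zr : nm (z - z) < r by rewrite subrr nm0.
have c1 w : supp G w -> ccont (fun w => Phi u w - Phi z w) w.
  by move=> sw; apply: ccontB; apply: cPhi.
have c2 w : supp G w -> ccont (fun w => (u - z) * Phi' w) w.
  by move=> sw; apply: ccontM; [exact: ccont_cst|exact: cPhi'].
rewrite -IintB; [|exact: cPhi|exact: cPhi].
rewrite mulrC -IintMl// -IintB//.
have := @Iint_bound (fun w => Phi u w - Phi z w - (u - z) * Phi' w)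
  (M * nm (u - z) ^+ 2) _ _.
move=> H; rewrite (le_trans (H _ _))//.
- by move=> w sw; apply: ccontB; [exact: c1|exact: c2].
- by move=> w sw; rewrite mulrC; exact: h.
rewrite mulrA expr2 mulrA ler_wpM2r ?nm_ge0//.
rewrite (le_trans (ler_wpM2l _ (ltW ue))) ?mulr_ge0 ?clen_ge0//.
rewrite mulrA ler_pdivrMr// mulrC ler_wpM2l ?ltW// ?ltrDl//.
Qed.

End Linear.

End Contour.

(** * Differentiation of Cauchy transforms *)

Section CauchyIntegral.
Context {R : realType}.
Local Notation C := (plane R).
Implicit Types (z w p u : C) (K U : set C) (f g F : C -> C) (G : @contour R).

Lemma mean_value_seg f f' z z0 (M : R) :
  (forall t : R, 0 <= t <= 1 -> hasd f (z0 + rc t * (z - z0)) (f' (z0 + rc t * (z - z0)))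
     /\ nm (f' (z0 + rc t * (z - z0))) <= M) ->
  nm (f z - f z0) <= M * nm (z - z0).
Proof.
move=> h; pose sg t := z0 + rc t * (z - z0).
have sgB s t : sg s - sg t = rc (s - t) * (z - z0) by rewrite /sg rcB; ring.
have := @mean_value R (fun t => f (sg t)) (fun t => f' (sg t) * (z - z0)) 0 1
  (M * nm (z - z0)) ler01.
rewrite subr0 mulr1 /sg rc0 rc1 mul0r mul1r addr0 addrCA subrr addr0; apply.
- move=> t /h[ft _] e e0; have k0 : 0 < nm (z - z0) + 1 by rewrite ltr_wpDl ?nm_ge0.
  have [r r0 hr] := ft (e / (nm (z - z0) + 1)) ltac:(by rewrite divr_gt0).
  exists (r / (nm (z - z0) + 1)); first by rewrite divr_gt0.
  move=> s _; rewrite ltr_pdivlMr// => st.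
  have nst : nm (sg s - sg t) = `|s - t| * nm (z - z0) by rewrite sgB nmM nm_rc.
  rewrite -mulrA [(z - z0) * _]mulrC -sgB (le_trans (hr _ _))//.
    by rewrite nst (le_lt_trans _ st)// ler_wpM2l// lerDl.
  rewrite nst mulrCA mulrC ler_wpM2r// mulrAC ler_pdivrMr// ler_wpM2l ?(ltW e0)//.
  by rewrite lerDl.
- by move=> t /h[_ fM]; rewrite nmM ler_wpM2r ?nm_ge0.
Qed.

Section Transform.
Variables (G : @contour R) (wG : wfc G) (g : C -> C).
Hypothesis cg : forall w, supp G w -> ccont g w.

Lemma ccont_kernel u w : w != u -> ccont (fun w => (w - u)^-1) w.
Proof.
move=> wu; apply: ccontV; first by rewrite subr_eq0.
by apply: ccontB; [exact: ccont_id|exact: ccont_cst].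
Qed.

Let kernel_bounds z : ~ supp G z -> exists2 e : R, 0 < e &
  forall u, nm (u - z) < e / 2 -> forall w, supp G w ->
    [/\ e <= nm (w - z), e / 2 <= nm (w - u) & nm (u - z) <= nm (w - z) / 2].
Proof.
move=> sz; have [e e0 he] := compact_dist (@supp_compact R G) sz.
exists e => // u uz w sw; have h := he _ sw; split => //; last by lra.
by have := nm_triangle u w z; lra.
Qed.

(** The inner function [h] serves the inverse of an injective map, where the kernel is
    [(f w - u)^-1]. The constant [2 / e ^+ 3] comes from [e <= nm (h w - z)] and
    [e / 2 <= nm (h w - u)]. *)
Lemma cauchy_hasd_gen (h : C -> C) z : (forall w, supp G w -> ccont h w) ->
  (forall w, supp G w -> h w != z) ->
  hasd (fun u => Iint G (fun w => g w * (h w - u)^-1)) z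
    (Iint G (fun w => g w * ((h w - z)^-1 * (h w - z)^-1))).
Proof.
move=> ch hz.
have [e e0 he0] := @compact_cont_pos R (supp G) (fun w => h w - z) (@supp_compact R G)
  (fun w sw => ccontB (ch w sw) (@ccont_cst R z w))
  (fun w sw => ltac:(by rewrite subr_eq0; exact: hz)).
have e20 : 0 < e / 2 by rewrite divr_gt0.
have he u : nm (u - z) < e / 2 -> forall w, supp G w ->
    e <= nm (h w - z) /\ e / 2 <= nm (h w - u).
  move=> uz w sw; have h1 := he0 _ sw; split => //.
  by have := nm_triangle u (h w) z; lra.
have [B B0 gB] := compact_cont_bound (@supp_compact R G) cg.
have zz : nm (z - z) < e / 2 by rewrite subrr nm0.
have wu u w : nm (u - z) < e / 2 -> supp G w -> h w != u.
  by move=> uz sw; rewrite -subr_eq0 -nm_gt0; have [_ h1] := he _ uz _ sw; lra.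
have ck u w : nm (u - z) < e / 2 -> supp G w -> ccont (fun w => (h w - u)^-1) w.
  move=> uz sw; exact: (@ccont_comp R h (fun v => (v - u)^-1) w (ch w sw)
    (ccont_kernel (wu _ _ uz sw))).
apply: (@Iint_hasd R G wG _ _ z (e / 2) (B * (2 / e ^+ 3))) => //.
- by rewrite mulr_ge0// divr_ge0// exprn_ge0// ltW.
- by move=> u uz w sw; apply: ccontM; [exact: cg|exact: ck].
- move=> w sw; apply: ccontM; first exact: cg.
  by apply: ccontM; exact: ck.
- move=> u uz w sw; have [h1 h2] := he _ uz _ sw.
  have n1 : h w - u != 0 by rewrite subr_eq0 wu.
  have n2 : h w - z != 0 by rewrite subr_eq0 wu.
  rewrite (_ : _ - _ - _ = g w * ((u - z) ^+ 2 / ((h w - u) * (h w - z) ^+ 2))); last first.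
    by field; rewrite n1 n2.
  rewrite nmM -mulrA ler_pM ?nm_ge0 ?gB// nmM nmX mulrC ler_wpM2r ?exprn_ge0 ?nm_ge0//.
  rewrite nmV nmM nmX (_ : 2 / e ^+ 3 = (e / 2 * e ^+ 2)^-1); last first.
    by field; rewrite gt_eqF.
  rewrite lef_pV2 ?posrE ?mulr_gt0 ?exprn_gt0 ?nm_gt0//.
  by rewrite ler_pM ?exprn_ge0 ?(ltW e0) ?(ltW e20)// lerXn2r ?nnegrE ?nm_ge0 ?(ltW e0).
Qed.

Lemma cauchy_hasd z : ~ supp G z ->
  hasd (fun u => Iint G (fun w => g w * (w - u)^-1)) z
    (Iint G (fun w => g w * ((w - z)^-1 * (w - z)^-1))).
Proof.
move=> sz; apply: (@cauchy_hasd_gen id) => w sw; first exact: ccont_id.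
by apply: contra_not_neq sz => <-.
Qed.

Lemma cauchy_hasd2 z : ~ supp G z ->
  hasd (fun u => Iint G (fun w => g w * ((w - u)^-1 * (w - u)^-1))) z
    (Iint G (fun w => g w * (2 * ((w - z)^-1 * (w - z)^-1 * (w - z)^-1)))).
Proof.
move=> sz; have [e e0 he] := kernel_bounds sz.
have [B B0 gB] := compact_cont_bound (@supp_compact R G) cg.
have e20 : 0 < e / 2 by rewrite divr_gt0.
have zz : nm (z - z) < e / 2 by rewrite subrr nm0.
have wu u w : nm (u - z) < e / 2 -> supp G w -> w != u.
  by move=> uz sw; rewrite -subr_eq0 -nm_gt0; have [_ h _] := he _ uz _ sw; lra.
apply: (@Iint_hasd R G wG _ _ z (e / 2) (B * (16 / e ^+ 4))) => //.
- by rewrite mulr_ge0// divr_ge0// exprn_ge0// ltW.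
- move=> u uz w sw; apply: ccontM; first exact: cg.
  by apply: ccontM; apply: ccont_kernel; exact: wu.
- move=> w sw; apply: ccontM; first exact: cg.
  apply: ccontM; first exact: ccont_cst.
  by do 2?apply: ccontM; apply: ccont_kernel; exact: wu.
- move=> u uz w sw; have [h1 h2 h3] := he _ uz _ sw.
  have n1 : w - u != 0 by rewrite subr_eq0 wu.
  have n2 : w - z != 0 by rewrite subr_eq0 wu.
  (* As [nm (u - z) <= nm (w - z) / 2], the last numerator is at most [4 * nm (w - z)]; with
     [e / 2 <= nm (w - u)] this accounts for the constant 16. *)
  rewrite (_ : _ - _ - _ = g w * ((u - z) ^+ 2 *
      ((3 * (w - z) - 2 * (u - z)) / ((w - u) ^+ 2 * (w - z) ^+ 3)))); last first.
    by field; rewrite n1 n2.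
  rewrite nmM -mulrA ler_pM ?nm_ge0 ?gB// nmM nmX mulrC ler_wpM2r ?exprn_ge0 ?nm_ge0//.
  rewrite nmM nmV nmM !nmX.
  have p1 : 0 < nm (w - z) by rewrite nm_gt0.
  have p2 : 0 < nm (w - u) by rewrite nm_gt0.
  have n3 : nm (3 * (w - z) - 2 * (u - z)) <= 4 * nm (w - z).
    rewrite (le_trans (nmD _ _))// nmN !nmM.
    have -> : nm (3 : C) = 3 by rewrite -rc_nat nm_rc ger0_norm.
    have -> : nm (2 : C) = 2 by rewrite -rc_nat nm_rc ger0_norm.
    by lra.
  rewrite ler_pdivrMr ?mulr_gt0 ?exprn_gt0// (le_trans n3)//.
  rewrite (_ : 16 / e ^+ 4 * _ = 4 * nm (w - z) * ((nm (w - u) / (e / 2)) ^+ 2 *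
     (nm (w - z) / e) ^+ 2)); last by field; rewrite gt_eqF.
  rewrite ler_peMr ?mulr_ge0 ?(ltW p1)//.
  by rewrite mulr_ege1// exprn_ege1// ler_pdivlMr// mul1r.
Qed.

End Transform.

(** The derivative with respect to the pole is the integral of the derivative of [- (w - u)^-1],
    hence zero along the segment. *)
Lemma winding_const G z z0 : wfc G ->
  (forall F f, (forall w, supp G w -> hasd F w (f w)) -> Iint G f = 0) ->
  (forall t : R, 0 <= t <= 1 -> ~ supp G (z0 + rc t * (z - z0))) ->
  Iint G (fun w => (w - z)^-1) = Iint G (fun w => (w - z0)^-1).
Proof.
move=> wG ex0 seg; apply/eqP; rewrite -subr_eq0 -nm_eq0 eq_le nm_ge0 andbT.
have := @mean_value_seg (fun u => Iint G (fun w => (w - u)^-1)) (fun=> 0) z z0 0.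
rewrite mul0r; apply=> t /seg st; split; last by rewrite nm0.
set u := z0 + _ in st *.
have := @cauchy_hasd G wG (fun=> 1) (fun w _ => @ccont_cst R 1 w) u st.
have -> : (fun u => Iint G (fun w => 1 * (w - u)^-1)) =
    (fun u => Iint G (fun w => (w - u)^-1)).
  by apply/funext => v; congr (Iint G _); apply/funext => w; rewrite mul1r.
move=> h; apply: (hasd_eq h).
apply: (ex0 (fun w => - (w - u)^-1)) => w sw.
have wu : w - u != 0 by rewrite subr_eq0; apply: contra_not_neq st => <-.
apply: hasd_eq.
  apply: hasdN; apply: hasdV => //.
  by apply: hasdB; [exact: hasd_id|exact: hasd_cst].
rewrite /=; field; exact: wu.
Qed.

End CauchyIntegral.

(** * Cycles on a square grid *)

Section Grid.
Context {R : realType}.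
Local Notation C := (plane R).

(** Summation by parts; it converts sums over cells into sums over edges. *)
Lemma abel_sum (V : comPzRingType) (c h : nat -> V) n : c 0%N = 0 -> c n = 0 ->
  \sum_(0 <= j < n) c j * (h j - h j.+1) =
  \sum_(0 <= j < n) (c j.+1 - c j) * h j.+1.
Proof.
move=> c0 cn; apply/eqP; rewrite -subr_eq0 -sumrB.
rewrite (eq_bigr (fun j => - (c j.+1 * h j.+1 - c j * h j))); last first.
  by move=> j _; ring.
by rewrite sumrN telescope_sumr// c0 cn !mul0r subrr oppr0.
Qed.

Variables (x0 y0 s : R) (N : nat) (c : nat -> nat -> C).
Hypotheses (s0 : 0 < s) (ch0 : forall i, c i 0%N = 0) (chN : forall i, c i N = 0)
  (cv0 : forall j, c 0%N j = 0) (cvN : forall j, c N j = 0).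

Definition gX i : R := x0 + s * i%:R.
Definition gY i : R := y0 + s * i%:R.
Definition gQ i j : set C := rect (gX i) (gX i.+1) (gY j) (gY j.+1).

Lemma gXS i : gX i.+1 = gX i + s. Proof. by rewrite /gX -natr1; ring. Qed.
Lemma gYS i : gY i.+1 = gY i + s. Proof. by rewrite /gY -natr1; ring. Qed.

(** The boundary of the chain of cells with multiplicities [c]. Dropping the edges of weight zero
    confines the support to boundaries between cells of different multiplicity. *)
Definition grid : @contour R := [seq x <-
  [seq (c i j.+1 - c i j, (true, gY j.+1, gX i, gX i.+1)) |
     i <- index_iota 0 N, j <- index_iota 0 N] ++
  [seq (c i j - c i.+1 j, (false, gX i.+1, gY j, gY j.+1)) |
     i <- index_iota 0 N, j <- index_iota 0 N] | x.1 != 0].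

Lemma mem_grid x : x \in grid -> exists i j,
  c i j.+1 != c i j /\ x = (c i j.+1 - c i j, (true, gY j.+1, gX i, gX i.+1)) \/
  c i j != c i.+1 j /\ x = (c i j - c i.+1 j, (false, gX i.+1, gY j, gY j.+1)).
Proof.
rewrite mem_filter mem_cat => /andP[x0' /orP[] /allpairsP[[i j] [_ _ xE]]];
  exists i, j; move: x0'; rewrite xE /= subr_eq0; by [left|right].
Qed.

Lemma wfc_grid : wfc grid.
Proof.
by move=> x /mem_grid[i [j [[_ ->]|[_ ->]]]]; rewrite /lo /hi /= ?gXS ?gYS lerDl ltW.
Qed.

(** [val] will be the edge integral in [Iint_grid] and the increment of a primitive in
    [grid_exact]. *)
Lemma grid_sum (h v : nat -> nat -> C) (val : @edge R -> C) :
  (forall i j, val (true, gY j, gX i, gX i.+1) = h i j) ->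
  (forall i j, val (false, gX i, gY j, gY j.+1) = v i j) ->
  \sum_(x <- grid) x.1 * val x.2 =
  \sum_(0 <= i < N) \sum_(0 <= j < N)
     c i j * (h i j + v i.+1 j - h i j.+1 - v i j).
Proof.
move=> vh vv; rewrite /grid big_filter big_rmcond => [|x]; last first.
  by rewrite negbK => /eqP ->; rewrite mul0r.
rewrite big_cat !big_allpairs_dep /=.
rewrite [RHS](eq_bigr (fun i => \sum_(0 <= j < N) c i j * (h i j - h i j.+1) +
    \sum_(0 <= j < N) c i j * (v i.+1 j - v i j))); last first.
  move=> i _; rewrite -big_split /=; apply: eq_bigr => j _; ring.
rewrite big_split /=; congr (_ + _).
  apply: eq_bigr => i _; rewrite abel_sum//; apply: eq_bigr => j _.
  by rewrite vh.
rewrite exchange_big [RHS]exchange_big /=; apply: eq_bigr => j _.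
have := @abel_sum C (fun i => - c i j) (fun i => v i j) N.
rewrite cv0 cvN oppr0 => /(_ erefl erefl) E.
rewrite [RHS](eq_bigr (fun i => - c i j * (v i j - v i.+1 j))); last by move=> i _; ring.
by rewrite E; apply: eq_bigr => i _; rewrite vv; ring.
Qed.

Lemma Iint_grid f : Iint grid f = \sum_(0 <= i < N) \sum_(0 <= j < N)
  c i j * rint f (gX i) (gX i.+1) (gY j) (gY j.+1).
Proof. exact: (@grid_sum _ _ (eint f)). Qed.

(** Once the edge integrals are increments of [F], the cancellation around each cell is algebraic,
    so differentiability on the support is enough. *)
Lemma grid_exact (F f : C -> C) : (forall w, supp grid w -> hasd F w (f w)) ->
  Iint grid f = 0.
Proof.
move=> dF; pose val (e : @edge R) := F (ept e (hi e)) - F (ept e (lo e)).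
have -> : Iint grid f = \sum_(x <- grid) x.1 * val x.2.
  apply: eq_big_seq => x xG; congr (_ * _); have := wfc_grid xG.
  have : forall z, epts x.2 z -> hasd F z (f z) by move=> z xz; apply: dF; exists x.
  case: x xG => k [[[h p] a] b] /= _; rewrite /lo /hi /= => dFe ab.
  by case: h dFe => dFe; rewrite /val /=; [apply: hint_ftc|apply: vint_ftc] => // t ht;
    apply: dFe; exists t.
rewrite (@grid_sum (fun i j => F (mk (gX i.+1) (gY j)) - F (mk (gX i) (gY j)))
  (fun i j => F (mk (gX i) (gY j.+1)) - F (mk (gX i) (gY j))))//.
by apply: big1 => i _; apply: big1 => j _; ring.
Qed.

End Grid.

(** * Contours around a compact set *)

Section ContourExists.
Context {R : realType}.
Local Notation C := (plane R).
Implicit Types (z w p u : C) (K U : set C) (f g F : C -> C).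

Lemma rect_diam (a b c d : R) z w : rect a b c d z -> rect a b c d w ->
  nm (z - w) <= (b - a) + (d - c).
Proof.
move=> [/andP[z1 z2] /andP[z3 z4]] [/andP[w1 w2] /andP[w3 w4]].
rewrite (le_trans (nm_le_reim _))// reD imD reN imN lerD// ler_norml; lra.
Qed.

(** Closedness of the contour, tested on exact forms. *)
Definition exact_on (G : @contour R) :=
  forall F f, (forall w, supp G w -> hasd F w (f w)) -> Iint G f = 0.

(** Cells of a fine grid that meet [K] get multiplicity 1. A point of the support lies in two cells
    of different multiplicity, hence in [U] and off [K]. The vanishing clause tolerates a point
    without derivative, so that it applies to difference quotients before their singularity is known
    to be removable. *)
Lemma contour_exists U K : open U -> compact K -> K `<=` U ->
  exists G : @contour R, [/\ wfc G,
    forall z, supp G z -> U z /\ ~ K z,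
    exact_on G,
    forall f p, (forall z, U z -> ccont f z) ->
      (forall z, U z -> z != p -> exists D, hasd f z D) -> Iint G f = 0 &
    forall z, K z -> Iint G (fun w => (w - z)^-1) = tpi].
Proof.
move=> oU cK KU.
have [dl dl0 hU] := compact_open_nbhd cK oU KU.
have [M M0 hM] := compact_bounded_plane cK.
(* A cell has diameter at most [2 * s], less than [dl], so the cells meeting [K] stay in [U]. *)
pose s := dl / 4; have s0 : 0 < s by rewrite divr_gt0.
pose x0 := - M - 2 * s.
have [N NP] : exists N : nat, 2 * M + 2 * s < s * N%:R.
  exists (Num.truncn ((2 * M + 2 * s) / s)).+1.
  have := truncnS_gt ((2 * M + 2 * s) / s).
  by rewrite ltr_pdivrMr// [s * _]mulrC.
pose Q i j := gQ x0 x0 s i j.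
pose b i j := `[< exists2 z, K z & Q i j z >].
pose c i j : C := (b i j)%:R.
have reK z : K z -> - M <= re z <= M by move=> /hM zM; rewrite -ler_norml (le_trans (re_le_nm z)).
have imK z : K z -> - M <= im z <= M by move=> /hM zM; rewrite -ler_norml (le_trans (im_le_nm z)).
have g1 : gX x0 s 1 < - M by rewrite /gX /x0; lra.
have gN : M < gX x0 s N by rewrite /gX /x0; lra.
have ch0 i : c i 0%N = 0.
  rewrite /c /b; case: asboolP => // -[z /imK/andP[+ _] [_ /andP[_]]].
  by rewrite /gY -/(gX x0 s 1) => h1 h2; exfalso; lra.
have chN i : c i N = 0.
  rewrite /c /b; case: asboolP => // -[z /imK/andP[_ +] [_ /andP[+ _]]].
  by rewrite /gY -/(gX x0 s N) => h1 h2; exfalso; lra.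
have cv0 j : c 0%N j = 0.
  rewrite /c /b; case: asboolP => // -[z /reK/andP[+ _] [/andP[_ +] _]].
  by move=> h1 h2; exfalso; lra.
have cvN j : c N j = 0.
  rewrite /c /b; case: asboolP => // -[z /reK/andP[_ +] [/andP[+ _] _]].
  by move=> h1 h2; exfalso; lra.
have QU i j : b i j -> Q i j `<=` U.
  move=> /asboolP[k Kk Qk] z Qz; apply: (hU k) => //.
  by rewrite (le_lt_trans (rect_diam Qz Qk))// gXS gYS /s; lra.
have QK i j z : K z -> Q i j z -> b i j by move=> Kz Qz; apply/asboolP; exists z.
pose G := grid x0 x0 s N c.
have wG : wfc G by exact: wfc_grid.
have eG : exact_on G by move=> F f; exact: grid_exact.
have gle i : gX x0 s i <= gX x0 s i.+1 by rewrite gXS lerDl ltW.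
have suppP z : supp G z -> exists i j i' j', [/\ b i j != b i' j', Q i j z & Q i' j' z].
  case=> x /mem_grid[i [j [[bb ->]|[bb ->]]]] [t ht zE]; rewrite /lo /hi /= in ht.
  - exists i, j.+1, i, j; split; first by apply: contra_neq bb; rewrite /c => ->.
    + by rewrite zE; apply: rect_mk => //; rewrite lexx gle.
    + by rewrite zE; apply: rect_mk => //; rewrite lexx gle.
  - exists i, j, i.+1, j; split; first by apply: contra_neq bb; rewrite /c => ->.
    + by rewrite zE; apply: rect_mk => //; rewrite lexx gle.
    + by rewrite zE; apply: rect_mk => //; rewrite lexx gle.
have sG z : supp G z -> U z /\ ~ K z.
  move=> /suppP[i [j [i' [j' [bb Qz Q'z]]]]]; split.
    have [bij|/negbTE bij] := boolP (b i j); first exact: QU bij _ Qz.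
    move: bb; rewrite bij; have [bij' _|//] := boolP (b i' j'); exact: QU bij' _ Q'z.
  by move=> Kz; move: bb; rewrite (QK _ _ _ Kz Qz) (QK _ _ _ Kz Q'z).
exists G; split => //.
- move=> f p cf hf; rewrite /G Iint_grid//; apply: big1 => i _; apply: big1 => j _.
  rewrite /c; have [bij|_] := boolP (b i j); last by rewrite mul0r.
  rewrite (@goursat_except _ _ _ _ _ _ p) ?mulr0//.
    by move=> z Qz; apply: cf; apply: (QU _ _ bij).
  by move=> z Qz; apply: hf; apply: (QU _ _ bij).
move=> z Kz.
have loc (x : R) : - M <= x <= M -> exists2 i, (i < N)%N & gX x0 s i <= x < gX x0 s i.+1.
  move=> /andP[x1 x2]; pose y := (x - x0) / s.
  have y0 : 0 <= y by rewrite divr_ge0 ?(ltW s0)// /x0; lra.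
  have /andP[i1 i2] := truncn_itv y0.
  have h1 : gX x0 s (Num.truncn y) <= x.
    by move: i1; rewrite /y ler_pdivlMr// /gX mulrC; lra.
  exists (Num.truncn y); last first.
    by rewrite h1 /=; move: i2; rewrite /y ltr_pdivrMr// /gX mulrC; lra.
  have : gX x0 s (Num.truncn y) < gX x0 s N by lra.
  by rewrite /gX ltrD2l ltr_pM2l// ltr_nat.
have [i iN /andP[zi zi']] := loc _ (reK _ Kz).
have [j jN /andP[zj zj']] := loc _ (imK _ Kz).
have Qz : Q i j z by split; apply/andP; split => //; exact: ltW.
have bij := QK _ _ _ Kz Qz.
pose z0 := mk (gX x0 s i + s / 2) (gX x0 s j + s / 2) : C.
have gap (k l : nat) (x : R) : gX x0 s k < x < gX x0 s k.+1 ->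
    gX x0 s l <= x <= gX x0 s l.+1 -> k = l.
  rewrite /gX => /andP[a1 a2] /andP[a3 a4].
  have h1 : (k < l.+1)%N by rewrite -(ltr_nat R) -(ltr_pM2l s0); clear -a1 a2 a3 a4; lra.
  have h2 : (l < k.+1)%N by rewrite -(ltr_nat R) -(ltr_pM2l s0); clear -a1 a2 a3 a4; lra.
  by apply/eqP; rewrite eqn_leq -ltnS h1 -ltnS h2.
have notsupp (x y : R) : gX x0 s i < x < gX x0 s i.+1 ->
    gX x0 s j < y < gX x0 s j.+1 -> ~ supp G (mk x y).
  move=> hx hy /suppP[k [l [k' [l' [bb [q1 q2] [q3 q4]]]]]].
  move: bb; rewrite -(gap _ _ _ hx q1) -(gap _ _ _ hx q3).
  by rewrite -(gap _ _ _ hy q2) -(gap _ _ _ hy q4) eqxx.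
(* As [z] may lie on a grid line, the pole is first moved to the centre of its cell: for [t < 1] the
   segment runs in the open cell, which the support avoids. *)
rewrite (@winding_const _ G z z0 wG eG); last first.
  move=> t /andP[t0 t1]; have [->|tn] := eqVneq t 1.
    by rewrite rc1 mul1r addrC subrK => /sG[].
  have t1' : t < 1 by rewrite lt_neqAle tn.
  rewrite -(mk_re_im (_ + _)); apply: notsupp.
    rewrite reD mulrC re_mulrc reD reN re_mk gXS.
    have : gX x0 s i.+1 = gX x0 s i + s by rewrite gXS.
    by move: zi zi'; rewrite gXS => y1 y2 _; clear -y1 y2 s0 t0 t1 t1'; apply/andP; split; nra.
  rewrite imD mulrC im_mulrc imD imN im_mk gXS.
  by move: zj zj'; rewrite gXS => y1 y2; clear -y1 y2 s0 t0 t1 t1'; apply/andP; split; nra.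
rewrite /G Iint_grid// (bigD1_seq i) ?mem_index_iota ?iota_uniq//=.
rewrite (bigD1_seq j) ?mem_index_iota ?iota_uniq//=.
have dz a b' : ~ Q a b' z0 -> rint (fun w => (w - z0)^-1) (gX x0 s a) (gX x0 s a.+1)
    (gY x0 s b') (gY x0 s b'.+1) = 0.
  by move=> nQ; apply: goursat => //; exact: holo_inv_sub.
have c1 : gX x0 s i < gX x0 s i + s / 2 < gX x0 s i.+1 by rewrite gXS; clear -s0; lra.
have c2 : gX x0 s j < gX x0 s j + s / 2 < gX x0 s j.+1 by rewrite gXS; clear -s0; lra.
rewrite !big1 ?addr0; first last.
- move=> j' jj'; rewrite dz ?mulr0// => -[_ /(gap _ _ _ c2) h].
  by rewrite h eqxx in jj'.
- move=> i' ii'; apply: big1 => j' _; rewrite dz ?mulr0// => -[/(gap _ _ _ c1) h _].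
  by rewrite h eqxx in ii'.
have := @rint_inv R (gX x0 s i + s / 2) (gX x0 s j + s / 2) (s / 2) ltac:(by rewrite divr_gt0).
rewrite /c bij mul1r gXS gYS => <-; congr rint; rewrite /gY -/(gX x0 s j); clear; lra.
Qed.

End ContourExists.

(** * Cauchy's formula, the maximum principle and logarithms *)

Section Holomorphic.
Context {R : realType}.
Local Notation C := (plane R).
Implicit Types (z w p u : C) (K U B X : set C) (f g F : C -> C) (G : @contour R).

Definition der f z : C := xget 0 [set d | hasd f z d].

Lemma derP U f z : holo U f -> U z -> hasd f z (der f z).
Proof. by move=> hf /hf[d fd]; exact: (xgetI 0 fd). Qed.

Lemma derE f z d : hasd f z d -> der f z = d.
Proof. by move=> fd; apply: (hasd_uniq (xgetI 0 fd) fd). Qed.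

Definition cball z (r : R) : set C := [set w | nm (w - z) <= r].
Definition oball z (r : R) : set C := [set w | nm (w - z) < r].

Lemma oball_open z r : open (oball z r). Proof. exact: open_ball. Qed.

Lemma oball_center z r : 0 < r -> oball z r z.
Proof. by move=> r0; rewrite /oball /mkset subrr nm0. Qed.

Lemma cball_compact z r : compact (cball z r).
Proof.
apply: (@bounded_closed_compact_plane _ _ (nm z + r)).
  apply/closed_planeP => w /negP; rewrite -ltNge => rw.
  exists (nm (w - z) - r); first by rewrite subr_gt0.
  move=> u uw; rewrite /cball /= => uz; have := nm_triangle u w z.
  by rewrite (nmB w u); lra.
by move=> w; rewrite /cball /= => wz; have := nmD (w - z) z; rewrite subrK; lra.
Qed.

Lemma open_cball U z : open U -> U z -> exists2 r : R, 0 < r & cball z r `<=` U.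
Proof.
move=> /open_planeP oU /oU[r r0 hr]; exists (r / 2); first by rewrite divr_gt0.
by move=> w; rewrite /cball /= => wz; apply: hr; lra.
Qed.

Lemma diffquot_spec U f p (q := fun w => if w == p then der f p else (f w - f p) / (w - p)) :
  open U -> holo U f -> U p ->
  (forall z, U z -> ccont q z) /\ (forall z, U z -> z != p -> exists D, hasd q z D).
Proof.
move=> oU hf Up; have off z : U z -> z != p -> exists D, hasd q z D.
  move=> Uz zp; have [d fd] := hf _ Uz; eexists; apply: hasd_near.
    have zp0 : z - p != 0 by rewrite subr_eq0.
    exact: hasdM (hasdB fd (hasd_cst (f p) z))
      (hasdV (f := fun w => w - p) zp0 (hasdB (hasd_id z) (hasd_cst p z))).
  exists (nm (z - p)); first by rewrite nm_gt0 subr_eq0.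
  move=> w wz; rewrite /q; case: eqP => // wp; move: wz; rewrite wp nmB ltxx//.
split => // z Uz; have [->|zp] := eqVneq z p; last first.
  by have [D] := off _ Uz zp; exact: hasd_ccont.
move=> e e0; have e20 : 0 < e / 2 by rewrite divr_gt0.
have [r r0 hr] := derP hf Up e20; exists r => // w wr.
rewrite /q eqxx; case: eqP => [_|/eqP wp]; first by rewrite subrr nm0.
have wp0 : w - p != 0 by rewrite subr_eq0.
rewrite (_ : _ - _ = (f w - f p - der f p * (w - p)) / (w - p)); last by field.
rewrite nmM nmV ltr_pdivrMr ?nm_gt0// (le_lt_trans (hr _ wr))//.
by rewrite ltr_pM2r ?nm_gt0//; lra.
Qed.

Definition cauchy_contour U K G := [/\ wfc G, forall z, supp G z -> U z /\ ~ K z,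
  exact_on G, forall f, holo U f -> Iint G f = 0 &
  forall f z, holo U f -> K z -> Iint G (fun w => f w * (w - z)^-1) = tpi * f z].

(** Cauchy's formula is the vanishing of the integral of the difference quotient at [z], together
    with the value [tpi] for the kernel. *)
Lemma cauchy_contour_exists U K : open U -> compact K -> K `<=` U ->
  exists G, cauchy_contour U K G.
Proof.
move=> oU cK KU; have [G [wG sG eG G0 Gw]] := contour_exists oU cK KU.
exists G; split => //.
  move=> f hf; apply: (G0 f 0); first by move=> z; exact: holo_ccont.
  by move=> z /hf.
move=> f z hf Kz; have Uz := KU _ Kz.
have [cq dq] := diffquot_spec oU hf Uz.
have sz w : supp G w -> w != z by move=> /sG[_]; apply: contra_notN => /eqP ->.
have ck w : supp G w -> ccont (fun w => (w - z)^-1) w.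
  by move=> sw; exact: ccont_kernel (sz _ sw).
have cf w : supp G w -> ccont f w by move=> /sG[Uw _]; exact: holo_ccont Uw.
have := G0 _ _ cq dq.
rewrite (@eq_Iint _ _ wG _ (fun w => f w * (w - z)^-1 - f z * (w - z)^-1)).
- rewrite IintB//.
  + by rewrite IintMl// Gw// => /eqP; rewrite subr_eq0 mulrC => /eqP.
  + by move=> w sw; apply: ccontM; [exact: cf|exact: ck].
  + by move=> w sw; apply: ccontM; [exact: ccont_cst|exact: ck].
- by move=> w /sG[Uw _]; exact: cq.
- by move=> w sw; rewrite (negbTE (sz _ sw)) mulrBl.
Qed.

(** Near a point, Cauchy's formula presents [f] as a Cauchy transform over a fixed contour, which is
    twice differentiable. *)
Lemma holo_der U f : open U -> holo U f -> holo U (der f).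
Proof.
move=> oU hf z0 Uz0; have [r r0 rU] := open_cball oU Uz0.
have [G [wG sG eG G0 Gf]] := cauchy_contour_exists oU (@cball_compact z0 r) rU.
have cf w : supp G w -> ccont f w by move=> /sG[Uw _]; exact: holo_ccont Uw.
have ns z : nm (z - z0) < r -> ~ supp G z.
  by move=> zr /sG[_]; apply; exact: ltW.
have d1 z : nm (z - z0) < r ->
    hasd f z (tpi^-1 * Iint G (fun w => f w * ((w - z)^-1 * (w - z)^-1))).
  move=> zr; apply: hasd_near.
    by apply: hasdMl; exact: (cauchy_hasd wG cf (ns _ zr)).
  exists (r - nm (z - z0)); first by rewrite subr_gt0.
  move=> u uz; rewrite Gf//; first by rewrite mulKf// tpi_neq0.
  rewrite /cball /=; have := nm_triangle z u z0.
  lra.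
have zz : nm (z0 - z0) < r by rewrite subrr nm0.
have h2 := hasdMl tpi^-1 (cauchy_hasd2 wG cf (ns _ zz)).
eexists; apply: (hasd_near h2).
by exists r => // w wr; rewrite (derE (d1 _ wr)).
Qed.

Lemma rect_compact (a b c d : R) : compact (rect a b c d : set C).
Proof.
apply: (@bounded_closed_compact_plane _ _ (`|a| + `|b| + (`|c| + `|d|))).
  apply/closed_planeP => z nz.
  pose e := Num.max (Num.max (a - re z) (re z - b)) (Num.max (c - im z) (im z - d)).
  have e0 : 0 < e.
    rewrite ltNge; apply/negP => h; apply: nz; move: h.
    rewrite /e !ge_max => /andP[/andP[? ?] /andP[? ?]].
    by split; apply/andP; split; lra.
  exists e => // w wz [/andP[w1 w2] /andP[w3 w4]]; move: wz; rewrite ltNge => /negP; apply.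
  have h1 := re_le_nm (w - z); have h2 := im_le_nm (w - z).
  rewrite reD reN in h1; rewrite imD imN in h2.
  have h3 := ler_norm (re w - re z); have h4 := ler_norm (re z - re w).
  have h5 := ler_norm (im w - im z); have h6 := ler_norm (im z - im w).
  rewrite (distrC (re z)) in h4; rewrite (distrC (im z)) in h6.
  by rewrite /e !ge_max; apply/andP; split; apply/andP; split; lra.
move=> z [/andP[z1 z2] /andP[z3 z4]]; rewrite (le_trans (nm_le_reim _))//.
have := ler_norm b; have := ler_norm (- a); have := ler_norm d; have := ler_norm (- c).
rewrite !normrN => h1 h2 h3 h4.
have := normr_ge0 a; have := normr_ge0 b; have := normr_ge0 c; have := normr_ge0 d.
by move=> *; apply: lerD; rewrite ler_norml; apply/andP; split; lra.
Qed.

Lemma rect_oball p (r : R) : 0 < r ->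
  rect (re p - r / 3) (re p + r / 3) (im p - r / 3) (im p + r / 3) `<=` oball p r.
Proof.
move=> r0 z [/andP[z1 z2] /andP[z3 z4]]; rewrite /oball /=.
rewrite (le_lt_trans (nm_le_reim _))// reD imD reN imN.
have h1 : `|re z - re p| <= r / 3 by rewrite ler_norml; lra.
have h2 : `|im z - im p| <= r / 3 by rewrite ler_norml; lra.
lra.
Qed.

(** The square of half-side [r / 3] fits in the disc of radius [r] and contains that of radius
    [r / 3]. *)
Lemma ball_primitive f p (r : R) : 0 < r ->
  (forall z, oball p r z -> ccont f z) ->
  (forall a b c d, a <= b -> c <= d -> rect a b c d `<=` oball p r ->
     rint f a b c d = 0) ->
  exists F, forall z, oball p (r / 3) z -> hasd F z (f z).
Proof.
move=> r0 cf f0; have rb := rect_oball r0 (p := p).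
have [F dF] := @morera_square R f (re p - r / 3) (re p + r / 3)
  (im p - r / 3) (im p + r / 3) (fun z rz => cf z (rb z rz)) (fun a b c d h1 h2 h3 h4 h5 h6 =>
   f0 a b c d h2 h5 (subset_trans (rect_sub h1 h3 h4 h6) rb)).
exists F => z; rewrite /oball /= => zr; apply: dF.
  have := re_le_nm (z - p); rewrite reD reN => h.
  have := le_lt_trans h zr; rewrite ltr_norml; lra.
have := im_le_nm (z - p); rewrite imD imN => h.
have := le_lt_trans h zr; rewrite ltr_norml; lra.
Qed.

Lemma morera U f : open U -> (forall z, U z -> ccont f z) ->
  (forall a b c d, a <= b -> c <= d -> rect a b c d `<=` U -> rint f a b c d = 0) ->
  holo U f.
Proof.
move=> oU cf f0 p Up; have [r r0 rU] := open_cball oU Up.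
have bU : oball p r `<=` U by move=> z /= zr; apply: rU; exact: ltW.
have [F dF] := ball_primitive r0 (fun z zr => cf _ (bU _ zr))
  (fun a b c d h1 h2 h3 => f0 a b c d h1 h2 (subset_trans h3 bU)).
have r30 : 0 < r / 3 by rewrite divr_gt0.
have hF : holo (oball p (r / 3)) F by move=> z /dF; exists (f z).
have pp : oball p (r / 3) p by rewrite /oball /= subrr nm0.
have [D hD] := holo_der (@oball_open p (r / 3)) hF pp.
exists D; apply: (hasd_near hD); exists (r / 3) => // w wr.
by rewrite (derE (dF _ wr)).
Qed.

Lemma removable U f p : open U -> (forall z, U z -> ccont f z) ->
  (forall z, U z -> z != p -> exists D, hasd f z D) -> holo U f.
Proof.
move=> oU cf hf; apply: morera => // a b c d ab cd rU.
apply: (@goursat_except _ _ _ _ _ _ p) => // z rz; first exact: cf (rU _ rz).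
exact: hf (rU _ rz).
Qed.

Lemma diffquot U f p : open U -> holo U f -> U p ->
  exists q, [/\ holo U q, q p = der f p &
    forall w, w != p -> q w = (f w - f p) / (w - p)].
Proof.
move=> oU hf Up; have [cq dq] := diffquot_spec oU hf Up.
exists (fun w => if w == p then der f p else (f w - f p) / (w - p)); split.
- exact: removable cq dq.
- by rewrite eqxx.
- by move=> w /negbTE ->.
Qed.

Lemma weierstrass U f : open U ->
  (forall K, compact K -> K `<=` U -> forall e : R, 0 < e ->
     exists2 g, holo U g & forall z, K z -> nm (f z - g z) <= e) -> holo U f.
Proof.
move=> oU h; have cf z : U z -> ccont f z.
  move=> Uz e e0; have [r r0 rU] := open_cball oU Uz.
  have e40 : 0 < e / 4 by rewrite divr_gt0.
  have [g hg fg] := h _ (@cball_compact z r) rU _ e40.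
  have [d d0 hd] := holo_ccont hg Uz e40.
  exists (Num.min r d); first by rewrite lt_min r0.
  move=> w; rewrite lt_min => /andP[wr wd].
  have := nm_triangle (g w) (f w) (f z); have := nm_triangle (g z) (g w) (f z).
  have := fg w (ltW wr); have := fg z ltac:(by rewrite /cball /= subrr nm0 ltW).
  by rewrite (nmB (f z)); have := hd _ wd; lra.
apply: morera => // a b c d ab cd rU.
have S0 : 0 <= 2 * ((b - a) + (d - c)) by lra.
apply/eqP; rewrite -nm_eq0 eq_le nm_ge0 andbT; apply/ler_addgt0Pr => e e0.
have e'0 : 0 < e / (2 * ((b - a) + (d - c)) + 1) by rewrite divr_gt0//; lra.
have [g hg fg] := h _ (@rect_compact a b c d) rU _ e'0.
have cf' z : rect a b c d z -> ccont f z by move=> /rU; exact: cf.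
have cg z : rect a b c d z -> ccont g z by move=> /rU; exact: holo_ccont.
have g0 : rint g a b c d = 0 by apply: goursat => //; exact: holo_sub rU hg.
have := rint_bound (fun z rz => ccontB (cf' z rz) (cg z rz)) ab cd fg.
rewrite rintB// g0 subr0 => H; rewrite add0r (le_trans H)//.
rewrite mulrAC ler_pdivrMr; last by lra.
by rewrite ler_wpM2l ?(ltW e0)//; lra.
Qed.

Lemma exp_unbounded (q M : R) : 1 < q -> exists k, M < q ^+ k.
Proof.
move=> q1; have bern k : 1 + k%:R * (q - 1) <= q ^+ k.
  elim: k => [|k IH]; first by rewrite mul0r addr0 expr0.
  have q0 : 0 <= q by lra.
  rewrite exprS -natr1 (le_trans _ (ler_wpM2l q0 IH))//.
  have : 0 <= k%:R * (q - 1) ^+ 2 by rewrite mulr_ge0// sqr_ge0.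
  by nra.
exists (Num.truncn (M / (q - 1))).+1; apply: lt_le_trans (bern _).
have := truncnS_gt (M / (q - 1)); rewrite ltr_pdivrMr; last by lra.
lra.
Qed.

(** Cauchy's formula for [f ^+ k] over a contour around the part where [M' <= nm (f z)]: on the
    contour [nm (f w) <= M'], so the powers of [nm (f p) / M'], a number above 1, would stay
    bounded. *)
Lemma max_principle B X f (M : R) : open B -> (exists M0, forall z, B z -> nm z <= M0) ->
  closure B `<=` B `|` X -> (forall z, B z \/ X z -> ccont f z) -> holo B f ->
  (forall z, X z -> nm (f z) <= M) -> forall z, B z -> nm (f z) <= M.
Proof.
move=> oB [M0 hM0] cB cf hf fX p Bp; rewrite leNgt; apply/negP => Mp.
have M_ge0 : 0 <= M \/ M < 0 by case: (leP 0 M); [left|right].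
(* [M'] lies strictly between [M] and [nm (f p)]; the second entry keeps it positive when [M] is
   negative. *)
pose M' := Num.max ((M + nm (f p)) / 2) (nm (f p) / 2).
have fp0 : 0 < nm (f p).
  rewrite lt_def nm_ge0 andbT; apply/eqP => fp.
  (* With [M < 0] no point lies in [X], so [B] is compact and open and a contour around it in itself
     has empty support. *)
  case: M_ge0 => M0'; first by move: Mp; rewrite fp; lra.
  have BX : closed B.
    move=> z /cB[//|/fX]; have := nm_ge0 (f z); lra.
  have cpt : compact B by exact: (bounded_closed_compact_plane BX hM0).
  have [G [wG sG eG G0 Gf]] := cauchy_contour_exists oB cpt (@subset_refl _ B).
  have G00 g : Iint G g = 0.
    by apply: (eG (fun=> 0)) => w /sG[].
  have := Gf (fun=> 1) p (@holo_cst R B 1) Bp; rewrite G00 mulr1 => /esym/eqP.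
  by rewrite (negbTE tpi_neq0).
have M'p : M' < nm (f p) by rewrite /M' gt_max; apply/andP; split; lra.
have MM' : M < M' by rewrite /M' lt_max; apply/orP; left; lra.
have M'0 : 0 < M' by rewrite /M' lt_max; apply/orP; right; lra.
pose K := [set z | B z /\ M' <= nm (f z)].
have cK : compact K.
  apply: (@bounded_closed_compact_plane _ _ M0); last by move=> z [/hM0].
  move=> z czK; have cz : closure B z.
    by apply: closure_subset czK => w [].
  have [//|h] := pselect (B z /\ M' <= nm (f z)); exfalso.
  have zBX : B z \/ X z by exact: cB cz.
  have fz : nm (f z) < M'.
    rewrite ltNge; apply/negP => h'; case: zBX => [Bz|Xz]; first by apply: h.
    by have := fX _ Xz; lra.
  have fz0 : 0 < M' - nm (f z) by rewrite subr_gt0.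
  have [r r0 hr] := cf _ zBX _ fz0.
  have [w [[_ fw] /hr wz]] := czK [set w | nm (w - z) < r]
    ltac:(by apply/nbhs_planeP; exists r).
  by have := nm_subl (f w) (f z); lra.
have [G [wG sG eG G0 Gf]] := cauchy_contour_exists oB cK (fun z h => proj1 h).
have Kp : K p by split => //; exact: ltW.
have [e e0 he] := compact_dist (@supp_compact R G) (fun s => proj2 (sG p s) Kp).
have q1 : 1 < nm (f p) / M' by rewrite ltr_pdivlMr// mul1r.
have tpi0 : 0 < nm (tpi : C) by rewrite nm_gt0 tpi_neq0.
have [k] := exp_unbounded (clen G / e / nm (tpi : C)) q1.
apply/negP; rewrite -leNgt expr_div_n ler_pdivrMr ?exprn_gt0// -nmX.
have wp w : supp G w -> w != p by move=> /he; rewrite -subr_eq0 -nm_gt0; lra.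
have := @Iint_bound R G wG (fun w => f w ^+ k * (w - p)^-1) (M' ^+ k / e) _ _.
rewrite (Gf _ _ (holoX k hf) Kp) => H.
rewrite -(ler_pM2l tpi0) -nmM (_ : _ * (_ * _) = clen G * (M' ^+ k / e)); last first.
  by field; rewrite !gt_eqF.
apply: H.
- move=> w sw; apply: ccontM; last exact: ccont_kernel (wp _ sw).
  by have [Bw _] := sG _ sw; apply: holo_ccont Bw; exact: (holoX k hf).
- move=> w sw; have [Bw nK] := sG _ sw.
  rewrite nmM nmX nmV ler_pM ?invr_ge0 ?exprn_ge0 ?nm_ge0//.
    rewrite lerXn2r ?nnegrE ?nm_ge0 ?(ltW M'0)// leNgt; apply/negP => h.
    by apply: nK; split => //; exact: ltW.
  by rewrite lef_pV2 ?posrE ?he// nm_gt0 subr_eq0 wp.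
Qed.

Definition ck (q : option C) z : C := if q is Some a then (z - a)^-1 else 0.

(* [logeq X q q']: the function (z - q) / (z - q') has a holomorphic logarithm
   near X, the factor belonging to the point at infinity being 1. *)
Definition logeq X (q q' : option C) := exists (V : set C) (u : C -> C), [/\ open V, X `<=` V &
  forall z, V z -> hasd u z (ck q z - ck q' z)].

(** A contour in [B] around [p] and the points of [B] off [V] runs inside [V]. A logarithm would
    make the integral of the difference of the kernels vanish, but it equals [tpi]. *)
Lemma no_logeq B X p q : open B -> (exists M0, forall z, B z -> nm z <= M0) ->
  closure B `<=` B `|` X -> B p -> (forall b, q = Some b -> ~ B b) ->
  ~ logeq X (Some p) q.
Proof.
move=> oB [M0 hM0] cB Bp Bq [V [u [oV XV dU]]].
pose K := [set z | z = p \/ B z /\ ~ V z].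
have cK : compact K.
  apply: (@bounded_closed_compact_plane _ _ M0); last first.
    by move=> z [->|[Bz _]]; exact: hM0.
  have -> : K = [set p] `|` (B `&` ~` V) by [].
  apply: closedU; first exact: compact_closed_plane (@compact_set1 _ p).
  move=> z cz; have nVz : ~ V z.
    have : closed (~` V) by exact: open_closedC.
    by apply; apply: closure_subset cz => w [].
  split => //; have [//|/XV//] : (B `|` X) z.
  by apply: cB; apply: closure_subset cz => w [].
have KB : K `<=` B by move=> z [->//|[]].
have [G [wG sG eG G0 Gf]] := cauchy_contour_exists oB cK KB.
have sV z : supp G z -> V z.
  move=> /sG[Bz nK]; have [//|nV] := pselect (V z).
  by exfalso; apply: nK; right.
have pG w : supp G w -> w != p.
  by move=> /sG[_ nK]; apply: contra_notN nK => /eqP ->; left.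
have hq : holo B (ck q).
  by case: q Bq {dU} => [a|] Bq; [apply: holo_inv_sub; exact: Bq|exact: holo_cst].
have h1 := Gf _ _ (@holo_cst R B 1) (or_introl erefl : K p).
have := eG u (fun w => ck (Some p) w - ck q w) (fun w sw => dU _ (sV _ sw)).
rewrite IintB//.
- rewrite (G0 _ hq) subr0 => h2; move: h1; rewrite mulr1.
  rewrite (_ : (fun w => _) = ck (Some p)) ?h2; last by apply/funext => w; rewrite mul1r.
  by move=> /esym/eqP; rewrite (negbTE tpi_neq0).
- by move=> w sw; exact: ccont_kernel (pG _ sw).
- by move=> w /sG[Bw _]; exact: holo_ccont hq Bw.
Qed.

End Holomorphic.

(** * Open mapping and univalent functions *)

Section OpenMapping.
Context {R : realType}.
Local Notation C := (plane R).
Implicit Types (z w p u a : C) (K U V : set C) (f g : C -> C).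

(** The constant comes from one contour around 0 in the unit disc, carried to every disc by scaling.
    Cauchy's formula is applied to the difference quotient, whose value at 0 is the derivative. *)
Lemma cauchy_estimate : exists2 k : R, 0 < k & forall f p (r M : R), 0 < r ->
  holo (oball p r) f -> (forall z, oball p r z -> nm (f z) <= M) ->
  nm (der f p) <= k * M / r.
Proof.
have K0 : [set (0 : C)] `<=` oball 0 1 by move=> _ ->; exact: oball_center.
have [G [wG sG eG G0 Gf]] :=
  cauchy_contour_exists (@oball_open R 0 1) (@compact_set1 _ (0 : C)) K0.
have [e e0 he] := compact_dist (@supp_compact R G) (fun s => proj2 (sG 0 s) erefl).
have tpi0 : 0 < nm (tpi : C) by rewrite nm_gt0 tpi_neq0.
exists (2 * clen G / (e ^+ 2 * nm (tpi : C)) + 1).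
  rewrite ltr_wpDl// divr_ge0 ?mulr_ge0 ?clen_ge0 ?exprn_ge0 ?(ltW e0) ?nm_ge0//.
move=> f p r M r0 hf fM.
pose l w := p + rc r * w.
have ol w : oball 0 1 w -> oball p r (l w).
  rewrite /oball /= subr0 /l addrC addKr nmM nm_rc gtr0_norm// => w1.
  by rewrite gtr_pMr.
have dl w : hasd l w (rc r).
  apply: hasd_eq; first exact: hasdD (hasd_cst p w) (hasdMl (rc r) (hasd_id w)).
  by rewrite add0r mulr1.
have hF : holo (oball 0 1) (fun w => f (l w)).
  by apply: (holo_comp ol) => // w _; exists (rc r).
have oo : oball 0 1 (0 : C) by apply: K0.
have [q [hq q0 qE]] := diffquot (@oball_open R 0 1) hF oo.
have pp : oball p r p by exact: oball_center.
have l0 : l 0 = p by rewrite /l mulr0 addr0.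
have dF : der (fun w => f (l w)) 0 = der f p * rc r.
  by apply: derE; apply: (hasd_comp (dl 0)); rewrite l0; exact: derP hf pp.
have s0 w : supp G w -> w != 0.
  by move=> /he; rewrite subr0 -nm_gt0; exact: lt_le_trans.
have cq w : supp G w -> ccont (fun w => q w * (w - 0)^-1) w.
  move=> sw; apply: ccontM; last exact: ccont_kernel (s0 _ sw).
  by have [ow _] := sG _ sw; exact: holo_ccont hq ow.
have M0 : 0 <= M by rewrite (le_trans (nm_ge0 _) (fM _ pp)).
have := Iint_bound wG cq (M := 2 * M / e ^+ 2) _.
rewrite (Gf _ _ hq erefl) q0 dF => H.
have {}H : nm (tpi * (der f p * rc r)) <= clen G * (2 * M / e ^+ 2).
  apply: H => w sw; have [ow _] := sG _ sw; have h := he _ sw.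
  rewrite qE ?s0// nmM nmV nmM nmV -mulrA -invfM ler_pM ?nm_ge0 ?invr_ge0 ?mulr_ge0 ?nm_ge0//.
    rewrite (le_trans (nmD _ _))// nmN l0.
    by have := fM _ pp; have := fM _ (ol _ ow); lra.
  rewrite subr0 in h *; rewrite -expr2 lef_pV2 ?posrE ?exprn_gt0//.
    by rewrite lerXn2r ?nnegrE ?nm_ge0 ?(ltW e0).
  exact: lt_le_trans h.
rewrite ler_pdivlMr//; move: H; rewrite nmM (nmM (der f p)) nm_rc gtr0_norm// => H.
rewrite mulrDl mul1r ler_wpDr// -(ler_pM2l tpi0) (le_trans H)//.
by rewrite le_eqVlt; apply/orP; left; apply/eqP; field; rewrite !gt_eqF.
Qed.

Lemma closure_oball a (r : R) : closure (oball a r) `<=` cball a r.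
Proof.
rewrite closureE => z; apply; split; last by move=> w /= /ltW.
exact: compact_closed_plane (@cball_compact R a r).
Qed.

(** If [w] were omitted, the maximum principle for [(f z - w)^-1] would give [d <= nm (f a - w)]. *)
Lemma min_modulus V f a w (r d : R) : 0 < r -> 0 < d -> holo V f -> cball a r `<=` V ->
  (forall z, nm (z - a) = r -> 2 * d <= nm (f z - f a)) ->
  nm (w - f a) < d -> exists2 z, nm (z - a) < r & f z = w.
Proof.
move=> r0 d0 hf rV hd wa; apply: contrapT => nz.
have f0 z : cball a r z -> f z - w != 0.
  rewrite /cball /= le_eqVlt => /orP[/eqP/hd h|zr]; last first.
    by rewrite subr_eq0; apply: contra_not_neq nz => <-; exists z.
  by rewrite -nm_gt0; have := nm_triangle w (f z) (f a); lra.
have cg z : cball a r z -> exists D, hasd (fun z => (f z - w)^-1) z D.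
  move=> zr; have [D fD] := hf _ (rV _ zr); eexists.
  exact: (hasdV (f := fun z => f z - w) (f0 _ zr) (hasdB fD (hasd_cst w z))).
have Bc z : oball a r z -> cball a r z by rewrite /oball /cball /= => /ltW.
have aa : oball a r a by exact: oball_center.
have := @max_principle R (oball a r) [set z | nm (z - a) = r]
  (fun z => (f z - w)^-1) d^-1 (@oball_open R a r) _ _ _ _ _ a aa.
rewrite nmV nmB => H; move: (wa); rewrite -[_ < _]negbK -leNgt => /negP; apply.
rewrite -lef_pV2 ?posrE//; last by rewrite nmB nm_gt0; apply: f0; exact: Bc.
apply: H.
- exists (nm a + r) => z; rewrite /oball /= => zr.
  by have := nmD (z - a) a; rewrite subrK; lra.
- move=> z /closure_oball; rewrite /cball /= le_eqVlt => /orP[/eqP|]; by [right|left].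
- move=> z [/Bc|/= zr]; [|have : cball a r z by rewrite /cball /= zr].
    by move=> /cg[D]; exact: hasd_ccont.
  by move=> /cg[D]; exact: hasd_ccont.
- by move=> z /Bc /cg.
- move=> z /= /hd h; rewrite nmV lef_pV2 ?posrE//.
    by have := nm_triangle w (f z) (f a); lra.
  by rewrite (lt_le_trans d0)//; have := nm_triangle w (f z) (f a); lra.
Qed.

Lemma sphere_compact a (r : R) : compact [set z : C | nm (z - a) = r].
Proof.
apply: (@subclosed_compact _ _ (cball a r)); last 2 first.
- exact: cball_compact.
- by move=> z /= zr; rewrite /cball /= zr.
apply/closed_planeP => z /= /eqP zr.
exists `|nm (z - a) - r|; first by rewrite normr_gt0 subr_eq0.
move=> w wz /= wr; move: wz; rewrite ltNge => /negP; apply; rewrite -wr.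
have := nm_triangle w z a; have := nm_triangle z w a; rewrite (nmB z w).
by rewrite ler_norml; lra.
Qed.

Section Injective.
Variables (U : set C) (f : C -> C).
Hypotheses (oU : open U) (hf : holo U f)
  (injf : forall x y, U x -> U y -> f x = f y -> x = y).

Lemma inj_local a (e : R) : U a -> 0 < e -> exists (r d : R),
  [/\ 0 < r <= e, 0 < d, cball a r `<=` U &
   forall w, nm (w - f a) < d -> exists2 z, nm (z - a) < r & f z = w].
Proof.
move=> Ua e0; have [r0 r00 r0U] := open_cball oU Ua.
pose r := Num.min r0 e; have r_gt0 : 0 < r by rewrite lt_min r00.
have rU : cball a r `<=` U.
  move=> z; rewrite /cball /= => zr; apply: r0U; rewrite /cball /= (le_trans zr)//.
  by rewrite ge_min lexx.
have sU z : nm (z - a) = r -> U z by move=> zr; apply: rU; rewrite /cball /= zr.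
have [||d d0 hd] := @compact_cont_pos R _ (fun z => f z - f a) (@sphere_compact a r).
- by move=> z /= /sU Uz; apply: ccontB; [exact: holo_ccont hf Uz|exact: ccont_cst].
- move=> z /= zr; rewrite subr_eq0; apply/eqP => /(injf (sU _ zr) Ua) za.
  by move: zr; rewrite za subrr nm0; lra.
exists r, (d / 2); split => //.
- by rewrite r_gt0 ge_min lexx orbT.
- by rewrite divr_gt0.
- move=> w wa; apply: (min_modulus r_gt0 _ hf rU _ wa); first by rewrite divr_gt0.
  by move=> z /hd /=; lra.
Qed.

Lemma der_neq0_dense z (e : R) : U z -> 0 < e ->
  exists z', [/\ nm (z' - z) < e, U z' & der f z' != 0].
Proof.
move=> Uz e0; apply: contrapT => nz; have [r r0 rU] := open_cball oU Uz.
pose s := Num.min r (e / 2); have s0 : 0 < s by rewrite lt_min r0 divr_gt0.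
have sr : s <= r by rewrite ge_min lexx.
have se : s <= e / 2 by rewrite ge_min lexx orbT.
have zs : nm (z + rc s - z) = s by rewrite addrC addKr nm_rc gtr0_norm.
have Uzs : U (z + rc s) by apply: rU; rewrite /cball /= zs.
have d0 w : nm (w - z) <= s -> U w /\ der f w = 0.
  move=> ws; have Uw : U w by apply: rU; rewrite /cball /=; lra.
  split => //; apply/eqP/negPn/negP => dw; apply: nz; exists w; split => //; lra.
have := @mean_value_seg R f (fun=> 0) (z + rc s) z 0.
rewrite mul0r => H; have : f (z + rc s) = f z.
  apply/eqP; rewrite -subr_eq0 -nm_eq0 eq_le nm_ge0 andbT H// => t /andP[t0 t1].
  split; last by rewrite nm0.
  have [|Uw dw] := d0 (z + rc t * (z + rc s - z)).
    rewrite addrC addKr nmM zs nm_rc ger0_norm//; nra.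
  by rewrite -dw; exact: derP hf Uw.
move=> /(injf Uzs Uz) E; move: zs; rewrite E subrr nm0; lra.
Qed.

(** The inverse is the integral of [z * der f z / (f z - w)] divided by [tpi]. The formula is
    checked where [der f] does not vanish, a dense set, and extended by continuity; that [der f]
    vanishes nowhere is then a corollary. *)
Lemma inj_inverse : exists2 psi, holo (f @` U) psi & forall z, U z -> psi (f z) = z.
Proof.
pose psi w := xget 0 [set z | U z /\ f z = w].
have psiE z : U z -> psi (f z) = z.
  move=> Uz; rewrite /psi; case: xgetP => [y _ [Uy fy]|/(_ z)]; last by case.
  exact: injf.
exists psi => // _ [a Ua <-].
have [r [d [/andP[r0 _] d0 rU hd]]] := inj_local Ua ltr01.
have [G [wG sG eG G0 Gf]] := cauchy_contour_exists oU (@cball_compact R a r) rU.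
pose g z := z * der f z.
have hg : holo U g by apply: holoM; [exact: holo_id|exact: holo_der].
have cg w : supp G w -> ccont g w by move=> /sG[Uw _]; exact: holo_ccont hg Uw.
have cf w : supp G w -> ccont f w by move=> /sG[Uw _]; exact: holo_ccont hf Uw.
pose W w := tpi^-1 * Iint G (fun u => g u * (f u - w)^-1).
have dW z : nm (z - a) < r -> exists D, hasd W (f z) D.
  move=> za; eexists; apply: hasdMl; apply: (cauchy_hasd_gen wG cg cf).
  move=> w sw; have [Uw nw] := sG _ sw; apply/eqP => fwz.
  have cz : cball a r z by exact: ltW.
  by apply: nw; rewrite (injf Uw (rU _ cz) fwz).
have WE z : nm (z - a) < r -> der f z != 0 -> W (f z) = z.
  move=> za dz; have Uz : U z by apply: rU; exact: ltW.
  (* As [f u - f z = (u - z) * q u] with [q] zero-free, the integral is Cauchy's formula for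
     [g / q], whose value at [z] is [z]. *)
  have [q [hq qz qE]] := diffquot oU hf Uz.
  have q0 u : U u -> q u != 0.
    move=> Uu; have [->|uz] := eqVneq u z; first by rewrite qz.
    rewrite qE// mulf_neq0 ?invr_eq0 ?subr_eq0//.
    by apply: contra_neq uz; exact: injf.
  have hH : holo U (fun u => g u * (q u)^-1) by apply: holoM => //; exact: holoV.
  have := Gf _ z hH (ltW za); rewrite /g qz mulfK// => H.
  rewrite /W -[RHS](mulKf (@tpi_neq0 R)) -H; congr (_ * _).
  have nz u : supp G u -> u != z.
    by move=> /sG[_ nu]; apply: contra_not_neq nu => ->; exact: ltW.
  apply/esym; apply: (eq_Iint wG) => u su.
    apply: ccontM; last exact: ccont_kernel (nz _ su).
    by have [Uu _] := sG _ su; exact: holo_ccont hH Uu.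
  have uz : u - z != 0 by rewrite subr_eq0 nz.
  have fuz : f u - f z != 0.
    have [Uu _] := sG _ su; rewrite subr_eq0; apply: contra_neq (nz _ su).
    exact: injf.
  by rewrite /g qE ?nz//; field; rewrite uz fuz.
have WE' z : nm (z - a) < r -> W (f z) = z.
  move=> za; apply: contrapT => /eqP nWz.
  have e0 : 0 < nm (W (f z) - z) / 2 by rewrite divr_gt0// nm_gt0 subr_eq0.
  have Uz : U z by apply: rU; exact: ltW.
  have [D hD] := dW _ za.
  have [r1 r10 h1] := ccont_comp (holo_ccont hf Uz) (hasd_ccont hD) e0.
  have m0 : 0 < Num.min (Num.min r1 (nm (W (f z) - z) / 2)) (r - nm (z - a)).
    by rewrite !lt_min r10 e0 subr_gt0.
  have [z' [+ Uz' dz']] := der_neq0_dense Uz m0.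
  rewrite !lt_min => /andP[/andP[z1 z2] z3].
  have za' : nm (z' - a) < r by have := nm_triangle z z' a; lra.
  have := h1 _ z1; rewrite WE// => h2.
  by have := nm_triangle z' (W (f z)) z; rewrite (nmB _ z'); lra.
have aa : nm (a - a) < r by rewrite subrr nm0.
have [D hD] := dW _ aa; exists D; apply: (hasd_near hD); exists d => // w /hd[z zr <-].
by rewrite WE'// psiE//; apply: rU; exact: ltW.
Qed.

Lemma inj_der_neq0 z : U z -> der f z != 0.
Proof.
move=> Uz; have [psi hpsi psiE] := inj_inverse.
have [D hD] := hpsi (f z) (ex_intro2 _ _ z Uz erefl).
have h1 := hasd_comp (derP hf Uz) hD.
have h2 : hasd (fun w => psi (f w)) z 1.
  apply: (hasd_near (hasd_id z)); have [r r0 rU] := open_cball oU Uz.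
  by exists r => // w wr; rewrite psiE//; apply: rU; exact: ltW.
have := hasd_uniq h1 h2; apply: contra_eq_neq => ->.
by rewrite mulr0 eq_sym oner_neq0.
Qed.

End Injective.

End OpenMapping.

(** * Riemann sums of Cauchy integrals *)

Section KernelApproximation.
Context {R : realType}.
Local Notation C := (plane R).
Implicit Types (z w p u a : C) (K U V : set C) (f g : C -> C) (G : @contour R).

(** Riemann sums with an error uniform over [K]. On an edge, being well approximated passes from two
    halves to the whole and holds on short intervals by continuity, so bisection gives it for the
    edge. *)
Lemma kernel_approx G g K : wfc G -> (forall w, supp G w -> ccont g w) ->
  compact K -> (forall w, supp G w -> ~ K w) -> forall e : R, 0 < e ->
  exists2 s : seq (C * C), (forall x, x \in s -> supp G x.2) &
    forall z, K z ->
      nm (Iint G (fun w => g w * (w - z)^-1) - \sum_(x <- s) x.1 * (x.2 - z)^-1) <= e.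
Proof.
move=> wG cg cK disj.
have oS : open (~` supp G).
  by apply: closed_openC; apply: compact_closed_plane; exact: supp_compact.
have KS : K `<=` ~` supp G by move=> z Kz /disj.
have [d d0 hd0] := compact_open_nbhd cK oS KS.
have hd w z : supp G w -> K z -> d <= nm (w - z).
  by move=> sw Kz; rewrite leNgt; apply/negP => /(hd0 _ _ Kz).
have cgk z w : K z -> supp G w -> ccont (fun w => g w * (w - z)^-1) w.
  move=> Kz sw; apply: ccontM; first exact: cg.
  by apply: ccont_kernel; rewrite -subr_eq0 -nm_gt0 (lt_le_trans d0)// hd.
have key x (eta : R) : x \in G -> 0 < eta ->
    exists2 s : seq (C * C), (forall y, y \in s -> supp G y.2) &
    forall z, K z -> nm (eint (fun w => g w * (w - z)^-1) x.2 -
      \sum_(y <- s) y.1 * (y.2 - z)^-1) <= eta * (hi x.2 - lo x.2).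
  move=> xG eta0; set e := x.2; have [k [k1 kE kB]] := eintE g e.
  have sup t : lo e <= t <= hi e -> supp G (ept e t) by move=> ht; exists x => //; exists t.
  have le := wG _ xG; rewrite -/e in le.
  pose h z t := g (ept e t) * (ept e t - z)^-1.
  have ih z : K z -> cintable (h z) (lo e) (hi e).
    move=> Kz; apply: (@ecintable _ (fun w => g w * (w - z)^-1)) => // w ew.
    by apply: cgk => //; exists x.
  have ihs z (a b : R) : K z -> lo e <= a -> b <= hi e -> cintable (h z) a b.
    move=> Kz ea be; have [F hF] := ih _ Kz; exists F => t /andP[ta tb].
    apply: wder_sub (hF t _) => //; by rewrite (le_trans ea ta) (le_trans tb be).
  pose good (a b : R) := exists2 s : seq (C * C), (forall y, y \in s -> supp G y.2) &
    forall z, K z -> nm (k * cint (h z) a b - \sum_(y <- s) y.1 * (y.2 - z)^-1)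
      <= eta * (b - a).
  suff [s sG sP] : good (lo e) (hi e).
    by exists s => // z Kz; rewrite kE; exact: sP.
  apply: contrapT => bad.
  have bad0 : ~ good (lo e) (hi e) /\ [/\ lo e <= lo e & hi e <= hi e] by [].
  have [n a1 b1 c1 d1 ab1 _ [bad1 [la1 hb1]] m m'|t0 [y ht0]] := @bisection R
    (fun _ (a b _ _ : R) => ~ good a b /\ [/\ lo e <= a & b <= hi e]) _ _ 0 0 le (lexx _) bad0.
    have am : a1 <= m <= b1 by rewrite /m; clear -ab1; apply/andP; split; lra.
    have /andP[am1 mb1] := am.
    have [g1|b1'] := pselect (good a1 m); last first.
      by constructor 1; split => //; split => //; exact: le_trans hb1.
    have [g2|b2'] := pselect (good m b1); last first.
      by constructor 2; split => //; split => //; exact: le_trans am1.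
    exfalso; apply: bad1; case: g1 g2 => s1 s1G s1P [s2 s2G s2P].
    exists (s1 ++ s2).
      by move=> v; rewrite mem_cat => /orP[/s1G|/s2G].
    move=> z Kz; rewrite big_cat /= (@cint_split _ _ a1 m b1)//; last exact: ihs.
    rewrite (_ : _ - _ = (k * cint (h z) a1 m - \sum_(v <- s1) v.1 * (v.2 - z)^-1) +
      (k * cint (h z) m b1 - \sum_(v <- s2) v.1 * (v.2 - z)^-1)); last by ring.
    rewrite (le_trans (nmD _ _))// (le_trans (lerD (s1P _ Kz) (s2P _ Kz)))//.
    by rewrite -mulrDr ler_pM2l//; clear; lra.
  have lt0 : lo e <= t0 <= hi e.
    have [a' [b' [c' [d' [/andP[h1 h2] /andP[h3 h4] _ _ _]]]]] := ht0 0%N.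
    by rewrite (le_trans h1 h2) (le_trans h3 h4).
  have s0 := sup _ lt0; set w0 := ept e t0 in s0.
  have B0 : 0 < nm (g w0) + 1 by rewrite ltr_wpDl ?nm_ge0.
  have [r1 r10 hr1] := cg _ s0 (eta / 2 * d) ltac:(by rewrite !(mulr_gt0, divr_gt0)).
  pose r := Num.min r1 (eta / 2 * d ^+ 2 / (nm (g w0) + 1)).
  have r0 : 0 < r by rewrite lt_min r10 /= divr_gt0// mulr_gt0 ?exprn_gt0// divr_gt0.
  have [n nr] := exp2_small (hi e - lo e) r0.
  have [a' [b' [c' [d' [/andP[h1 h2] /andP[h3 h4] _ _ [wE _ [badn _]]]]]]] := ht0 n.
  apply: badn; exists [:: (k * g w0 * rc (b' - a'), w0)].
    by move=> v; rewrite inE => /eqP ->.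
  have ab' : a' <= b' by exact: le_trans h3.
  move=> z Kz; rewrite big_seq1 /=.
  rewrite (_ : _ * rc (b' - a') * _ = k * (g w0 * (w0 - z)^-1 * rc (b' - a'))); last by ring.
  have cc : cintable (fun=> g w0 * (w0 - z)^-1) a' b'.
    apply: cont_cintable => // t _ e1 e10; exists 1 => // s _ _.
    by rewrite subrr nm0.
  rewrite -mulrBr nmM k1 mul1r -cint_cst// -cintB//; last exact: ihs.
  apply: cint_bound => //; first by apply: cintableB => //; exact: ihs.
  move=> t /andP[ta tb].
  have lt : lo e <= t <= hi e by rewrite (le_trans h1 ta) (le_trans tb h4).
  have s1 := sup _ lt; rewrite /h; set w := ept e t in s1 *.
  have ww : nm (w - w0) < r.
    rewrite /w /w0 kB nmM k1 mul1r nm_rc (le_lt_trans _ nr)// -wE ler_norml.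
    by clear -ta tb h2 h3; apply/andP; split; lra.
  move: (ww); rewrite /r lt_min => /andP[/hr1 g1].
  rewrite ltr_pdivlMr// => g2.
  have n1 := hd _ _ s1 Kz; have n0 := hd _ _ s0 Kz.
  have p1 : 0 < nm (w - z) by exact: lt_le_trans n1.
  have p0 : 0 < nm (w0 - z) by exact: lt_le_trans n0.
  have q1 : w - z != 0 by rewrite -nm_gt0.
  have q0 : w0 - z != 0 by rewrite -nm_gt0.
  rewrite (_ : _ - _ = (g w - g w0) / (w - z) - g w0 * (w - w0) / ((w - z) * (w0 - z))); last first.
    by field; rewrite q1 q0.
  rewrite (le_trans (nmD _ _))// nmN [eta]splitr lerD//.
    rewrite nmM nmV ler_pdivrMr// (le_trans (ltW g1))// ler_pM2l// divr_gt0//.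
  rewrite !nmM nmV nmM ler_pdivrMr ?mulr_gt0//.
  apply: (@le_trans _ _ (eta / 2 * d ^+ 2)).
    rewrite (le_trans _ (ltW g2))// mulrC ler_wpM2l ?nm_ge0//.
    by rewrite lerDl.
  rewrite ler_pM2l ?divr_gt0// expr2 ler_pM// ltW//.
move=> e e0; pose eta := e / (clen G + 1).
have L0 : 0 < clen G + 1 by rewrite ltr_wpDl ?clen_ge0.
have eta0 : 0 < eta by rewrite divr_gt0.
suff [s sG sP] : exists2 s : seq (C * C), (forall y, y \in s -> supp G y.2) &
    forall z, K z -> nm (Iint G (fun w => g w * (w - z)^-1) -
      \sum_(y <- s) y.1 * (y.2 - z)^-1) <= eta * clen G.
  exists s => // z /sP h; rewrite (le_trans h)// /eta mulrAC ler_pdivrMr//.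
  by rewrite ler_pM2l// lerDl.
set SG := supp G; rewrite /Iint /clen.
have : forall x, x \in G -> x \in G by [].
elim: {-2}G => [_|x H IH HG].
  by exists [::] => // z _; rewrite !big_nil subrr nm0 mulr0.
have [|s sG sP] := IH; first by move=> y yH; apply: HG; rewrite inE yH orbT.
have [s' s'G s'P] := key x eta (HG _ (mem_head _ _)) eta0.
exists ([seq (x.1 * y.1, y.2) | y <- s'] ++ s).
  by move=> y; rewrite mem_cat => /orP[/mapP[v /s'G ? ->]//|/sG].
move=> z Kz; rewrite !big_cons big_cat big_map /=.
rewrite (_ : \sum_(i <- s') _ = x.1 * \sum_(i <- s') i.1 * (i.2 - z)^-1); last first.
  by rewrite mulr_sumr; apply: eq_bigr => i _; rewrite mulrA.
rewrite opprD addrACA -mulrBr (le_trans (nmD _ _))// [leRHS]mulrDr lerD ?sP//.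
by rewrite nmM [leRHS]mulrCA ler_wpM2l ?nm_ge0// s'P.
Qed.

End KernelApproximation.

(** * Runge approximation *)

Section LogEq.
Context {R : realType}.
Local Notation C := (plane R).
Implicit Types (z w p : C) (K L X Y U V : set C) (f g : C -> C) (q : option C).

Lemma logeq_refl X q : logeq X q q.
Proof.
exists setT, (fun=> 0); split => //; first exact: openT.
by move=> z _; rewrite subrr; exact: hasd_cst.
Qed.

Lemma logeq_sym X q q' : logeq X q q' -> logeq X q' q.
Proof.
move=> [V [u [oV XV du]]]; exists V, (fun z => - u z); split => // z Vz.
by rewrite -opprB; apply: hasdN; exact: du.
Qed.

Lemma logeq_trans X q q' q'' : logeq X q q' -> logeq X q' q'' -> logeq X q q''.
Proof.
move=> [V [u [oV XV du]]] [V' [u' [oV' XV' du']]].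
exists (V `&` V'), (fun z => u z + u' z); split; first exact: openI.
  by move=> z Xz; split; [exact: XV|exact: XV'].
move=> z [Vz V'z]; rewrite -(subrK (ck q' z) (ck q z)) -addrA.
by apply: hasdD; [exact: du|exact: du'].
Qed.

Lemma logeq_sub X Y q q' : X `<=` Y -> logeq Y q q' -> logeq X q q'.
Proof.
move=> XY [V [u [oV YV du]]]; exists V, u; split => //.
exact: subset_trans YV.
Qed.

(** A branch of log (1 - t), on the disc supplied by [ball_primitive]. It is used as log (1 - (p -
    p0) / (z - p0)) in [logeq_near] and as log (1 - z / p) in [logeq_far], whence their factors
    3. *)
Let log1 : exists l : C -> C, forall t, nm t < 1 / 3 -> hasd l t (- (1 - t)^-1).
Proof.
pose f (t : C) := - (1 - t)^-1.
have hf : holo (oball 0 1) f.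
  move=> t; rewrite /oball /= subr0 => t1; eexists; apply: hasdN.
  apply: (hasdV (f := fun t => 1 - t)); last exact: hasdB (hasd_cst 1 t) (hasd_id t).
  by rewrite subr_eq0; apply: contraTneq t1 => <-; rewrite nm1 ltxx.
have [||l dl] := @ball_primitive R f 0 1 ltr01.
- by move=> t; exact: holo_ccont.
- by move=> a b c d ab cd rU; apply: goursat => //; exact: holo_sub hf.
by exists l => t t3; apply: dl; rewrite /oball /= subr0.
Qed.

Lemma logeq_near X p p0 : (forall z, X z -> nm (p - p0) < nm (z - p0) / 3) ->
  logeq X (Some p) (Some p0).
Proof.
move=> h; have [l dl] := log1.
exists [set z | nm (p - p0) < nm (z - p0) / 3], (fun z => l ((p - p0) / (z - p0))).
split => //.
  apply/open_planeP => z /= hz; exists (nm (z - p0) - 3 * nm (p - p0)).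
    by lra.
  move=> w wz; have := nm_triangle w z p0; rewrite (nmB z w); lra.
move=> z /= hz; have z0 : z - p0 != 0 by rewrite -nm_gt0; have := nm_ge0 (p - p0); lra.
have z1 : z - p != 0.
  rewrite -nm_gt0; have := nm_triangle p z p0; have := nm_ge0 (p - p0).
  by move: z0; rewrite -nm_gt0; lra.
have d1 : hasd (fun z => (p - p0) / (z - p0)) z ((p - p0) * (- (1 - 0) / (z - p0) ^+ 2)).
  apply: hasdMl; apply: (hasdV (f := fun z => z - p0) z0).
  exact: hasdB (hasd_id z) (hasd_cst p0 z).
apply: hasd_eq; first apply: (hasd_comp d1 (dl _ _)).
  rewrite nmM nmV ltr_pdivrMr ?nm_gt0//; lra.
have -> : 1 - (p - p0) / (z - p0) = (z - p) / (z - p0) by field.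
by rewrite /ck invf_div; field; rewrite z0 z1.
Qed.

Lemma logeq_far X p : (forall z, X z -> nm z < nm p / 3) -> 0 < nm p ->
  logeq X (Some p) None.
Proof.
move=> h p0; have [l dl] := log1; have p1 : p != 0 by rewrite -nm_gt0.
exists [set z | nm z < nm p / 3], (fun z => l (p^-1 * z)); split => //.
  apply/open_planeP => z /= hz; exists (nm p / 3 - nm z); first by rewrite subr_gt0.
  by move=> w wz; have := nmD (w - z) z; rewrite subrK; lra.
move=> z /= hz.
have z1 : z - p != 0.
  by rewrite subr_eq0; apply: contraTneq hz => ->; lra.
apply: hasd_eq; first apply: (hasd_comp (hasdMl p^-1 (hasd_id z)) (dl _ _)).
  by rewrite nmM nmV mulrC ltr_pdivrMr//; lra.
rewrite /ck; field; rewrite z1 p1 /=.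
by rewrite -opprB oppr_eq0 z1.
Qed.

Lemma logeq_open X p0 : compact X -> ~ X p0 -> exists2 r : R, 0 < r &
  forall p, nm (p - p0) < r -> logeq X (Some p) (Some p0).
Proof.
move=> cX nX; have [e e0 he] := compact_dist cX nX.
exists (e / 3); first by rewrite divr_gt0.
by move=> p pe; apply: logeq_near => z /he; lra.
Qed.

Lemma logeq_infty X : compact X -> exists2 r : R, 0 <= r &
  forall p, r < nm p -> logeq X (Some p) None.
Proof.
move=> cX; have [M M0 hM] := compact_bounded_plane cX.
exists (3 * M); first by rewrite mulr_ge0.
by move=> p pM; apply: logeq_far => [z /hM|]; lra.
Qed.

(** Disjoint compact sets have disjoint neighbourhoods, on which logarithms can be chosen
    independently. *)
Lemma logeqU X Y q q' : compact X -> compact Y -> (forall z, X z -> ~ Y z) ->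
  logeq X q q' -> logeq Y q q' -> logeq (X `|` Y) q q'.
Proof.
move=> cX cY XY [V [u [oV XV du]]] [V' [u' [oV' YV' du']]].
have [d d0 hd] := compact_open_nbhd cX (closed_openC (compact_closed_plane cY)) XY.
pose N (A : set C) := [set z | exists2 x, A x & nm (z - x) < d / 2].
have d20 : 0 < d / 2 by rewrite divr_gt0.
have oN A : open (N A).
  apply/open_planeP => z [x Ax zx]; exists (d / 2 - nm (z - x)); first by rewrite subr_gt0.
  by move=> w wz; exists x => //; have := nm_triangle z w x; lra.
have NN z : N X z -> ~ N Y z.
  move=> [x Xx zx] [y Yy zy]; have := hd x y Xx; rewrite /setC /=; apply => //.
  by have := nm_triangle z y x; rewrite (nmB y z); lra.
have selfN A z : A z -> N A z by move=> Az; exists z => //; rewrite subrr nm0.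
pose g z := if `[< N X z >] then u z else u' z.
exists ((V `&` N X) `|` (V' `&` N Y)), g; split.
- by apply: openU; apply: openI.
- move=> z [Xz|Yz]; [left|right]; split; by [exact: XV|exact: YV'|exact: selfN].
- move=> z [[Vz Nz]|[Vz Nz]].
    apply: (hasd_near (du _ Vz)); have /open_planeP/(_ _ Nz)[r r0 hr] := oN X.
    by exists r => // w /hr Nw; rewrite /g; case: asboolP.
  apply: (hasd_near (du' _ Vz)); have /open_planeP/(_ _ Nz)[r r0 hr] := oN Y.
  by exists r => // w /hr Nw; rewrite /g; case: asboolP => // /NN.
Qed.

Lemma open_logeq X q : compact X -> open [set z | ~ X z /\ logeq X (Some z) q].
Proof.
move=> cX; apply/open_planeP => z [nXz zq].
have [r r0 hr] := logeq_open cX nXz; have [d d0 hd] := compact_dist cX nXz.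
exists (Num.min r d); first by rewrite lt_min r0.
move=> w; rewrite lt_min => /andP[wr wd]; split; last exact: logeq_trans (hr _ wr) zq.
by move=> /hd; rewrite leNgt wd.
Qed.

Lemma open_nlogeq X q : compact X -> open [set z | ~ X z /\ ~ logeq X (Some z) q].
Proof.
move=> cX; apply/open_planeP => z [nXz zq].
have [r r0 hr] := logeq_open cX nXz; have [d d0 hd] := compact_dist cX nXz.
exists (Num.min r d); first by rewrite lt_min r0.
move=> w; rewrite lt_min => /andP[wr wd]; split.
  by move=> /hd; rewrite leNgt wd.
by move=> wq; apply: zq; apply: logeq_trans wq; exact: logeq_sym (hr _ wr).
Qed.

Lemma connected_logeq K L x y : connected K -> compact L -> (forall z, K z -> ~ L z) ->
  K x -> K y -> logeq L (Some x) (Some y).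
Proof.
move=> coK cL KL Kx Ky; pose B := [set z | K z /\ logeq L (Some z) (Some y)].
have : B = K; last by move=> /seteqP[_ /(_ x Kx)[]].
apply: coK.
- by exists y; split => //; exact: logeq_refl.
- exists [set z | ~ L z /\ logeq L (Some z) (Some y)]; first exact: open_logeq.
  apply/seteqP; split => z; first by move=> [Kz zy]; split => //; split => //; exact: KL.
  by move=> [Kz [_ zy]].
- exists (~` [set z | ~ L z /\ ~ logeq L (Some z) (Some y)]).
    by apply: open_closedC; exact: open_nlogeq.
  apply/seteqP; split => z; first by move=> [Kz zy]; split => // -[_].
  move=> [Kz nz]; split => //; apply: contrapT => h; apply: nz; split => //.
  exact: KL.
Qed.

Lemma closure_sub_closed (A B : set C) : closed B -> A `<=` B -> closure A `<=` B.
Proof. by move=> cB AB; rewrite closureE => z; apply. Qed.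

Lemma star_connected (A : set C) z : A z ->
  (forall w (t : R), A w -> 0 <= t <= 1 -> A (z + rc t * (w - z))) -> connected A.
Proof.
move=> Az st; pose seg w := (fun t : R => z + rc t * (w - z)) @` `[0, 1].
have segE w : A w -> seg w `<=` A.
  by move=> Aw _ [t + <-]; rewrite /= in_itv /= => /st; apply.
have -> : A = \bigcup_(w in A) seg w.
  apply/seteqP; split => w; last by move=> [v Av] /segE; apply.
  move=> Aw; exists w => //; exists 1; first by rewrite /= in_itv /= ler01 lexx.
  by rewrite rc1 mul1r addrC subrK.
apply: bigcup_connected => [|w Aw].
  by exists z => w _; exists 0; [rewrite /= in_itv /= ler01 lexx|rewrite rc0 mul0r addr0].
apply: connected_continuous_connected; first exact: segment_connected.
apply: continuous_subspaceT => t B /nbhs_planeP[e e0 eB].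
have k0 : 0 < nm (w - z) + 1 by rewrite ltr_wpDl ?nm_ge0.
apply/nbhs_ballP; exists (e / (nm (w - z) + 1)); first by rewrite /= divr_gt0.
move=> s; rewrite /ball /= ltr_pdivlMr// distrC => st'; apply: eB.
rewrite (_ : _ - _ = rc (s - t) * (w - z)); last by rewrite rcB; ring.
by rewrite nmM nm_rc (le_lt_trans _ st')// ler_wpM2l// lerDl.
Qed.

Lemma cball_connected z (r : R) : 0 <= r -> connected (cball z r).
Proof.
move=> r0; apply: (@star_connected _ z); rewrite /cball /=; first by rewrite subrr nm0.
move=> w t wz /andP[t0 t1]; rewrite addrC addKr nmM nm_rc ger0_norm//.
by rewrite (le_trans _ wz)// ler_piMl ?nm_ge0.
Qed.

Lemma plane_clopen (A : set C) : open A -> closed A -> A !=set0 -> A = setT.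
Proof.
move=> oA clA A0; have : connected [set: C] by apply: (@star_connected _ 0).
by apply => //; exists A => //; rewrite setTI.
Qed.

Lemma plane_unbounded (M : R) : exists z : C, M < nm z.
Proof.
exists (rc (`|M| + 1)); rewrite nm_rc ger0_norm ?addr_ge0//.
by rewrite (le_lt_trans (ler_norm M))// ltrDl.
Qed.

(** The two sets cannot each screen [p] from the other. If [K] does, the class of [p] off [K] misses
    [L]; a boundary point of its intersection with the class of [p] off [L] lies in [K] and, being
    off [L], is equivalent to [p] there. *)
Lemma logeq_or K L p x y : compact K -> compact L -> connected K -> connected L ->
  (forall z, K z -> ~ L z) -> ~ K p -> ~ L p -> K x -> L y ->
  logeq K (Some p) (Some y) \/ logeq L (Some p) (Some x).
Proof.
move=> cK cL coK coL KL nKp nLp Kx Ly.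
have LK z : L z -> ~ K z by move=> Lz /KL.
have [h|nh] := pselect (logeq K (Some p) (Some y)); [by left|right].
pose A1 := [set z | ~ K z /\ logeq K (Some z) (Some p)].
pose A2 := [set z | ~ L z /\ logeq L (Some z) (Some p)].
have oA1 : open A1 by exact: open_logeq.
have oA2 : open A2 by exact: open_logeq.
have nLA z : A1 z -> ~ L z.
  move=> [_ zp] Lz; apply: nh; apply: logeq_trans (logeq_sym zp) _.
  exact: (connected_logeq coL cK LK).
have Ap : (A1 `&` A2) p by split; split => //; exact: logeq_refl.
(* the boundary of [A1 `&` A2] is contained in [K] *)
have [z [cz nz]] : exists z, closure (A1 `&` A2) z /\ ~ (A1 `&` A2) z.
  apply: contrapT => h; have clA : closed (A1 `&` A2).
    by move=> z cz; apply: contrapT => nz; apply: h; exists z.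
  have AT := plane_clopen (openI oA1 oA2) clA (ex_intro _ p Ap).
  have : (A1 `&` A2) x by rewrite AT.
  by move=> [[]].
have meet (O : set C) : open O -> O z -> exists w, A1 w /\ A2 w /\ O w.
  move=> oO Oz; have [w [[? ?] ?]] := cz O (open_nbhs_nbhs (conj oO Oz)).
  by exists w.
have Kz : K z.
  apply: contrapT => nKz; have nLz : ~ L z.
    move=> Lz; have [w [[nKw wp] [_ [_ wz]]]] := meet _ (@open_logeq K (Some z) cK)
      (conj nKz (logeq_refl K (Some z))).
    apply: (nLA z) => //; split => //; apply: logeq_trans wp; exact: logeq_sym.
  apply: nz; split; split => //.
    have [w [[_ wp] [_ [_ wz]]]] := meet _ (@open_logeq K (Some z) cK)
      (conj nKz (logeq_refl K (Some z))).
    by apply: logeq_trans wp; exact: logeq_sym.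
  have [w [_ [[_ wp] [_ wz]]]] := meet _ (@open_logeq L (Some z) cL)
    (conj nLz (logeq_refl L (Some z))).
  by apply: logeq_trans wp; exact: logeq_sym.
have nLz := KL _ Kz.
have [w [_ [[_ wp] [_ wz]]]] := meet _ (@open_logeq L (Some z) cL)
  (conj nLz (logeq_refl L (Some z))).
apply: logeq_trans (logeq_sym wp) _; apply: logeq_trans wz _.
exact: (connected_logeq coK cL KL).
Qed.

(** Infinity is replaced by a point so distant that it is equivalent to infinity for both sets. *)
Lemma logeq_or_option K L q x y : compact K -> compact L -> connected K -> connected L ->
  (forall z, K z -> ~ L z) -> (forall p, q = Some p -> ~ K p /\ ~ L p) -> K x -> L y ->
  logeq K q (Some y) \/ logeq L q (Some x).
Proof.
move=> cK cL coK coL KL nq Kx Ly; case: q nq => [p|_] => [/(_ p erefl)[nKp nLp]|].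
  exact: logeq_or.
have cX : compact (K `|` L) by exact: compactU.
have [M _ hM] := logeq_infty cX; have [M' _ hM'] := compact_bounded_plane cX.
have [z] := plane_unbounded (Num.max M M'); rewrite gt_max => /andP[/hM zN zM'].
have nz : ~ (K `|` L) z by move=> /hM'; rewrite leNgt zM'.
have [h|h] := logeq_or cK cL coK coL KL (fun Kz => nz (or_introl Kz))
  (fun Lz => nz (or_intror Lz)) Kx Ly; [left|right]; apply: logeq_trans h; apply: logeq_sym.
  by apply: logeq_sub zN; exact: subsetUl.
by apply: logeq_sub zN; exact: subsetUr.
Qed.

End LogEq.

(** * Holomorphic hulls and Runge's theorem *)

Section Hull.
Context {R : realType}.
Local Notation C := (plane R).
Variable Omega : set C.
Hypothesis oO : open Omega.
Implicit Types (z w p : C) (K L X Y U V : set C) (f g h : C -> C) (q : option C).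

Definition outside q := if q is Some a then ~ Omega a else True.

(** Quantifying over [a] avoids the distance to the complement, which is empty when [Omega] is the
    plane. *)
Definition inner (M d : R) : set C :=
  [set z | nm z <= M /\ forall a, ~ Omega a -> d <= nm (a - z)].

Lemma inner_compact M d : compact (inner M d).
Proof.
apply: (@bounded_closed_compact_plane _ _ M) => [|z []//].
apply/closed_planeP => z nz; have [h|h] := ltP M (nm z).
  exists (nm z - M); first by rewrite subr_gt0.
  by move=> w wz [wM _]; have := nm_subl z w; rewrite nmB; lra.
have [a [na az]] : exists a : C, ~ Omega a /\ nm (a - z) < d.
  apply: contrapT => na; apply: nz; split => // a nOa; rewrite leNgt; apply/negP => az.
  by apply: na; exists a.
exists (d - nm (a - z)); first by rewrite subr_gt0.
by move=> w wz [_ /(_ _ na)]; have := nm_triangle z a w; rewrite (nmB z w); lra.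
Qed.

Lemma inner_sub M d : 0 < d -> inner M d `<=` Omega.
Proof. by move=> d0 z [_ h]; apply: contrapT => /h; rewrite subrr nm0 leNgt d0. Qed.

Definition approx K f := forall e : R, 0 < e ->
  exists2 g, holo Omega g & forall z, K z -> nm (f z - g z) <= e.

Lemma approx_holo K f : holo Omega f -> approx K f.
Proof. by move=> hf e e0; exists f => // z _; rewrite subrr nm0 ltW. Qed.

Lemma approxD K f g : approx K f -> approx K g -> approx K (fun z => f z + g z).
Proof.
move=> af ag e e0; have e20 : 0 < e / 2 by rewrite divr_gt0.
have [f' hf' ff'] := af _ e20; have [g' hg' gg'] := ag _ e20.
exists (fun z => f' z + g' z); first exact: holoD.
move=> z Kz; rewrite opprD addrACA (le_trans (nmD _ _))// [e]splitr.
by rewrite lerD ?ff' ?gg'.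
Qed.

Lemma approxMl K f c : approx K f -> approx K (fun z => c * f z).
Proof.
move=> af e e0; have k0 : 0 < nm c + 1 by rewrite ltr_wpDl ?nm_ge0.
have [f' hf' ff'] := af (e / (nm c + 1)) ltac:(by rewrite divr_gt0).
exists (fun z => c * f' z); first by apply: holoM => //; exact: holo_cst.
move=> z Kz; rewrite -mulrBr nmM (le_trans (ler_wpM2l (nm_ge0 _) (ff' _ Kz)))//.
by rewrite mulrA ler_pdivrMr// mulrC ler_pM2l// lerDl.
Qed.

Lemma approx_sum K (I : eqType) (s : seq I) (F : I -> C -> C) :
  (forall i, i \in s -> approx K (F i)) -> approx K (fun z => \sum_(i <- s) F i z).
Proof.
elim: s => [|i s IH] h.
  rewrite (_ : (fun _ => _) = fun=> 0); first exact/approx_holo/holo_cst.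
  by apply/funext => z; rewrite big_nil.
rewrite (_ : (fun _ => _) = fun z => F i z + \sum_(j <- s) F j z).
  apply: approxD; first by apply: h; rewrite mem_head.
  by apply: IH => j js; apply: h; rewrite inE js orbT.
by apply/funext => z; rewrite big_cons.
Qed.

(* [removable_pole K p]: the function 1 / (z - p) is a limit, uniformly on [K],
   of functions holomorphic on [Omega]. *)
Definition removable_pole K p :=
  exists2 h, holo Omega h & forall z, K z -> nm (1 - (z - p) * h z) <= 1 / 2.

Lemma removable_pole_notin K p : removable_pole K p -> ~ K p.
Proof. by move=> [h _ hK] /hK; rewrite subrr mul0r subr0 nm1; lra. Qed.

Lemma removable_pole_out K p : ~ Omega p -> K `<=` Omega -> removable_pole K p.
Proof.
move=> np KO; exists (fun z => (z - p)^-1); first exact: holo_inv_sub.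
move=> z /KO Oz; rewrite divff ?subrr ?nm0//.
by rewrite subr_eq0; apply: contra_not_neq np => <-.
Qed.

Lemma removable_pole_far K p : 0 < nm p -> (forall z, K z -> nm z <= nm p / 2) ->
  removable_pole K p.
Proof.
move=> p0 hK; have p1 : p != 0 by rewrite -nm_gt0.
exists (fun=> - p^-1); first exact: holo_cst.
move=> z /hK zp; rewrite (_ : _ - _ = z / p); last by field.
by rewrite nmM nmV ler_pdivrMr//; lra.
Qed.

(** With [t z = 1 - (z - p) * h z], multiplying [h] by a partial geometric sum of [t] turns the
    error [t] into [t ^+ n]. *)
Lemma removable_pole_improve K p (e : R) : removable_pole K p -> 0 < e ->
  exists2 h, holo Omega h & forall z, K z -> nm (1 - (z - p) * h z) <= e.
Proof.
move=> [h hh hK] e0; have [n ne] := @exp2_small R 1 e e0.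
pose t z := 1 - (z - p) * h z.
exists (fun z => h z * \sum_(k <- iota 0 n) t z ^+ k).
  apply: holoM => //; apply: holo_sum => k; apply: holoX; apply: holoB.
    exact: holo_cst.
  by apply: holoM => //; apply: holoB; [exact: holo_id|exact: holo_cst].
move=> z Kz; have -> : 1 - (z - p) * (h z * \sum_(k <- iota 0 n) t z ^+ k) = t z ^+ n.
  rewrite mulrA (_ : (z - p) * h z = 1 - t z); last by rewrite /t; ring.
  elim: n {ne} => [|n IH]; first by rewrite big_nil mulr0 subr0 expr0.
  rewrite -addn1 iotaD big_cat /= big_seq1 mulrDr opprD addrA IH add0n addn1 exprS; ring.
rewrite nmX (le_trans _ (ltW ne))// div1r -exprVn lerXn2r ?nnegrE ?nm_ge0//.
by have := hK _ Kz; rewrite div1r.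
Qed.

Lemma removable_pole_kernel K p : compact K -> removable_pole K p ->
  approx K (fun z => (z - p)^-1).
Proof.
move=> cK gp e e0; have np := removable_pole_notin gp.
have [d d0 hd] := compact_dist cK np.
have [h hh hK] := removable_pole_improve gp (mulr_gt0 e0 d0).
exists h => // z Kz; have zp := hd _ Kz.
have z0 : z - p != 0 by rewrite -nm_gt0 (lt_le_trans d0).
rewrite (_ : _ - _ = (1 - (z - p) * h z) / (z - p)); last by field.
rewrite nmM nmV ler_pdivrMr ?nm_gt0// (le_trans (hK _ Kz))//.
by rewrite ler_pM2l.
Qed.

Lemma removable_pole_near K p p' : removable_pole K p ->
  (forall z, K z -> nm (p' - p) <= nm (z - p) / 4) -> removable_pole K p'.
Proof.
(* The fractions satisfy 1/4 + (1 + 1/4) / 5 = 1/2. *)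
move=> gp hK; have [h hh hp] := removable_pole_improve gp (ltac:(lra) : (0 : R) < 1 / 5).
exists h => // z Kz; have z0 : z - p != 0.
  by rewrite subr_eq0; apply/eqP => zp; apply: (removable_pole_notin gp); rewrite -zp.
have n0 : 0 < nm (z - p) by rewrite nm_gt0.
pose v := (p' - p) / (z - p).
have v4 : nm v <= 1 / 4 by rewrite nmM nmV ler_pdivrMr//; have := hK _ Kz; lra.
rewrite (_ : _ - _ = v + (1 - v) * (1 - (z - p) * h z)); last by rewrite /v; field.
rewrite (le_trans (nmD _ _))// [nm ((1 - v) * _)]nmM.
have := nmD 1 (- v); rewrite nmN nm1 => h1.
have := ler_pM (nm_ge0 _) (nm_ge0 _) h1 (hp _ Kz).
by have := nm_ge0 v; lra.
Qed.

(** The holomorphically convex hull (see [hol_hullE]) in terms of poles; its topology is obtained by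
    moving poles. *)
Definition hull K : set C := [set p | ~ removable_pole K p].

Lemma sub_hull K : K `<=` hull K.
Proof. by move=> z Kz /removable_pole_notin. Qed.

Lemma hull_sub K : K `<=` Omega -> hull K `<=` Omega.
Proof. by move=> KO z nz; apply: contrapT => /removable_pole_out /(_ KO). Qed.

Lemma open_removable_pole K : compact K -> open [set p | removable_pole K p].
Proof.
move=> cK; apply/open_planeP => p gp.
have [d d0 hd] := compact_dist cK (removable_pole_notin gp).
exists (d / 4); first by rewrite divr_gt0.
move=> w wp; apply: (removable_pole_near gp) => z /hd; lra.
Qed.

Lemma hull_compact K : compact K -> compact (hull K).
Proof.
move=> cK; have [M M0 hM] := compact_bounded_plane cK.
apply: (@bounded_closed_compact_plane _ _ (2 * M)).
  have -> : hull K = ~` [set p | removable_pole K p] by [].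
  by apply: open_closedC; exact: open_removable_pole.
move=> z nz; rewrite leNgt; apply/negP => zM; apply: nz.
by apply: removable_pole_far => [|w /hM]; lra.
Qed.

(** Moving a pole slightly is reversible off [K], so there the poles that cannot be removed form an
    open set. With [d / 5], points of [K] are at distance at least [4 * d / 5] from [w], as
    [removable_pole_near] requires. *)
Lemma open_hullD K : compact K -> open (hull K `\` K).
Proof.
move=> cK; apply/open_planeP => p [np nKp].
have [d d0 hd] := compact_dist cK nKp.
exists (d / 5); first by rewrite divr_gt0.
move=> w wp; split; last by move=> /hd; rewrite leNgt => /negP; apply; lra.
move=> gw; apply: np; apply: (removable_pole_near gw) => z /hd zp.
have := nm_triangle w z p; rewrite (nmB p w); lra.
Qed.

Lemma closure_hullD K : compact K -> closure (hull K `\` K) `<=` (hull K `\` K) `|` K.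
Proof.
move=> cK; have cl : closed (hull K) := compact_closed_plane (hull_compact cK).
move=> z /(closure_sub_closed cl (@subDsetl _ _ _)) hz.
by have [Kz|nKz] := pselect (K z); [right|left].
Qed.

Lemma hullD_bounded K : compact K -> exists M, forall z, (hull K `\` K) z -> nm z <= M.
Proof.
by move=> /hull_compact/compact_bounded_plane[M _ hM]; exists M => z [/hM].
Qed.

Lemma hull_max K f (M : R) : compact K -> K `<=` Omega -> holo Omega f ->
  (forall z, K z -> nm (f z) <= M) -> forall z, hull K z -> nm (f z) <= M.
Proof.
move=> cK KO hf fM z hz; have [/fM//|nKz] := pselect (K z).
have hO := hull_sub KO.
apply: (max_principle (open_hullD cK) (hullD_bounded cK) (closure_hullD cK)) => //.
- by move=> w [[/hO Ow _]|/KO Ow]; exact: holo_ccont hf Ow.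
- by apply: holo_sub hf => w [/hO].
Qed.

Definition peaks K := forall p, Omega p -> ~ K p -> exists f (M : R),
  [/\ holo Omega f, forall z, K z -> nm (f z) <= M & M < nm (f p)].

Lemma hull_peaks K : compact K -> K `<=` Omega -> peaks (hull K).
Proof.
move=> cK KO p _ /contrapT[h hh hK].
have hF : holo Omega (fun z => 1 - (z - p) * h z).
  apply: holoB; first exact: holo_cst.
  by apply: holoM => //; apply: holoB; [exact: holo_id|exact: holo_cst].
exists (fun z => 1 - (z - p) * h z), (1 / 2); split => //.
  exact: hull_max hF hK.
by rewrite subrr mul0r subr0 nm1; lra.
Qed.

(** A clopen part of the hull missing [K] would be open and closed in the plane and bounded, hence
    empty. *)
Lemma hull_connected K : compact K -> connected K -> connected (hull K).
Proof.
move=> cK coK; have clH : closed (hull K) := compact_closed_plane (hull_compact cK).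
have key (B O : set C) : open O -> closed B -> B = hull K `&` O ->
    (forall z, B z -> ~ K z) -> B = set0.
  move=> oO' clB BE BK; apply: contrapT => /eqP/set0P B0.
  have BE' : B = (hull K `\` K) `&` O.
    apply/seteqP; split => z.
      by move=> Bz; have := Bz; rewrite BE => -[? ?]; split => //; split => //; exact: BK.
    by rewrite BE => -[[? _] ?].
  have oB : open B by rewrite BE'; apply: openI => //; exact: open_hullD.
  have [M hM] := hullD_bounded cK; have [z zM] := plane_unbounded M.
  have : B z by rewrite (plane_clopen oB clB B0).
  by rewrite BE' => -[/hM]; rewrite leNgt zM.
move=> B [b Bb] [ O oO' BE] [F clF BE'].
have clB : closed B by rewrite BE'; exact: closedI.
have BH : B `<=` hull K by rewrite BE => z [].
pose B' := hull K `&` ~` B.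
have B'E : B' = hull K `&` ~` F.
  apply/seteqP; split => z; rewrite /B' BE'.
    by move=> [hz nz]; split => // Fz; apply: nz.
  by move=> [hz nz]; split => // -[_].
have clB' : closed B'.
  rewrite (_ : B' = hull K `&` ~` O); first by apply: closedI => //; exact: open_closedC.
  apply/seteqP; split => z; rewrite /B' BE.
    by move=> [hz nz]; split => // Oz; apply: nz.
  by move=> [hz nz]; split => // -[_].
have [[x [Kx Bx]]|nB] := pselect (exists x, K x /\ B x); last first.
  have := key B O oO' clB BE (fun z Bz Kz => nB (ex_intro _ z (conj Kz Bz))).
  by move=> B0; rewrite B0 in Bb.
have KB : K `<=` B.
  have KE : K `&` B = K.
    apply: coK; first by exists x.
    - exists O => //; rewrite BE; apply/seteqP; split => z.
        by move=> [? [? ?]].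
      by move=> [Kz ?]; split => //; split => //; exact: sub_hull.
    - by exists B.
  by rewrite -{1}KE; exact: subIsetr.
have B'0 : B' = set0.
  apply: (key B' (~` F)) => //; first exact: closed_openC.
  by move=> z [_ nBz] /KB.
apply/seteqP; split => // z hz; apply: contrapT => nBz.
have : B' z by split.
by rewrite B'0.
Qed.

(** In terms of logarithms: every component of the complement of [K] reaches infinity or a point off
    [Omega]. *)
Definition separating K := forall p, ~ K p -> exists2 q, outside q & logeq K (Some p) q.

(** Otherwise the class of [p] off [K] is a bounded open subset of [Omega] with boundary in [K], and
    the maximum principle contradicts the peak at [p]. *)
Lemma peaks_separating K : compact K -> K `<=` Omega -> peaks K -> separating K.
Proof.
move=> cK KO pK p nKp; have [Op|nOp] := pselect (Omega p); last first.
  by exists (Some p) => //; exact: logeq_refl.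
apply: contrapT => nq.
pose B := [set b | ~ K b /\ logeq K (Some b) (Some p)].
have BO : B `<=` Omega.
  move=> b [_ bp]; apply: contrapT => nOb; apply: nq; exists (Some b) => //.
  exact: logeq_sym.
have oB : open B by exact: open_logeq.
have bB : exists M, forall z, B z -> nm z <= M.
  have [M M0 hM] := logeq_infty cK; exists M => b [_ bp].
  rewrite leNgt; apply/negP => /hM h; apply: nq; exists None => //.
  exact: logeq_trans (logeq_sym bp) h.
have cB : closure B `<=` B `|` K.
  move=> z cz; have [Kz|nKz] := pselect (K z); [by right|left; split => //].
  have oz : nbhs z [set b | ~ K b /\ logeq K (Some b) (Some z)].
    apply: open_nbhs_nbhs; split; first exact: open_logeq.
    by split => //; exact: logeq_refl.
  have [w [[_ wp] [_ wz]]] := cz _ oz.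
  exact: logeq_trans (logeq_sym wz) wp.
have [f [M [hf fM Mp]]] := pK _ Op nKp.
have := max_principle oB bB cB (f := f) (M := M) _ _ fM (z := p).
rewrite leNgt Mp => H; apply/negP; last apply: H => //.
- by [].
- by move=> z [/BO|/KO] Oz; exact: holo_ccont hf Oz.
- exact: holo_sub hf.
- by split => //; exact: logeq_refl.
Qed.

Lemma hull_no_logeq X p q : compact X -> X `<=` Omega -> hull X p -> ~ X p ->
  outside q -> ~ logeq X (Some p) q.
Proof.
move=> cX XO hp nXp oq.
apply: (no_logeq (open_hullD cX) (hullD_bounded cX) (closure_hullD cX)) => // b qb [hb _].
by move: oq; rewrite qb /=; apply; exact: hull_sub hb.
Qed.

(** Cauchy's formula and Riemann sums reduce [f] to finite sums of kernels with poles off [X], each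
    of which is a limit. *)
Lemma runge X U f : compact X -> (forall p, ~ X p -> removable_pole X p) ->
  open U -> X `<=` U -> holo U f -> approx X f.
Proof.
move=> cX rX oU XU hf e e0.
have [G [wG sG eG G0 Gf]] := cauchy_contour_exists oU cX XU.
have cf w : supp G w -> ccont f w by move=> /sG[Uw _]; exact: holo_ccont hf Uw.
have tpi0 : 0 < nm (tpi : C) by rewrite nm_gt0 tpi_neq0.
have e20 : 0 < e / 2 by rewrite divr_gt0.
have [s sS sP] := kernel_approx wG cf cX (fun w sw => proj2 (sG w sw)) (mulr_gt0 e20 tpi0).
have aS : approx X (fun z => tpi^-1 * \sum_(x <- s) x.1 * (x.2 - z)^-1).
  apply: approxMl; apply: approx_sum => x xs.
  rewrite (_ : (fun _ => _) = fun z => - x.1 * (z - x.2)^-1); last first.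
    by apply/funext => z; rewrite -[x.2 - z]opprB invrN mulrN mulNr.
  apply: approxMl; apply: removable_pole_kernel => //; apply: rX.
  by have [] := sG _ (sS _ xs).
have [g hg ag] := aS _ e20; exists g => // z Xz.
rewrite (le_trans (nm_triangle (tpi^-1 * \sum_(x <- s) x.1 * (x.2 - z)^-1) _ _))//.
rewrite [e]splitr lerD ?ag// -[f z](mulKf (@tpi_neq0 R)) -(Gf _ _ hf Xz) -mulrBr.
rewrite nmM nmV mulrC ler_pdivrMr//.
exact: sP.
Qed.

End Hull.

(** * Transitivity of the composition operators *)

Section Nice.
Context {R : realType}.
Local Notation C := (plane R).
Variable Omega : set C.
Hypotheses (oO : open Omega) (coO : connected Omega).
Implicit Types (z w p : C) (K L X Y U V : set C) (f g h u : C -> C) (q : option C).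
Local Notation removable_pole := (removable_pole Omega).
Local Notation outside := (outside Omega).
Local Notation hull := (hull Omega).

Lemma connected_join x y : Omega x -> Omega y ->
  exists J, [/\ compact J, connected J, J `<=` Omega, J x & J y].
Proof.
move=> Ox Oy; pose A := [set y | exists J, [/\ compact J, connected J, J `<=` Omega, J x & J y]].
have AO : A `<=` Omega by move=> z [J [_ _ JO _ /JO]].
have step z w (r : R) : 0 <= r -> cball z r `<=` Omega -> A z -> nm (w - z) <= r -> A w.
  move=> r0 rO [J [cJ coJ JO Jx Jz]] wr; exists (J `|` cball z r); split.
  - by apply: compactU => //; exact: cball_compact.
  - apply: connectedU => //; last exact: cball_connected.
    by exists z; split => //; rewrite /cball /= subrr nm0.
  - by move=> v [/JO|/rO].
  - by left.
  - by right.
suff AE : A = Omega by have : A y by rewrite AE.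
apply: coO.
- exists x; exists [set x]; split => //; last by move=> _ ->.
    exact: compact_set1.
  exact: connected1.
- exists A; last by apply/seteqP; split => z; [move=> Az; split => //; exact: AO|case].
  apply/open_planeP => z Az; have [r r0 rO] := open_cball oO (AO _ Az).
  exists r => // w wr; apply: (step z w r) => //; exact: ltW.
- exists (closure A); first exact: closed_closure.
  apply/seteqP; split => z.
    by move=> Az; split; [exact: AO|exact: subset_closure].
  move=> [Oz cz]; have [r r0 rO] := open_cball oO Oz.
  have r20 : 0 < r / 2 by rewrite divr_gt0.
  have [w [Aw wz]] := cz [set w | nm (w - z) < r / 2]
    ltac:(by apply/nbhs_planeP; exists (r / 2)).
  apply: (step w z (r / 2)) => //; first exact: ltW; last by rewrite nmB; exact: ltW.
  move=> v; rewrite /cball /= => vw; apply: rO; rewrite /cball /=.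
  by have := nm_triangle w v z; move: wz => /=; lra.
Qed.

Lemma connected_enlarge K : K `<=` Omega -> compact K -> K !=set0 ->
  exists J, [/\ compact J, connected J, J `<=` Omega & K `<=` J].
Proof.
move=> KO cK [x Kx].
have rP z : exists r : R, Omega z -> 0 < r /\ cball z r `<=` Omega.
  have [Oz|?] := pselect (Omega z); last by exists 0.
  by have [r r0 rO] := open_cball oO Oz; exists r.
pose r z := projT1 (cid (rP z)).
have rE z : Omega z -> 0 < r z /\ cball z (r z) `<=` Omega := projT2 (cid (rP z)).
have [s sK Ks] := compact_ball_cover cK (fun z Kz => proj1 (rE z (KO z Kz))).
suff [J [cJ coJ JO Jx Js]] : exists J, [/\ compact J, connected J, J `<=` Omega, J x &
    forall z, z \in s -> cball z (r z) `<=` J].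
  by exists J; split => // z /Ks[w /Js ws zw]; apply: ws; exact: ltW.
elim: s sK {Ks} => [|z s IH] sK.
  exists [set x]; split => //; first exact: compact_set1; first exact: connected1.
  by move=> _ ->; exact: KO.
have [|J [cJ coJ JO Jx Js]] := IH; first by move=> w ws; apply: sK; rewrite inE ws orbT.
have Oz : Omega z by apply/KO/sK; rewrite mem_head.
have [r0 rO] := rE _ Oz; have [J' [cJ' coJ' J'O J'x J'z]] := connected_join (KO _ Kx) Oz.
exists (J `|` (J' `|` cball z (r z))); split.
- by apply: compactU => //; apply: compactU => //; exact: cball_compact.
- apply: connectedU => //; first by exists x; split => //; left.
  apply: connectedU => //; last by apply: cball_connected; exact: ltW.
  by exists z; split => //; rewrite /cball /= subrr nm0 ltW.
- by move=> v [/JO|[/J'O|/rO]].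
- by left.
- move=> w; rewrite inE => /orP[/eqP -> v vz|ws v vw]; first by right; right.
  by left; apply: (Js _ ws).
Qed.

Definition nice K := [/\ compact K, connected K, K `<=` Omega, K !=set0 &
  forall p, ~ K p -> removable_pole K p].

Lemma nice_enlarge K : compact K -> K `<=` Omega -> K !=set0 ->
  exists2 J, nice J & K `<=` J.
Proof.
move=> cK KO K0; have [J [cJ coJ JO KJ]] := connected_enlarge KO cK K0.
exists (hull J); last exact: subset_trans KJ (@sub_hull _ _ _).
split; [exact: hull_compact|exact: hull_connected|exact: hull_sub| |].
  by have [x Kx] := K0; exists x; apply: sub_hull; exact: KJ.
move=> p /contrapT[h hh hp]; exists h => //.
apply: (hull_max cJ JO _ hp).
apply: holoB; first exact: holo_cst.
by apply: holoM => //; apply: holoB; [exact: holo_id|exact: holo_cst].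
Qed.

Lemma nice_peaks K : nice K -> peaks Omega K.
Proof.
move=> [cK _ KO _ rK] p Op nKp; rewrite (_ : K = hull K) in nKp *.
  exact: hull_peaks.
apply/seteqP; split; first exact: sub_hull.
by move=> z hz; apply: contrapT => /rK.
Qed.

(* The image of [u] is a Runge domain, expressed on [Omega] itself. *)
Definition runge_map u := forall G K (e : R), holo Omega G -> compact K -> K `<=` Omega ->
  0 < e -> exists2 f, holo Omega f & forall z, K z -> nm (f (u z) - G z) <= e.

Lemma image_compact K u : compact K -> K `<=` Omega -> holo Omega u -> compact (u @` K).
Proof.
move=> cK KO hu; apply: continuous_compact => //.
by apply: continuous_in_subspaceT => z /set_mem Kz; apply/ccontP/(holo_ccont hu)/KO.
Qed.

Lemma image_connected K u : connected K -> K `<=` Omega -> holo Omega u -> connected (u @` K).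
Proof.
move=> cK KO hu; apply: connected_continuous_connected => //.
by apply: continuous_in_subspaceT => z /set_mem Kz; apply/ccontP/(holo_ccont hu)/KO.
Qed.

Section Image.
Variable u : C -> C.
Hypotheses (hu : holo Omega u) (uO : forall z, Omega z -> Omega (u z)) (ru : runge_map u).

(** If [p = u q], a peak at [q] is transported by the Runge condition. If [p] is not a value of [u],
    the condition is applied to [(u z - p)^-1] and makes [p] a removable pole for the image. *)
Lemma peaks_image K : nice K -> peaks Omega (u @` K).
Proof.
move=> nK p Op np; have [cK _ KO _ _] := nK.
have [[q [Oq up]]|nu] := pselect (exists q : C, Omega q /\ u q = p).
  have nKq : ~ K q by move=> Kq; apply: np; exists q.
  have [f [M [hf fM Mq]]] := nice_peaks nK Oq nKq.
  have e0 : 0 < (nm (f q) - M) / 3 by rewrite divr_gt0// subr_gt0.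
  have [f2 hf2 ff2] := ru (K := K `|` [set q]) hf ltac:(by apply: compactU => //; exact: compact_set1)
    ltac:(by move=> z [/KO|->]) e0.
  exists f2, (M + (nm (f q) - M) / 3); split => //.
    move=> _ [z Kz <-]; have := ff2 z (or_introl Kz); have := fM _ Kz.
    have := nmD (f2 (u z) - f z) (f z); rewrite subrK; lra.
  have := ff2 q (or_intror erefl); have := nmD (f q - f2 (u q)) (f2 (u q)).
  by rewrite subrK nmB up; lra.
have hG : holo Omega (fun z => (u z - p)^-1).
  apply: holoV; last by apply: holoB => //; exact: holo_cst.
  by move=> z Oz; rewrite subr_eq0; apply/eqP => uz; apply: nu; exists z.
have [M M0 hM] := @compact_cont_bound R K (fun z => u z - p) cK
  (fun z Kz => ccontB (holo_ccont hu (KO _ Kz)) (ccont_cst p z)).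
have e0 : 0 < 1 / 2 / (M + 1) by rewrite !divr_gt0// ltr_wpDl.
have [f2 hf2 ff2] := ru hG cK KO e0.
exists (fun w => 1 - (w - p) * f2 w), (1 / 2); split.
- apply: holoB; first exact: holo_cst.
  by apply: holoM => //; apply: holoB; [exact: holo_id|exact: holo_cst].
- move=> _ [z Kz <-].
  have z0 : u z - p != 0 by rewrite subr_eq0; apply/eqP => uz; apply: nu; exists z; split => //; exact: KO.
  rewrite (_ : _ - _ = (u z - p) * - (f2 (u z) - (u z - p)^-1)); last by field.
  rewrite nmM nmN (le_trans (ler_pM (nm_ge0 _) (nm_ge0 _) (hM _ Kz) (ff2 _ Kz)))//.
  by rewrite mulrA ler_pdivrMr; lra.
- by rewrite subrr mul0r subr0 nm1; lra.
Qed.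

Lemma separating_image K : nice K -> separating Omega (u @` K).
Proof.
move=> nK; have [cK _ KO _ _] := nK; apply: peaks_separating => //.
- exact: image_compact.
- by move=> _ [z /KO/uO Oz <-].
- exact: peaks_image.
Qed.

End Image.

Lemma nice_separating K : nice K -> separating Omega K.
Proof. by move=> nK; have [cK _ KO _ _] := nK; apply: peaks_separating => //; exact: nice_peaks. Qed.

Section Bad.
Variables (K L : set C) (p : C).
Hypotheses (cK : compact K) (cL : compact L) (KO : K `<=` Omega) (LO : L `<=` Omega)
  (coL : connected L) (sK : separating Omega K)
  (KL : forall z, K z -> ~ L z) (nKp : ~ K p) (nLp : ~ L p)
  (hp : hull (K `|` L) p).

(** Logarithms near [K] and near [L] glue to one near the union, where a bad point admits none. *)
Lemma bad_no_logeq q : outside q -> logeq K (Some p) q -> logeq L (Some p) q -> False.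
Proof.
move=> oq Kq Lq; apply: (@hull_no_logeq R Omega (K `|` L) p q) => //.
- exact: compactU.
- by move=> z [/KO|/LO].
- by case.
- exact: logeqU.
Qed.

(** If [K] screened [p] from [L], the part of the hull of the union lying in the class of [p] off
    [K] would be bounded and open with boundary in [K]; then [p] could not be equivalent to an
    outside point off [K]. *)
Lemma bad_meets y : L y -> logeq K (Some p) (Some y).
Proof.
move=> Ly; apply: contrapT => npy.
have LK z : L z -> ~ K z by move=> Lz /KL.
have nL z : logeq K (Some z) (Some p) -> ~ L z.
  move=> zp Lz; apply: npy; apply: logeq_trans (logeq_sym zp) _.
  exact: (connected_logeq coL cK LK).
have [q oq pq] := sK nKp.
have cX : compact (K `|` L) by exact: compactU.
have XO : K `|` L `<=` Omega by move=> z [/KO|/LO].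
pose B := (hull (K `|` L) `\` (K `|` L)) `&` [set z | ~ K z /\ logeq K (Some z) (Some p)].
have oB : open B by apply: openI; [exact: open_hullD|exact: open_logeq].
have [M hM] := hullD_bounded Omega cX.
apply: (@no_logeq R B K p q oB) pq.
- by exists M => z [/hM].
- move=> z cz; have [Kz|nKz] := pselect (K z); [by right|left].
  have [w [[_ [_ wp]] [_ wz]]] := cz _ (open_nbhs_nbhs (conj (@open_logeq _ K (Some z) cK)
    (conj nKz (logeq_refl K (Some z))))).
  have zp := logeq_trans (logeq_sym wz) wp.
  split; last by split.
  by have [//|[//|/(nL _ zp)]] := closure_hullD cX (closure_subset (@subIsetl _ _ _) cz).
- by split; [split => // -[]|split => //; exact: logeq_refl].
- by move=> b qb [[hb _] _]; move: oq; rewrite qb; apply; exact: hull_sub hb.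
Qed.

End Bad.

Lemma iter_holo u n : holo Omega u -> (forall z, Omega z -> Omega (u z)) ->
  holo Omega (iter n u) /\ forall z, Omega z -> Omega (iter n u z).
Proof.
move=> hu uO; elim: n => [|n [IH IH']]; first by split => //; exact: holo_id.
by split => [|z Oz /=]; [exact: (holo_comp IH' IH hu)|exact/uO/IH'].
Qed.

Lemma iter_runge u n : holo Omega u -> (forall z, Omega z -> Omega (u z)) ->
  runge_map u -> runge_map (iter n u).
Proof.
move=> hu uO ru; elim: n => [|n IH] G K e hG cK KO e0.
  by exists G => // z _; rewrite /= subrr nm0 ltW.
have e20 : 0 < e / 2 by rewrite divr_gt0.
have [hn nO] := iter_holo n hu uO.
have [f hf ff] := IH G K _ hG cK KO e20.
have [f2 hf2 ff2] := ru f (iter n u @` K) _ hf (image_compact cK KO hn)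
  ltac:(by move=> _ [z /KO/nO Oz <-]) e20.
exists f2 => // z Kz; rewrite [e]splitr /=.
have := ff2 _ (ex_intro2 _ _ z Kz erefl); have := ff _ Kz.
by have := nm_triangle (f (iter n u z)) (f2 (u (iter n u z))) (G z); lra.
Qed.

Lemma iter_inj u n : (forall z, Omega z -> Omega (u z)) ->
  (forall x y, Omega x -> Omega y -> u x = u y -> x = y) ->
  forall x y, Omega x -> Omega y -> iter n u x = iter n u y -> x = y.
Proof.
move=> uO iu; elim: n => [//|n IH] x y Ox Oy; rewrite !iterSr => /IH h.
by apply: iu => //; apply: h; exact: uO.
Qed.

Definition transitive_maps (u : nat -> C -> C) := forall f g K (e : R), holo Omega f -> holo Omega g ->
  compact K -> K `<=` Omega -> 0 < e -> exists2 h, holo Omega h & exists l,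
    (forall z, K z -> nm (h z - f z) <= e) /\ forall z, K z -> nm (h (u l z) - g z) <= e.

(** Runge approximation, on the union of [K'] and its image, of the function equal to [f] near [K']
    and to [f2] near the image, where [f2 \o u l] approximates [g]. *)
Lemma transitive_of_removable (u : nat -> C -> C) :
  (forall l, holo Omega (u l)) -> (forall l z, Omega z -> Omega (u l z)) ->
  (forall l, runge_map (u l)) ->
  (forall K, compact K -> K `<=` Omega -> K !=set0 -> exists K' l, [/\ nice K', K `<=` K',
     forall z, K' z -> ~ (u l @` K') z &
     forall p, ~ (K' `|` u l @` K') p -> removable_pole (K' `|` u l @` K') p]) ->
  transitive_maps u.
Proof.
move=> hu uO ru H f g K e hf hg cK KO e0.
have [K0|/set0P/negP/negPn/eqP K0] := pselect (K !=set0); last first.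
  by exists f => //; exists 0; split => z; rewrite K0.
have [K' [l [nK' KK' disj rX]]] := H K cK KO K0.
have [cK' _ K'O _ _] := nK'; have e20 : 0 < e / 2 by rewrite divr_gt0.
have [f2 hf2 ff2] := ru l g K' _ hg cK' K'O e20.
set L := u l @` K' in disj rX *; have cL : compact L by exact: image_compact.
have LO : L `<=` Omega by move=> _ [z /K'O/uO Oz <-].
have [d d0 hd] := compact_open_nbhd cK' (closed_openC (compact_closed_plane cL)) disj.
pose N (A : set C) := [set z | exists2 x, A x & nm (z - x) < d / 2].
have oN A : open (N A).
  apply/open_planeP => z [x Ax zx]; exists (d / 2 - nm (z - x)); first by rewrite subr_gt0.
  by move=> w wz; exists x => //; have := nm_triangle z w x; lra.
have NN z : N K' z -> ~ N L z.
  move=> [x Xx zx] [y Yy zy]; have := hd x y Xx; rewrite /setC /=; apply => //.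
  by have := nm_triangle z y x; rewrite (nmB y z); lra.
have selfN A z : A z -> N A z.
  by move=> Az; exists z => //; rewrite subrr nm0 divr_gt0.
pose F z := if `[< N K' z >] then f z else f2 z.
have F1 z : N K' z -> F z = f z by rewrite /F; case: asboolP.
have F2 z : N L z -> F z = f2 z by move=> Lz; rewrite /F; case: asboolP => // /NN.
have hF : holo ((Omega `&` N K') `|` (Omega `&` N L)) F.
  move=> z [[/hf[D dz] Nz]|[/hf2[D dz] Nz]]; exists D; apply: (hasd_near dz).
    by have /open_planeP/(_ _ Nz)[r r0 hr] := oN K'; exists r => // w /hr /F1.
  by have /open_planeP/(_ _ Nz)[r r0 hr] := oN L; exists r => // w /hr /F2.
have aF : approx Omega (K' `|` L) F.
  apply: (runge _ rX _ _ hF); first exact: compactU.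
    by apply: openU; apply: openI.
  by move=> z [Kz|Lz]; [left|right]; split; [exact: K'O|exact: selfN|exact: LO|exact: selfN].
have [h hh Fh] := aF _ e20; exists h => //; exists l; split => z Kz.
  have := Fh z (or_introl (KK' _ Kz)); rewrite F1; last by apply: selfN; exact: KK'.
  by rewrite (nmB (h z)); lra.
have Lz : L (u l z) by exists z => //; exact: KK'.
have := Fh _ (or_intror Lz); rewrite F2; last exact: selfN.
have := ff2 _ (KK' _ Kz); have := nm_triangle (f2 (u l z)) (h (u l z)) (g z).
by rewrite (nmB (h _) (f2 _)); lra.
Qed.

End Nice.

(** * Simply and infinitely connected domains *)

Section Cases.
Context {R : realType}.
Local Notation C := (plane R).
Variable Omega : set C.
Hypotheses (oO : open Omega) (coO : connected Omega).
Implicit Types (z w p : C) (K L X Y U V : set C) (f g h : C -> C) (q : option C)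
  (G : @contour R).
Local Notation removable_pole := (removable_pole Omega).
Local Notation outside := (outside Omega).
Local Notation hull := (hull Omega).
Local Notation nice := (nice Omega).
Local Notation runge_map := (runge_map Omega).
Local Notation opc := (one_point_compactification C).

Definition run_away_maps (u : nat -> C -> C) := forall K, compact K -> K `<=` Omega ->
  exists l, forall z, K z -> ~ (u l @` K) z.

Lemma sphere_complementE : sphere_complement Omega = outside.
Proof.
apply/seteqP; split => [[a|]|[a|]] //=; rewrite /sphere_complement /=.
- by move=> nz Oz; apply: nz; exists a.
- by move=> nz [b Ob [ba]]; apply: nz; rewrite -ba.
- by move=> _ [].
Qed.

Definition off K q := if q is Some a then ~ K a else True.

Lemma open_opcP (A : set opc) : open [set a | A (Some a)] ->
  (A None -> exists M : R, forall a, M < nm a -> A (Some a)) -> open A.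
Proof.
move=> oA AN; rewrite openE => -[a|] Aa /=; rewrite /interior.
  exact: (open_nbhs_nbhs (conj oA Aa)).
have [M hM] := AN Aa; exists (cball 0 M).
  by split; [exact: cball_compact|exact: compact_closed_plane (@cball_compact R 0 M)].
move=> _ [[a na <-]|->//]; apply: hM; rewrite ltNge; apply/negP => aM; apply: na.
by rewrite /cball /= subr0.
Qed.

Lemma open_opc_logeq K q0 : compact K -> open [set q : opc | off K q /\ logeq K q q0].
Proof.
move=> cK; apply: open_opcP; first exact: open_logeq.
move=> [_ Nq]; have [M M0 hM] := logeq_infty cK; have [M' _ hM'] := compact_bounded_plane cK.
exists (Num.max M M') => a; rewrite gt_max => /andP[aM aM']; split.
  by move=> /hM'; rewrite leNgt aM'.
exact: logeq_trans (hM _ aM) Nq.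
Qed.

Lemma open_opc_nlogeq K q0 : compact K -> open [set q : opc | off K q /\ ~ logeq K q q0].
Proof.
move=> cK; apply: open_opcP; first exact: open_nlogeq.
move=> [_ Nq]; have [M M0 hM] := logeq_infty cK; have [M' _ hM'] := compact_bounded_plane cK.
exists (Num.max M M') => a; rewrite gt_max => /andP[aM aM']; split.
  by move=> /hM'; rewrite leNgt aM'.
by move=> aq; apply: Nq; exact: logeq_trans (logeq_sym (hM _ aM)) aq.
Qed.

Lemma outside_off K q : K `<=` Omega -> outside q -> off K q.
Proof. by move=> KO; case: q => //= a na /KO. Qed.

(** In the sphere complement of [Omega] the class of infinity is open, and so is the rest. *)
Lemma simply_connected_logeq K q : simply_connected Omega -> compact K -> K `<=` Omega ->
  outside q -> logeq K q None.
Proof.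
move=> sc cK KO oq; move: sc; rewrite /simply_connected sphere_complementE => sc.
pose B : set opc := [set q | outside q /\ logeq K q None].
suff BE : B = (outside : set opc) by have [] : B q by rewrite BE.
apply: sc; first by exists None; split => //; exact: logeq_refl.
- exists [set q : opc | off K q /\ logeq K q None]; first exact: open_opc_logeq.
  apply/seteqP; split => r; first by move=> [or rN]; split => //; split => //; exact: outside_off.
  by move=> [or [_ rN]].
- exists (~` [set q : opc | off K q /\ ~ logeq K q None]).
    by apply: open_closedC; exact: open_opc_nlogeq.
  apply/seteqP; split => r; first by move=> [or rN]; split => // -[].
  move=> [or nr]; split => //; apply: contrapT => h; apply: nr; split => //.
  exact: outside_off.
Qed.

Section Maps.
Variable u : nat -> C -> C.
Hypotheses (hu : forall l, holo Omega (u l)) (uO : forall l z, Omega z -> Omega (u l z))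
  (iu : forall l x y, Omega x -> Omega y -> u l x = u l y -> x = y)
  (ru : forall l, runge_map (u l)) (ra : run_away_maps u).

Lemma simply_connected_transitive : simply_connected Omega -> transitive_maps Omega u.
Proof.
move=> sc; apply: transitive_of_removable => // K cK KO K0.
have [K' nK' KK'] := nice_enlarge oO coO cK KO K0; have [cK' coK' K'O _ _] := nK'.
have [l dl] := ra cK' K'O; exists K', l; split => // p nXp; apply: contrapT => hp.
have nKp : ~ K' p by move=> Kp; apply: nXp; left.
have nLp : ~ (u l @` K') p by move=> Kp; apply: nXp; right.
have cL : compact (u l @` K') by exact: (image_compact cK' K'O).
have LO : u l @` K' `<=` Omega by move=> _ [z /K'O/uO Oz <-].
have [q oq pq] := nice_separating nK' nKp.
have [q' oq' pq'] := separating_image (hu l) (@uO l) (@ru l) nK' nLp.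
apply: (bad_no_logeq cK' cL K'O LO dl nKp nLp hp (q := None)) => //.
  exact: logeq_trans pq (simply_connected_logeq sc cK' K'O oq).
exact: logeq_trans pq' (simply_connected_logeq sc cL LO oq').
Qed.

End Maps.

(* The functional [f |-> Iint G (u' * f \o u)] is determined by its values on the
   kernels with poles outside [Omega], since the sources of a Cauchy contour can be
   pushed out of [Omega] without crossing [u @` K]. *)
Lemma functional_zero G K u f : wfc G -> exact_on G -> compact K -> K `<=` Omega ->
  supp G `<=` K -> holo Omega u -> (forall z, Omega z -> Omega (u z)) ->
  (forall q, outside q -> Iint G (fun z => der u z * ck q (u z)) = 0) ->
  holo Omega f -> Iint G (fun z => der u z * f (u z)) = 0.
Proof.
move=> wG eG cK KO sG hu uO w0 hf; pose L := u @` K.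
have cL : compact L by exact: (image_compact cK KO hu).
have LO : L `<=` Omega by move=> _ [z /KO/uO Oz <-].
have sO z : supp G z -> Omega z by move=> /sG/KO.
have sL z : supp G z -> L (u z) by move=> /sG Kz; exists z.
have cdu z : supp G z -> ccont (der u) z by move=> /sO Oz; exact: holo_ccont (holo_der oO hu) Oz.
have ccu g z : supp G z -> ccont g (u z) -> ccont (fun z => der u z * g (u z)) z.
  move=> sz cg; apply: ccontM; first exact: cdu.
  by apply: ccont_comp cg; exact: holo_ccont hu (sO _ sz).
have [d d0 hd] := compact_open_nbhd cL oO LO.
have [M M0 hM] := logeq_infty cL; have [M' _ hM'] := compact_bounded_plane cL.
have d30 : 0 < d / 3 by rewrite divr_gt0.
(* A pole in [Omega] off [Q] is either large enough to be equivalent to infinity, or within [d / 3]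
   of a point off [Omega], as [logeq_near] requires. *)
pose Q := inner Omega (Num.max M M') (d / 3).
have cQ : compact Q by exact: inner_compact.
have QO : Q `<=` Omega by exact: inner_sub.
have LQ : L `<=` Q.
  move=> z Lz; split; first by rewrite le_max hM' ?orbT.
  move=> a na; rewrite leNgt; apply/negP => az; apply: na; apply: (hd z) => //; lra.
have push z : Omega z -> ~ Q z -> exists2 q, outside q & logeq L (Some z) q.
  move=> Oz nQz; have [h|h] := ltP M (nm z); first by exists None => //; exact: hM.
  have [a [na az]] : exists a : C, ~ Omega a /\ nm (a - z) < d / 3.
    apply: contrapT => na; apply: nQz; split; first by rewrite le_max h.
    move=> a nOa; rewrite leNgt; apply/negP => az.
    by apply: na; exists a.
  exists (Some a) => //; apply: logeq_near => y Ly; rewrite nmB (lt_le_trans az)//.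
  rewrite ler_pM2r// nmB leNgt; apply/negP => ay; exact: na (hd _ _ Ly ay).
(* The difference of the integrands for [z] and [q] is the derivative of [v \o u], and the integral
   for [q] vanishes by hypothesis. *)
have wz z : Omega z -> ~ Q z -> Iint G (fun y => der u y * (u y - z)^-1) = 0.
  move=> Oz nQz; have [q oq [V [v [oV LV dv]]]] := push z Oz nQz.
  have cV y : supp G y -> V (u y) by move=> /sL/LV.
  have nz y : supp G y -> u y != z by move=> /sL/LQ Qu; apply/eqP => uz; apply: nQz; rewrite -uz.
  have cz y : supp G y -> ccont (ck (Some z)) (u y).
    by move=> /nz; rewrite -subr_eq0 => uz; apply: ccontV => //; apply: ccontB; [exact: ccont_id|exact: ccont_cst].
  have cq y : supp G y -> ccont (ck q) (u y).
    move=> sy; case: q oq {dv} => [a na|_]; last exact: ccont_cst.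
    apply: ccontV; last by apply: ccontB; [exact: ccont_id|exact: ccont_cst].
    by rewrite subr_eq0; apply/eqP => ua; apply: na; rewrite -ua; exact/LO/sL.
  rewrite -[RHS](eG (fun y => v (u y)) (fun y => der u y * (ck (Some z) (u y)) - der u y * ck q (u y))).
    rewrite IintB ?(w0 q oq) ?subr0//.
      by move=> y sy; exact: (ccu (ck (Some z)) y sy (cz _ sy)).
    by move=> y sy; exact: (ccu (ck q) y sy (cq _ sy)).
  move=> y sy; rewrite -mulrBr mulrC; apply: hasd_comp; last exact: dv (cV _ sy).
  exact: derP hu (sO _ sy).
have [H [wH sH _ _ Hf]] := cauchy_contour_exists oO cQ QO.
have [M1 M10 hM1] := compact_cont_bound (@supp_compact R G) cdu.
have cf w : supp H w -> ccont f w by move=> /sH[Ow _]; exact: holo_ccont hf Ow.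
have sHL w : supp H w -> ~ L w by move=> /sH[_ nQ] /LQ.
have tpi0 : 0 < nm (tpi : C) by rewrite nm_gt0 tpi_neq0.
apply/eqP; rewrite -nm_eq0 eq_le nm_ge0 andbT; apply/ler_addgt0Pr => e e0; rewrite add0r.
pose k := clen G * M1 + 1; have k0 : 0 < k by rewrite ltr_wpDl ?mulr_ge0 ?clen_ge0.
have [s sS sP] := kernel_approx wH cf cL sHL (divr_gt0 (mulr_gt0 e0 tpi0) k0).
pose S w := tpi^-1 * \sum_(x <- s) x.1 * (x.2 - w)^-1.
have cS y : supp G y -> ccont (fun y => der u y * S (u y)) y.
  move=> sy; apply: ccu => //; apply: ccontM; first exact: ccont_cst.
  have h x : x \in s -> ccont (fun w => x.1 * (x.2 - w)^-1) (u y).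
    move=> xs; apply: ccontM; first exact: ccont_cst.
    apply: ccontV; last by apply: ccontB; [exact: ccont_cst|exact: ccont_id].
    rewrite subr_eq0; apply/eqP => xu; apply: (sHL _ (sS _ xs)); rewrite xu; exact: sL.
  elim: s h {sS sP S} => [|x s IH] h.
    by rewrite (_ : (fun _ => _) = fun=> 0); [exact: ccont_cst|apply/funext => w; rewrite big_nil].
  rewrite (_ : (fun _ => _) = fun w => x.1 * (x.2 - w)^-1 + \sum_(x <- s) x.1 * (x.2 - w)^-1).
    by apply: ccontD; [apply: h; rewrite mem_head|apply: IH => x' xs; apply: h; rewrite inE xs orbT].
  by apply/funext => w; rewrite big_cons.
have IS : Iint G (fun y => der u y * S (u y)) = 0.
  have h x : x \in s -> Iint G (fun y => der u y * (u y - x.2)^-1) = 0.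
    by move=> /sS/sH[Ox nQ]; exact: wz.
  have ck x y : x \in s -> supp G y -> ccont (fun y => der u y * (u y - x.2)^-1) y.
    move=> xs sy; apply: (ccu (fun w => (w - x.2)^-1)) => //.
    apply: ccontV; last by apply: ccontB; [exact: ccont_id|exact: ccont_cst].
    by rewrite subr_eq0; apply/eqP => xu; apply: (sHL _ (sS _ xs)); rewrite -xu; exact: sL.
  pose T y := \sum_(x <- s) (- (tpi^-1 * x.1)) * (der u y * (u y - x.2)^-1).
  have TE y : der u y * S (u y) = T y.
    rewrite /S /T mulrCA !mulr_sumr; apply: eq_bigr => x _.
    by rewrite -[x.2 - u y]opprB invrN; ring.
  have [cT IT] : (forall y, supp G y -> ccont T y) /\ Iint G T = 0.
    rewrite /T; elim: s h ck {S cS TE T sS sP} => [|x s IH] h ck.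
      rewrite (_ : (fun y => \sum_(x <- [::]) _) = fun=> 0 * 0); last first.
        by apply/funext => y; rewrite big_nil mulr0.
      by split; [move=> y _; exact: ccont_cst|rewrite IintMl ?mul0r// => y _; exact: ccont_cst].
    have [||cT IT] := IH.
    - by move=> x' xs; apply: h; rewrite inE xs orbT.
    - by move=> x' y xs; apply: ck; rewrite inE xs orbT.
    set T := (fun y => \sum_(x <- s) _) in cT IT.
    rewrite (_ : (fun y => \sum_(x <- _ :: s) _) =
      fun y => (- (tpi^-1 * x.1)) * (der u y * (u y - x.2)^-1) + T y); last first.
      by apply/funext => y; rewrite big_cons.
    have cx y : supp G y -> ccont (fun y => der u y * (u y - x.2)^-1) y.
      by apply: ck; rewrite mem_head.
    have cx' y : supp G y -> ccont (fun y => (- (tpi^-1 * x.1)) * (der u y * (u y - x.2)^-1)) y.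
      by move=> sy; apply: ccontM; [exact: ccont_cst|exact: cx].
    split; first by move=> y sy; apply: ccontD; [exact: cx'|exact: cT].
    by rewrite IintD// IT addr0 IintMl// h ?mulr0// mem_head.
  by rewrite -IT; apply: eq_Iint.
have cfu y : supp G y -> ccont (fun y => der u y * f (u y)) y.
  by move=> sy; apply: ccu => //; apply: holo_ccont hf _; exact/uO/sO.
rewrite -[X in nm X]subr0 -IS -IintB//.
apply: (@le_trans _ _ (clen G * (M1 * (e / k)))); last first.
  rewrite (_ : _ * _ = clen G * M1 / k * e); last by field; rewrite gt_eqF.
  by rewrite ler_piMl ?(ltW e0)// ler_pdivrMr// mul1r /k; lra.
apply: Iint_bound => // y sy; first by apply: ccontB; [exact: cfu|exact: cS].
rewrite -mulrBr nmM ler_pM ?nm_ge0 ?hM1//.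
have Ly := sL _ sy; rewrite -[f _](mulKf (@tpi_neq0 R)) -(Hf _ _ hf (LQ _ Ly)) -mulrBr.
rewrite nmM nmV mulrC ler_pdivrMr//; have := sP _ Ly.
by rewrite mulrAC.
Qed.

Lemma comb_contour G1 G2 (a b : C) : wfc G1 -> wfc G2 -> exact_on G1 -> exact_on G2 ->
  exists G, [/\ wfc G, exact_on G, supp G `<=` supp G1 `|` supp G2 &
    forall f, Iint G f = a * Iint G1 f + b * Iint G2 f].
Proof.
move=> w1 w2 e1 e2; pose sc c G : @contour R := [seq (c * x.1, x.2) | x <- G].
have scI c G f : Iint (sc c G) f = c * Iint G f.
  by rewrite /Iint big_map mulr_sumr; apply: eq_bigr => x _; rewrite mulrA.
have scS c G z : supp G z -> supp (sc c G) z.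
  by move=> [x xG xz]; exists (c * x.1, x.2) => //; apply/mapP; exists x.
have IE f : Iint (sc a G1 ++ sc b G2) f = a * Iint G1 f + b * Iint G2 f.
  by rewrite Iint_cat !scI.
have catS G H z : supp G z -> supp (G ++ H) z /\ supp (H ++ G) z.
  by move=> [x xG xz]; split; exists x => //; rewrite mem_cat xG ?orbT.
exists (sc a G1 ++ sc b G2); split => //.
- by move=> x; rewrite mem_cat => /orP[] /mapP[y yG ->]; [exact: (w1 y yG)|exact: (w2 y yG)].
- move=> F f dF; rewrite IE (e1 F) ?(e2 F) ?mulr0 ?addr0// => z sz; apply: dF.
    by have [_] := catS _ (sc a G1) _ (scS b _ _ sz).
  by have [] := catS _ (sc b G2) _ (scS a _ _ sz).
- move=> z [x]; rewrite mem_cat => /orP[] /mapP[y yG ->] yz; [left|right]; by exists y.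
Qed.

Lemma Iint0 G : exact_on G -> Iint G (fun=> 0) = 0.
Proof. by move=> eG; apply: (eG (fun=> 0)) => w _; exact: hasd_cst. Qed.

(** As [u] is injective, [g / der u] is holomorphic on [Omega]. The Runge condition approximates it
    by [f \o u], and [der u] times such a function has integral zero. *)
Lemma annihilator G K u g : wfc G -> exact_on G -> compact K -> K `<=` Omega ->
  supp G `<=` K -> holo Omega u -> (forall z, Omega z -> Omega (u z)) ->
  (forall x y, Omega x -> Omega y -> u x = u y -> x = y) -> runge_map u ->
  (forall q, outside q -> Iint G (fun z => der u z * ck q (u z)) = 0) ->
  holo Omega g -> Iint G g = 0.
Proof.
move=> wG eG cK KO sG hu uO iu ru w0 hg.
have sO z : supp G z -> Omega z by move=> /sG/KO.
have hd := holo_der oO hu.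
have d0 z : Omega z -> der u z != 0 by move=> Oz; exact: (inj_der_neq0 oO hu iu).
have hgd : holo Omega (fun z => g z * (der u z)^-1) by apply: holoM => //; exact: holoV.
have cdu z : supp G z -> ccont (der u) z by move=> /sO; exact: holo_ccont hd.
have [M M0 hM] := compact_cont_bound (@supp_compact R G) cdu.
apply/eqP; rewrite -nm_eq0 eq_le nm_ge0 andbT; apply/ler_addgt0Pr => e e0; rewrite add0r.
pose k := clen G * M + 1; have k0 : 0 < k by rewrite ltr_wpDl ?mulr_ge0 ?clen_ge0.
have [f hf ff] := ru _ K _ hgd cK KO (divr_gt0 e0 k0).
have h0 := functional_zero wG eG cK KO sG hu uO w0 hf.
have hfu : holo Omega (fun y => der u y * f (u y)).
  by apply: holoM => //; exact: holo_comp uO hu hf.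
rewrite -[X in nm X]subr0 -h0 -IintB//; last 2 first.
- by move=> z /sO; exact: holo_ccont hg.
- by move=> z /sO; exact: holo_ccont hfu.
apply: (@le_trans _ _ (clen G * (M * (e / k)))); last first.
  rewrite (_ : _ * _ = clen G * M / k * e); last by field; rewrite gt_eqF.
  by rewrite ler_piMl ?(ltW e0)// ler_pdivrMr// mul1r /k; lra.
apply: Iint_bound => // y sy.
  by apply: ccontB; [exact: holo_ccont hg (sO _ sy)|exact: holo_ccont hfu (sO _ sy)].
rewrite (_ : _ - _ = der u y * (g y * (der u y)^-1 - f (u y))); last first.
  by field; exact: d0 (sO _ sy).
by rewrite nmM ler_pM ?nm_ge0 ?hM// nmB; apply: ff; exact: sG.
Qed.

Lemma kernel_const G K u q q' : wfc G -> exact_on G -> K `<=` Omega -> supp G `<=` K ->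
  holo Omega u -> (forall z, Omega z -> Omega (u z)) -> outside q -> outside q' ->
  logeq (u @` K) q q' ->
  Iint G (fun z => der u z * ck q (u z)) = Iint G (fun z => der u z * ck q' (u z)).
Proof.
move=> wG eG KO sG hu uO oq oq' [V [v [oV LV dv]]].
have sO z : supp G z -> Omega z by move=> /sG/KO.
have ck_holo r : outside r -> holo Omega (ck r).
  by case: r => [a na|_]; [exact: holo_inv_sub|exact: holo_cst].
have cq r z : outside r -> supp G z -> ccont (fun z => der u z * ck r (u z)) z.
  move=> /ck_holo hr /sO Oz; apply: holo_ccont Oz.
  by apply: holoM; [exact: holo_der|exact: holo_comp uO hu hr].
apply/eqP; rewrite -subr_eq0 -IintB//; try by move=> z; exact: cq.
apply/eqP/(eG (fun y => v (u y))) => y sy; rewrite -mulrBr mulrC; apply: hasd_comp.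
  exact: derP hu (sO _ sy).
by apply/dv/LV; exists y => //; exact: sG.
Qed.

(** A contour around [F] in the union of [Omega] and [F]: kernels with poles in the rest of the
    complement are holomorphic on that union. *)
Lemma clopen_contour F : compact F -> (forall a, F a -> ~ Omega a) -> open (Omega `|` F) ->
  exists G, [/\ wfc G, exact_on G, supp G `<=` Omega,
    forall a, F a -> Iint G (fun w => (w - a)^-1) = tpi &
    forall a, ~ Omega a -> ~ F a -> Iint G (fun w => (w - a)^-1) = 0].
Proof.
move=> cF FO oF; have [G [wG sG eG G0 Gf]] := cauchy_contour_exists oF cF (@subsetUr _ _ _).
exists G; split => //.
- by move=> z /sG[[]].
- move=> a Fa; rewrite -[RHS]mulr1 -(Gf (fun=> 1) a) //; last exact: holo_cst.
  by congr Iint; apply/funext => w; rewrite mul1r.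
- by move=> a nO nF; apply: G0; apply: holo_inv_sub => -[].
Qed.

(** Compactness of the sphere complement: a neighbourhood of infinity and finitely many discs cover
    it, each within one class. *)
Lemma finite_classes K : compact K -> K `<=` Omega -> exists2 s : seq (option C),
  (forall q, q \in s -> outside q) &
  forall q, outside q -> exists2 q', q' \in s & logeq K q q'.
Proof.
move=> cK KO; have [M M0 hM] := logeq_infty cK.
pose B := cball 0 M `&` ~` Omega.
have cB : compact B.
  apply: (@subclosed_compact _ _ (cball 0 M)); [|exact: cball_compact|exact: subIsetl].
  apply: closedI; first exact: compact_closed_plane (@cball_compact R 0 M).
  exact: open_closedC.
have rP (a : C) : exists r : R, ~ Omega a -> 0 < r /\
    forall p, nm (p - a) < r -> logeq K (Some p) (Some a).
  have [Oa|na] := pselect (Omega a); first by exists 0 => /(_ Oa).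
  by have [r r0 hr] := logeq_open cK (fun Ka => na (KO _ Ka)); exists r.
pose r a := projT1 (cid (rP a)).
have rE a : ~ Omega a -> 0 < r a /\ forall p, nm (p - a) < r a -> logeq K (Some p) (Some a)
  := projT2 (cid (rP a)).
have [s sB Bs] := compact_ball_cover cB (fun z Bz => proj1 (rE z (proj2 Bz))).
exists (None :: [seq Some a | a <- s]) => [q|[a|] oq].
- by rewrite inE => /orP[/eqP->//|/mapP[a /sB[_ na] ->]].
- have [aM|aM] := ltP M (nm a); first by exists None; [rewrite mem_head|exact: hM].
  have [|b bs ab] := Bs a; first by split => //; rewrite /cball /= subr0.
  exists (Some b); first by rewrite inE; apply/orP; right; exact: map_f.
  by have [_ nb] := sB _ bs; have [_] := rE _ nb; apply.
- by exists None; [rewrite mem_head|exact: logeq_refl].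
Qed.

Definition trivial_class K0 K q0 := forall q q', outside q -> outside q' ->
  logeq K0 q q0 -> logeq K0 q' q0 -> logeq K q q'.

(** For each listed class that some compact set splits, such a set is added to [K1]; the classes
    that [K1] leaves whole are then left whole by every compact set. *)
Lemma stable_enlarge K0 (s : seq (option C)) : compact K0 -> K0 `<=` Omega -> K0 !=set0 ->
  exists K1, [/\ nice K1, K0 `<=` K1 & forall q0, q0 \in s -> trivial_class K0 K1 q0 ->
    forall K, compact K -> K `<=` Omega -> trivial_class K0 K q0].
Proof.
move=> cK KO [x Kx].
suff [K [cK' K'O KK' hK]] : exists K1, [/\ compact K1, K1 `<=` Omega, K0 `<=` K1 &
    forall q0, q0 \in s -> trivial_class K0 K1 q0 ->
    forall K, compact K -> K `<=` Omega -> trivial_class K0 K q0].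
  have [K1 nK1 KK1] := nice_enlarge oO coO cK' K'O (ex_intro _ x (KK' _ Kx)).
  exists K1; split => //; first exact: subset_trans KK1.
  move=> q0 qs t1; apply: (hK _ qs) => q q' oq oq' qq0 qq0'.
  exact: logeq_sub KK1 (t1 q q' oq oq' qq0 qq0').
elim: s => [|q0 s [K1 [cK1 K1O KK1 hK1]]]; first by exists K0; split.
have [t0|] := pselect (forall K, compact K -> K `<=` Omega -> trivial_class K0 K q0).
  by exists K1; split => // q; rewrite inE => /orP[/eqP ->//|]; exact: hK1.
move=> /existsNP[K2] /not_implyP[cK2] /not_implyP[K2O nt].
exists (K1 `|` K2); split.
- exact: compactU.
- by move=> z [/K1O|/K2O].
- by move=> z /KK1; left.
- move=> q; rewrite inE => /orP[/eqP -> t|qs t].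
    exfalso; apply: nt => r r' or or' rq rq'; apply: logeq_sub (t r r' or or' rq rq').
    exact: subsetUr.
  apply: (hK1 _ qs) => r r' or or' rq rq'; apply: logeq_sub (t r r' or or' rq rq').
  exact: subsetUl.
Qed.

Lemma clopen_piece (A : set opc) : A `<=` outside -> ~ A None ->
  (exists2 O, open O & A = (outside : set opc) `&` O) ->
  (exists2 F, closed F & A = (outside : set opc) `&` F) ->
  let F := [set a | A (Some a)] in
  [/\ compact F, forall a, F a -> ~ Omega a & open (Omega `|` F)].
Proof.
move=> AO AN [B oB AB] [D clD AD] F.
have pre (E : set opc) : open E -> open [set z : C | E (Some z)].
  move=> oE; rewrite openE => z Ez; rewrite /interior.
  by have : nbhs (Some z : opc) E by exact: open_nbhs_nbhs.
split; last 2 first.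
- by move=> a /AO.
- rewrite (_ : _ `|` _ = Omega `|` Some @^-1` B).
    by apply: openU => //; exact: pre.
  apply/seteqP; split => z [Oz|Fz]; [by left|right|by left|].
    by move: Fz; rewrite /F /= AB => -[].
  have [Oz|nOz] := pselect (Omega z); [by left|right].
  by rewrite /F /= AB.
have FE : F = ~` Omega `&` Some @^-1` D.
  by apply/seteqP; split => z; rewrite /F /= AD => -[].
have clF : closed F.
  rewrite FE; apply: closedI; first exact: open_closedC.
  by have := open_closedC (pre _ (closed_openC clD)); rewrite setCK.
have nD : ~ D None by move=> DN; apply: AN; rewrite AD.
have [Q [cQ clQ] hQ] : nbhs (None : opc) (~` D).
  by apply: open_nbhs_nbhs; split => //; exact: closed_openC.
have [M _ hM] := compact_bounded_plane cQ.
apply: (bounded_closed_compact_plane clF (M := M)) => z Fz; apply: hM.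
apply: contrapT => nQ; have := hQ (Some z) (or_introl (ex_intro2 _ _ z nQ erefl)).
by apply; move: Fz; rewrite FE => -[].
Qed.

Lemma not_connected_clopen (T : topologicalType) (A : set T) : ~ connected A ->
  exists B, [/\ B !=set0, (exists2 O, open O & B = A `&` O),
    (exists2 F, closed F & B = A `&` F) & B != A].
Proof.
move=> nA; apply: contrapT => h; apply: nA => B B0 oB cB; apply: contrapT => BA.
by apply: h; exists B; split => //; exact/eqP.
Qed.

Lemma clopen_setD (T : topologicalType) (A B : set T) :
  (exists2 O, open O & B = A `&` O) -> (exists2 F, closed F & B = A `&` F) ->
  (exists2 O, open O & A `\` B = A `&` O) /\ (exists2 F, closed F & A `\` B = A `&` F).
Proof.
move=> [ O oO' BO] [F cF BF]; split.
  exists (~` F); first exact: closed_openC.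
  apply/seteqP; split => x; rewrite BF; first by move=> [Ax nx]; split => // Fx; apply: nx.
  by move=> [Ax nx]; split => // -[].
exists (~` O); first exact: open_closedC.
apply/seteqP; split => x; rewrite BO; first by move=> [Ax nx]; split => // Fx; apply: nx.
by move=> [Ax nx]; split => // -[].
Qed.

Lemma clopen_trans (T : topologicalType) (A B D : set T) :
  (exists2 O, open O & B = A `&` O) -> (exists2 F, closed F & B = A `&` F) ->
  (exists2 O, open O & D = B `&` O) -> (exists2 F, closed F & D = B `&` F) ->
  (exists2 O, open O & D = A `&` O) /\ (exists2 F, closed F & D = A `&` F).
Proof.
move=> [ O oO' ->] [F cF BF] [ O' oO'' DO] [F' cF' DF]; split.
  by exists (O `&` O'); [exact: openI|rewrite DO setIA].
by exists (F `&` F'); [exact: closedI|rewrite DF BF setIA].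
Qed.

(** Were there no such pair, the complement would be a union of two connected sets and would have at
    most two components. The part containing infinity is the third piece. *)
Lemma infinitely_connected_pieces : infinitely_connected Omega ->
  exists A1 A2 : set opc, [/\ A1 !=set0, A2 !=set0, A1 `&` A2 = set0, ~ A1 None /\ ~ A2 None &
  [/\ (exists2 O, open O & A1 = (outside : set opc) `&` O),
    (exists2 F, closed F & A1 = (outside : set opc) `&` F),
    (exists2 O, open O & A2 = (outside : set opc) `&` O) &
    (exists2 F, closed F & A2 = (outside : set opc) `&` F)]].
Proof.
rewrite /infinitely_connected sphere_complementE; set W : set opc := outside => inf.
apply: contrapT => no; have noP (A1 A2 : set opc) : A1 !=set0 -> A2 !=set0 -> A1 `&` A2 = set0 ->
    ~ A1 None -> ~ A2 None ->
    (exists2 O, open O & A1 = W `&` O) -> (exists2 F, closed F & A1 = W `&` F) ->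
    (exists2 O, open O & A2 = W `&` O) -> (exists2 F, closed F & A2 = W `&` F) -> False.
  by move=> *; apply: no; exists A1, A2.
have two (A B : set opc) : connected A -> connected B -> A `|` B = W -> False.
  move=> cA cB AB; apply: inf.
  pose f (x : opc) := connected_component W x.
  have AW : A `<=` W by rewrite -AB; exact: subsetUl.
  have BW : B `<=` W by rewrite -AB; exact: subsetUr.
  have fin (D : set opc) : connected D -> D `<=` W -> finite_set (f @` D).
    move=> cD DW; have [->|/set0P[d Dd]] := eqVneq D set0; first by rewrite image_set0.
    apply: (@sub_finite_set _ _ [set f d]); last exact: finite_set1.
    move=> _ [x Dx <-]; apply/esym/same_connected_component.
    by exists D => //; split.
  rewrite -[X in f @` X]AB image_setU finite_setU; split; exact: fin.
have clopenW : (exists2 O, open O & W = W `&` O) /\ (exists2 F, closed F & W = W `&` F).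
  by split; (exists setT; last by rewrite setIT); [exact: openT|exact: closedT].
have [cW|/not_connected_clopen[B0 [B00 oB0 cB0 B0W]]] := pselect (connected W).
  by apply: (two W W) => //; rewrite setUid.
have WN : W None by [].
have [B [B1 oB cB BN]] : exists B : set opc, [/\ B !=set0,
   (exists2 O, open O & B = W `&` O), (exists2 F, closed F & B = W `&` F) & ~ B None].
  have [h|h] := pselect (B0 None); last by exists B0.
  have [oC cC] := clopen_setD oB0 cB0; exists (W `\` B0); split => //; last by case.
  apply/set0P; apply: contra_neq B0W; rewrite setD_eq0 => WB; apply/seteqP; split => //.
  by have [ O _ ->] := oB0; exact: subIsetl.
have [oA cA] := clopen_setD oB cB.
have BW : B `<=` W by have [ O _ ->] := oB; exact: subIsetl.
apply: (two (W `\` B) B); last by rewrite setUC setUDr setDv setD0 setUidr.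
- apply: contrapT => /not_connected_clopen[D [D0 oD cD DW]].
  have [oD' cD'] := clopen_trans oA cA oD cD.
  have DWB : D `<=` W `\` B by have [ O _ ->] := oD; exact: subIsetl.
  have [DN|DN] := pselect (D None); last first.
    apply: (noP D B) => //; apply/seteqP; split => // x [/DWB[_ ?]]; exact.
  have [oE cE] := clopen_setD oD cD; have [oE' cE'] := clopen_trans oA cA oE cE.
  apply: (noP ((W `\` B) `\` D) B) => //.
  - apply/set0P; apply: contra_neq DW; rewrite setD_eq0 => WB; exact/seteqP.
  - by apply/seteqP; split => // x [[[_ ?] _]].
  - by case.
- apply: contrapT => /not_connected_clopen[D [D0 oD cD DW]].
  have [oD' cD'] := clopen_trans oB cB oD cD.
  have DB : D `<=` B by have [ O _ ->] := oD; exact: subIsetl.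
  have [oE cE] := clopen_setD oD cD; have [oE' cE'] := clopen_trans oB cB oE cE.
  apply: (noP D (B `\` D)) => //.
  - apply/set0P; apply: contra_neq DW; rewrite setD_eq0 => WB; exact/seteqP.
  - by apply/seteqP; split => // x [? []].
  - by move=> /DB.
  - by move=> [].
Qed.

Section Pieces.
Variable u : nat -> C -> C.
Hypotheses (hu : forall l, holo Omega (u l)) (uO : forall l z, Omega z -> Omega (u l z))
  (iu : forall l x y, Omega x -> Omega y -> u l x = u l y -> x = y)
  (ru : forall l, runge_map (u l)) (ra : run_away_maps u).

Lemma pieces_transitive F1 F2 : compact F1 -> compact F2 -> F1 !=set0 -> F2 !=set0 ->
  (forall a, F1 a -> ~ Omega a) -> (forall a, F2 a -> ~ Omega a) ->
  (forall a, F1 a -> ~ F2 a) -> open (Omega `|` F1) -> open (Omega `|` F2) ->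
  transitive_maps Omega u.
Proof.
move=> cF1 cF2 [a1 Fa1] [a2 Fa2] FO1 FO2 F12 oF1 oF2.
have [G1 [wG1 eG1 sG1 G1F G1n]] := clopen_contour cF1 FO1 oF1.
have [G2 [wG2 eG2 sG2 G2F G2n]] := clopen_contour cF2 FO2 oF2.
apply: transitive_of_removable => // K cK KO [x0 Kx0].
have [K0 nK0 KK0] : exists2 K0, nice K0 & K `|` (supp G1 `|` supp G2) `<=` K0.
  apply: nice_enlarge => //; last by exists x0; left.
    by apply: compactU => //; apply: compactU; exact: supp_compact.
  by move=> z [/KO|[/sG1|/sG2]].
have Kx : K0 x0 by apply: KK0; left.
have sGK1 : supp G1 `<=` K0 by move=> z sz; apply: KK0; right; left.
have sGK2 : supp G2 `<=` K0 by move=> z sz; apply: KK0; right; right.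
have [cK0 coK0 K0O _ _] := nK0.
have [s so hs] := finite_classes cK0 K0O.
have [K1 [nK1 KK1 hK1]] := stable_enlarge s cK0 K0O (ex_intro _ x0 Kx).
have [cK1 coK1 K1O _ _] := nK1.
(* Run-away is applied to [K1], while the approximation takes place on [K0] and its image; thus [K1]
   too is disjoint from the image of [K0]. *)
have [l dl] := ra cK1 K1O.
exists K0, l; split => //; first by move=> z Kz; apply: KK0; left.
  by move=> z /KK1 /dl nz [y /KK1 Ky yz]; apply: nz; exists y.
move=> p nXp; apply: contrapT => hp; pose L := u l @` K0.
have nKp : ~ K0 p by move=> Kp; apply: nXp; left.
have nLp : ~ L p by move=> Lp; apply: nXp; right.
have cL : compact L by exact: (image_compact cK0 K0O).
have coL : connected L by exact: (image_connected coK0 K0O).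
have LO : L `<=` Omega by move=> _ [z /K0O/uO Oz <-].
have dl1 z : K1 z -> ~ L z by move=> /dl nz [y /KK1 Ky yz]; apply: nz; exists y.
have dl0 z : K0 z -> ~ L z by move=> /KK1; exact: dl1.
have dl0' z : L z -> ~ K0 z by move=> Lz /dl0.
have hp' : hull (L `|` K0) p by rewrite setUC.
have sepK := nice_separating nK0.
have sepL : separating Omega L := separating_image (hu l) (@uO l) (@ru l) nK0.
pose y0 := u l x0; have Ly : L y0 by exists x0.
have Kp : logeq K0 (Some p) (Some y0).
  exact: (bad_meets cK0 cL K0O LO coL sepK dl0 nKp nLp hp Ly).
have Lp : logeq L (Some p) (Some x0).
  exact: (bad_meets cL cK0 LO K0O coK0 sepL dl0' nLp nKp hp' Kx).
have nboth q : outside q -> logeq K0 (Some p) q -> logeq L (Some p) q -> False.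
  exact: (bad_no_logeq cK0 cL K0O LO dl0 nKp nLp hp).
have alt q : outside q -> logeq K0 q (Some p) \/ logeq L q (Some p).
  move=> oq; have [|h|h] := logeq_or_option cK0 cL coK0 coL dl0 (q := q) _ Kx Ly.
  - by move=> a qa; move: oq; rewrite qa => na; split=> [/K0O|/LO].
  - by left; exact: logeq_trans h (logeq_sym Kp).
  - by right; exact: logeq_trans h (logeq_sym Lp).
(* Otherwise [q] would be equivalent to [x0], hence to [p], off [L], which [nboth] excludes. *)
have E1 q : outside q -> logeq K0 q (Some p) -> logeq K1 q (Some y0).
  move=> oq qp; have [|//|h] := logeq_or_option cK1 cL coK1 coL dl1 (q := q) _ (KK1 _ Kx) Ly.
    by move=> a qa; move: oq; rewrite qa => na; split=> [/K1O|/LO].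
  exfalso; apply: (nboth _ oq (logeq_sym qp)); exact: logeq_trans Lp (logeq_sym h).
(* By [E1] the outside points in the [K0]-class of [p] lie in one [K1]-class, so the choice of [K1]
   keeps them together for [L]. *)
have E2 q q' : outside q -> outside q' -> logeq K0 q (Some p) -> logeq K0 q' (Some p) ->
    logeq L q q'.
  move=> oq oq' qp qp'; have [q0 q0s qq0] := hs _ oq.
  have pq0 := logeq_trans (logeq_sym qp) qq0.
  have oq0 := so _ q0s.
  apply: (hK1 q0 q0s _ L cL LO q q') => //; last exact: logeq_trans qp' pq0.
  move=> r r' or or' rq rq'; apply: logeq_trans (E1 r or _) (logeq_sym (E1 r' or' _)).
    exact: logeq_trans rq (logeq_sym pq0).
  exact: logeq_trans rq' (logeq_sym pq0).
pose w G q := Iint G (fun z => der (u l) z * ck q (u l z)).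
have wN G : exact_on G -> w G None = 0.
  move=> eG; rewrite -[RHS](Iint0 eG) /w; congr Iint.
  by apply/funext => z; rewrite mulr0.
have wC G q q' : wfc G -> exact_on G -> supp G `<=` K0 -> outside q -> outside q' ->
    logeq L q q' -> w G q = w G q'.
  by move=> wG eG sG oq oq' qq'; apply: (kernel_const wG eG K0O sG (hu l) (@uO l)).
(* Each outside point is in the [L]-class of [p] or in the single [L]-class given by [E2]: at most
   two classes, and the periods of the class of infinity vanish. *)
have [v1 [v2 hv]] : exists v1 v2, forall q, outside q ->
    (w G1 q = 0 /\ w G2 q = 0) \/ (w G1 q = v1 /\ w G2 q = v2).
  have same q q' : outside q -> outside q' -> logeq L q q' ->
      w G1 q = w G1 q' /\ w G2 q = w G2 q'.
    by move=> oq oq' qq'; split; apply: wC.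
  have same0 q : outside q -> logeq L q None -> w G1 q = 0 /\ w G2 q = 0.
    by move=> oq qN; have [-> ->] := same _ None oq I qN; rewrite !wN.
  have pick P : (forall q q', outside q -> outside q' -> P q -> P q' -> logeq L q q') ->
      (forall q, outside q -> logeq L q None \/ P q) ->
      exists v1 v2, forall q, outside q ->
      (w G1 q = 0 /\ w G2 q = 0) \/ (w G1 q = v1 /\ w G2 q = v2).
    move=> h1 h2; have [[q' [oq' Pq']]|nP] := pselect (exists q', outside q' /\ P q').
      exists (w G1 q'), (w G2 q') => q oq; have [qN|Pq] := h2 _ oq; first by left; exact: same0.
      by right; apply: same => //; exact: h1.
    exists 0, 0 => q oq; left; apply: same0 => //; have [//|Pq] := h2 _ oq.
    by exfalso; apply: nP; exists q.
  have [N0|NL] := alt None I.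
    apply: (pick (fun q => logeq L q (Some p))).
      by move=> q q' _ _ h1 h2; exact: logeq_trans h1 (logeq_sym h2).
    by move=> q oq; have [h|] := alt q oq; [left; exact: E2|right].
  apply: (pick (fun q => logeq K0 q (Some p))); first by move=> *; exact: E2.
  move=> q oq; have [h|h] := alt q oq; [by right|left].
  exact: logeq_trans h (logeq_sym NL).
have [a [b [ab0 hab]]] : exists a b : C, (a, b) != (0, 0) /\ a * v1 + b * v2 = 0.
  have [v20|v20] := eqVneq v2 0; last first.
    exists v2, (- v1); split; last by ring.
    by apply/eqP => -[/eqP]; rewrite (negbTE v20).
  have [v10|v10] := eqVneq v1 0.
    exists 1, 0; split; last by rewrite v10 mulr0 mul0r addr0.
    by apply/eqP => -[/eqP]; rewrite oner_eq0.
  exists v2, (- v1); split; last by ring.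
  by apply/eqP => -[_ /eqP]; rewrite oppr_eq0 (negbTE v10).
have [G [wG eG sG IG]] := comb_contour a b wG1 wG2 eG1 eG2.
have sGK : supp G `<=` K0 by move=> z /sG[/sGK1|/sGK2].
have w0 q : outside q -> Iint G (fun z => der (u l) z * ck q (u l z)) = 0.
  move=> oq; rewrite IG; have := hv q oq; rewrite /w => -[[-> ->]|[-> ->]] //.
  by rewrite !mulr0 addr0.
have ann g : holo Omega g -> Iint G g = 0.
  exact: (annihilator wG eG cK0 K0O sGK (hu l) (@uO l) (@iu l) (@ru l) w0).
(* The kernel at a point of [F1] has period [tpi] along [G1] and 0 along [G2]. *)
have a0 : a = 0.
  have := ann _ (holo_inv_sub (FO1 _ Fa1)); rewrite IG G1F// G2n ?mulr0 ?addr0.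
  - by move=> /eqP; rewrite mulf_eq0 (negbTE tpi_neq0) orbF => /eqP.
  - exact: FO1.
  - exact: F12.
have b0 : b = 0.
  have := ann _ (holo_inv_sub (FO2 _ Fa2)); rewrite IG G2F// G1n ?mulr0 ?add0r.
  - by move=> /eqP; rewrite mulf_eq0 (negbTE tpi_neq0) orbF => /eqP.
  - exact: FO2.
  - by move=> /F12.
by move: ab0; rewrite a0 b0 eqxx.
Qed.

Lemma infinitely_connected_transitive : infinitely_connected Omega -> transitive_maps Omega u.
Proof.
move=> /infinitely_connected_pieces[A1 [A2 [[x1 Ax1] [x2 Ax2] A12 [N1 N2] [oA1 cA1 oA2 cA2]]]].
have AW1 : A1 `<=` outside by have [ O _ ->] := oA1; exact: subIsetl.
have AW2 : A2 `<=` outside by have [ O _ ->] := oA2; exact: subIsetl.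
have [c1 F1 o1] := clopen_piece AW1 N1 oA1 cA1.
have [c2 F2 o2] := clopen_piece AW2 N2 oA2 cA2.
apply: (pieces_transitive c1 c2) => //.
- by case: x1 Ax1 => // a Aa; exists a.
- by case: x2 Ax2 => // a Aa; exists a.
- by move=> a Aa1 Aa2; have : (A1 `&` A2) (Some a) by []; rewrite A12.
Qed.

End Pieces.

End Cases.

(** * From transitivity to a universal function *)

Section Birkhoff.
Context {R : realType}.
Local Notation C := (plane R).
Variable Omega : set C.
Hypothesis oO : open Omega.
Implicit Types (z w p : C) (K : set C) (f g h : C -> C).

Definition exhaust (j : nat) : set C := inner Omega j%:R (j.+1%:R)^-1.

Lemma exhaust_compact j : compact (exhaust j).
Proof. exact: inner_compact. Qed.

Lemma exhaust_sub j : exhaust j `<=` Omega.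
Proof. by apply: inner_sub; rewrite invr_gt0. Qed.

Lemma exhaustS i j : (i <= j)%N -> exhaust i `<=` exhaust j.
Proof.
move=> ij z [zi hz]; split; first by rewrite (le_trans zi)// ler_nat.
by move=> a /hz; apply: le_trans; rewrite lef_pV2 ?posrE// ler_nat.
Qed.

Lemma exhaust_cofinal K : compact K -> K `<=` Omega -> exists j, K `<=` exhaust j.
Proof.
move=> cK KO; have [M M0 hM] := compact_bounded_plane cK.
have [d d0 hd] := compact_open_nbhd cK oO KO.
have n1 := truncnS_gt M; have n2 := truncnS_gt d^-1.
exists (maxn (Num.truncn M).+1 (Num.truncn d^-1).+1) => z Kz; split.
  by rewrite (le_trans (hM _ Kz))// (le_trans (ltW n1))// ler_nat leq_maxl.
move=> a na; rewrite leNgt; apply/negP => az; apply: na; apply: (hd z a Kz).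
rewrite (lt_le_trans az)// -[leRHS]invrK lef_pV2 ?posrE ?invr_gt0//.
by rewrite (le_trans (ltW n2))// ler_nat leqW// leq_maxr.
Qed.

Lemma uniform_continuity K f (e : R) : compact K -> (forall z, K z -> ccont f z) -> 0 < e ->
  exists2 d : R, 0 < d & forall z w, K z -> K w -> nm (w - z) < d -> nm (f w - f z) < e.
Proof.
move=> cK cf e0; have e20 : 0 < e / 2 by rewrite divr_gt0.
have rP z : exists r : R, K z -> 0 < r /\ forall w, nm (w - z) < r + r -> nm (f w - f z) < e / 2.
  have [Kz|?] := pselect (K z); last by exists 0.
  have [r r0 hr] := cf _ Kz _ e20; exists (r / 2) => _; split; first by rewrite divr_gt0.
  by move=> w wz; apply: hr; lra.
have [r rE] := choice rP.
have [s sK Ks] := compact_ball_cover cK (fun z Kz => proj1 (rE z Kz)).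
have [|d d0 hd] := @seq_min_pos R _ s r; first by move=> z /sK/rE[].
exists d => // z w Kz Kw wz; have [c cs zc] := Ks _ Kz; have [rc0 hc] := rE c (sK _ cs).
have h1 := hc z ltac:(lra); have h2 := hc w.
have := nm_triangle z w c; have := hd _ cs; move=> h3 h4.
have := nm_triangle (f c) (f w) (f z); rewrite (nmB (f c)); have := h2 ltac:(lra); lra.
Qed.

Lemma rat_dense z (e : R) : 0 < e -> exists q : rat * rat, nm (z - mk (ratr q.1) (ratr q.2)) < e.
Proof.
move=> e0; have [a] := @rat_in_itvoo R (re z - e / 2) (re z) ltac:(lra).
have [b] := @rat_in_itvoo R (im z - e / 2) (im z) ltac:(lra).
rewrite !in_itv /= => /andP[b1 b2] /andP[a1 a2]; exists (a, b).
rewrite (le_lt_trans (nm_le_reim _))// reD reN imD imN re_mk im_mk.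
by rewrite !gtr0_norm /=; lra.
Qed.

Lemma countable_dense : exists gs : nat -> C -> C, (forall i, holo Omega (gs i)) /\
  forall g j (e : R), holo Omega g -> 0 < e -> exists i, forall z, exhaust j z ->
    nm (gs i z - g z) <= e.
Proof.
have netP (jn : nat * nat) : exists s : seq C, (forall z, z \in s -> exhaust jn.1 z) /\
    forall w, exhaust jn.1 w -> exists2 z, z \in s & nm (w - z) < (jn.2.+1%:R)^-1.
  have [|s s1 s2] := @compact_ball_cover R _ (fun=> (jn.2.+1%:R)^-1) (@exhaust_compact jn.1).
    by move=> z _; rewrite invr_gt0.
  by exists s.
have [net netE] := choice netP.
(* The code [((j, n), (N, v))] prescribes the values [v], up to [1 / (N + 1)], near the points
   of a net of mesh [1 / (n + 1)] of [exhaust j]. *)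
pose near (c : nat * nat * (nat * seq (rat * rat))) : set (C -> C) :=
  [set g | holo Omega g /\ forall z i, exhaust c.1.1 z -> (i < size (net c.1))%N ->
    nm (z - nth 0 (net c.1) i) < (c.1.2.+1%:R)^-1 ->
    nm (g z - mk (ratr (nth (0, 0) c.2.2 i).1) (ratr (nth (0, 0) c.2.2 i).2)) <=
      (c.2.1.+1%:R)^-1].
(* One function is kept for each prescription that can be met, and 0 otherwise. The choice is
   harmless: on [exhaust j] all functions meeting a prescription agree up to [2 / (N + 1)]. *)
pose gs k : C -> C := if unpickle k is Some c then
  (if pselect (near c !=set0) is left h then projT1 (cid h) else fun=> 0) else fun=> 0.
exists gs; split.
  move=> i; rewrite /gs; case: unpickle => [c|]; last exact: holo_cst.
  case: pselect => [h|_]; last exact: holo_cst.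
  by case: (cid h) => g [].
move=> g j e hg e0.
have small (d : R) : 0 < d -> exists n : nat, (0 : R) < (n.+1%:R)^-1 <= d.
  move=> d0; exists (Num.truncn d^-1).+1; rewrite invr_gt0 ltr0Sn/=.
  rewrite -[leRHS]invrK lef_pV2 ?posrE ?invr_gt0// (le_trans (ltW (truncnS_gt _)))//.
  by rewrite ler_nat.
have e20 : 0 < e / 2 by rewrite divr_gt0.
have [N /andP[N0 Ne]] := small _ e20; set t := _^-1 in N0 Ne.
have t20 : 0 < t / 2 by rewrite divr_gt0.
have [d d0 hd] := uniform_continuity (@exhaust_compact j)
  (fun z hz => holo_ccont hg (exhaust_sub hz)) t20.
have [n /andP[n0 nd]] := small _ d0.
have [netK netC] := netE (j, n).
have [q qE] := choice (fun i => rat_dense (g (nth 0 (net (j, n)) i)) t20).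
pose m := size (net (j, n)); pose c := ((j, n), (N, mkseq q m)).
have nc : near c !=set0.
  exists g; split => // z i jz im zi; rewrite nth_mkseq//.
  have ji := netK _ (mem_nth 0 im).
  have h1 := hd (nth 0 (net (j, n)) i) z ji jz (lt_le_trans zi nd).
  rewrite (le_trans (nm_triangle (g (nth 0 (net (j, n)) i)) _ _))//.
  by rewrite -/t [t]splitr lerD ?(ltW h1)//; apply: ltW; exact: qE.
exists (pickle c) => z jz; rewrite /gs pickleK; case: pselect => // h; case: (cid h) => f /= [_ hf].
have [_ /(nthP 0)[i im <-] zi] := netC _ jz.
have h1 := hf z i jz im zi; have ji := netK _ (mem_nth 0 im).
have h2 := hd (nth 0 (net (j, n)) i) z ji jz (lt_le_trans zi nd).
have h3 := qE i; rewrite /= nth_mkseq// -/t in h1.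
have h4 := nm_triangle (mk (ratr (q i).1) (ratr (q i).2)) (f z) (g z).
have h5 := nm_triangle (g (nth 0 (net (j, n)) i)) (mk (ratr (q i).1) (ratr (q i).2)) (g z).
rewrite (nmB _ (g (nth _ _ _))) (nmB (g (nth _ _ _)) (g z)) in h5.
move: h1 h2 h3 h4 h5 Ne; clear; lra.
Qed.

Lemma injective_unbounded (t : nat -> nat) B : injective t -> exists m, (B <= t m)%N.
Proof.
move=> ti; apply: contrapT => h.
have lt m : (t m < B)%N by rewrite ltnNge; apply/negP => Bm; apply: h; exists m.
have : (#|'I_B.+1| <= #|'I_B|)%N.
  apply: (@leq_card _ _ (fun i : 'I_B.+1 => Ordinal (lt i))) => x y [/ti xy].
  exact: val_inj.
by rewrite !card_ord ltnn.
Qed.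

(** The sequences [y] and [z] are monotone and enclose the limit; their factor 2 is the sum of the
    geometric series of ratio 1/2. *)
Lemma geometric_cauchy (x : nat -> R) N :
  (forall k, (N <= k)%N -> `|x k.+1 - x k| <= (1 / 2) ^+ k) ->
  exists L, forall k, (N <= k)%N -> `|L - x k| <= 2 * (1 / 2) ^+ k.
Proof.
move=> hx; pose y k := x k - 2 * (1 / 2) ^+ k; pose z k := x k + 2 * (1 / 2) ^+ k.
have pS k : (1 / 2) ^+ k.+1 = (1 / 2) ^+ k / 2 :> R by rewrite exprS; lra.
have p0 k : 0 < (1 / 2) ^+ k :> R by rewrite exprn_gt0//; lra.
have mono k i : (N <= k)%N -> y k <= y (k + i)%N /\ z (k + i)%N <= z k.
  move=> Nk; elim: i => [|i [h1 h2]]; first by rewrite addn0.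
  have := hx (k + i)%N (leq_trans Nk (leq_addr _ _)); rewrite addnS ler_norml => /andP[h3 h4].
  by move: h1 h2; rewrite /y /z pS; have := p0 (k + i)%N => *; split; lra.
have yz k m : (N <= k)%N -> (N <= m)%N -> y k <= z m.
  move=> Nk Nm; have yzn n : y n <= z n by rewrite /y /z; have := p0 n; lra.
  have [h1 _] := mono k m Nk; have [_ h2] := mono m k Nm.
  by rewrite (le_trans h1)// (le_trans (yzn _))// addnC.
pose A := [set y k | k in [set k | (N <= k)%N]].
have A0 : A !=set0 by exists (y N), N => //=.
exists (sup A) => k Nk.
have h1 : y k <= sup A.
  apply: ub_le_sup; last by exists k.
  by exists (z N) => _ [m Nm <-]; exact: yz.
have h2 : sup A <= z k by apply: ge_sup => // _ [m Nm <-]; exact: yz.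
by move: h1 h2; rewrite /y /z ler_norml => *; apply/andP; split; lra.
Qed.

Lemma geometric_cauchy_plane (x : nat -> C) N :
  (forall k, (N <= k)%N -> nm (x k.+1 - x k) <= (1 / 2) ^+ k) ->
  exists L, forall k, (N <= k)%N -> nm (L - x k) <= 4 * (1 / 2) ^+ k.
Proof.
move=> hx.
have [|L1 h1] := @geometric_cauchy (fun k => re (x k)) N.
  by move=> k /hx; apply: le_trans; rewrite -reN -reD re_le_nm.
have [|L2 h2] := @geometric_cauchy (fun k => im (x k)) N.
  by move=> k /hx; apply: le_trans; rewrite -imN -imD im_le_nm.
exists (mk L1 L2) => k Nk; rewrite (le_trans (nm_le_reim _))// reD reN imD imN.
by have := h1 _ Nk; have := h2 _ Nk; rewrite /=; lra.
Qed.

Lemma half_small (M e : R) : 0 < e -> exists n, forall k, (n <= k)%N -> M * (1 / 2) ^+ k <= e.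
Proof.
move=> e0; have [n hn] := exp2_small (Num.max M 0) e0; exists n => k nk.
have M0 : 0 <= Num.max M 0 by rewrite le_max lexx orbT.
apply: le_trans (ltW hn); rewrite (@le_trans _ _ (Num.max M 0 * (1 / 2) ^+ k))//.
  by rewrite ler_wpM2r ?exprn_ge0 ?le_max ?lexx//; lra.
rewrite ler_wpM2l// div1r exprVn lef_pV2 ?posrE ?exprn_gt0//.
by rewrite ler_weXn2l// ler1n.
Qed.

Definition universal_maps (u : nat -> C -> C) := exists2 h, holo Omega h &
  forall g K (e : R), holo Omega g -> compact K -> K `<=` Omega -> 0 < e ->
  exists l, forall z, K z -> nm (h (u l z) - g z) <= e.

(** The Baire argument made explicit: stage k changes the current function by at most [(1 / 2) ^+ k]
    on a large set and makes its composition with some [u l] hit target k. Later changes are small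
    on the image of [exhaust k] under [u l], so the hit persists in the limit. *)
Lemma transitive_universal (u : nat -> C -> C) : (forall l, holo Omega (u l)) ->
  (forall l z, Omega z -> Omega (u l z)) -> transitive_maps Omega u -> universal_maps u.
Proof.
move=> hu uO tr; have [gs [hgs dgs]] := countable_dense.
pose tgt k := if unpickle k is Some mi then gs (mi : nat * nat).2 else fun=> 0.
have htgt k : holo Omega (tgt k) by rewrite /tgt; case: unpickle => [mi|]; [exact: hgs|exact: holo_cst].
have h20 k : (0 : R) < (1 / 2) ^+ k by rewrite exprn_gt0//; lra.
have stepP (khM : nat * ((C -> C) * nat)) : exists hM' : (C -> C) * nat,
    holo Omega khM.2.1 -> [/\ holo Omega hM'.1, (khM.2.2 <= hM'.2)%N, (khM.1 < hM'.2)%N,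
     forall z, exhaust khM.2.2 z -> nm (hM'.1 z - khM.2.1 z) <= (1 / 2) ^+ khM.1 &
     exists l, forall z, exhaust khM.1 z -> exhaust hM'.2 (u l z) /\
       nm (hM'.1 (u l z) - tgt khM.1 z) <= (1 / 2) ^+ khM.1].
  case: khM => k [h M] /=; have [hh|?] := pselect (holo Omega h); last by exists (h, M).
  pose m := maxn k M; have [h' hh' [l [e1 e2']]] := tr h (tgt k) (exhaust m) _ hh (htgt k)
    (@exhaust_compact m) (@exhaust_sub m) (h20 k).
  have cI' : compact (u l @` exhaust k).
    by apply: (image_compact _ (@exhaust_sub k) (hu l)); exact: exhaust_compact.
  have [j hj] := exhaust_cofinal cI' ltac:(by move=> _ [z /exhaust_sub/uO Oz <-]).
  (* The new level also covers the image of [exhaust k], where later changes have to stay small. *)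
  exists (h', maxn (maxn M k.+1) j) => _; split => //=.
  - by rewrite -maxnA leq_maxl.
  - by rewrite !leq_max ltnSn orbT.
  - by move=> z Mz; apply: e1; apply: exhaustS Mz; exact: leq_maxr.
  - exists l => z kz; split.
      by apply: (exhaustS (leq_maxr _ _)); apply: hj; exists z.
    by apply: e2'; apply: exhaustS kz; exact: leq_maxl.
have [step stepE] := choice stepP.
pose fix st k : (C -> C) * nat := if k is k'.+1 then step (k', st k') else (fun=> 0, 0%N).
have hst k : holo Omega (st k).1.
  by elim: k => [|k IH]; [exact: holo_cst|case: (stepE (k, st k) IH)].
have stM k : ((st k).2 <= (st k.+1).2)%N by case: (stepE (k, st k) (hst k)).
have stk k : (k <= (st k).2)%N by case: k => // k; case: (stepE (k, st k) (hst k)).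
have stmono k i : ((st k).2 <= (st (k + i)%N).2)%N.
  by elim: i => [|i IH]; rewrite ?addn0// addnS (leq_trans IH)//; exact: stM.
have stmono' k m : (k <= m)%N -> ((st k).2 <= (st m).2)%N by move=> /subnKC <-.
have std k z : exhaust (st k).2 z -> nm ((st k.+1).1 z - (st k).1 z) <= (1 / 2) ^+ k.
  by move=> kz; case: (stepE (k, st k) (hst k)) => _ _ _ /(_ z kz).
have limP z : exists L, forall N, exhaust (st N).2 z -> forall k, (N <= k)%N ->
    nm (L - (st k).1 z) <= 4 * (1 / 2) ^+ k.
  have [[N Nz]|nz] := pselect (exists N, exhaust (st N).2 z); last first.
    by exists 0 => N Nz; exfalso; apply: nz; exists N.
  have ex : exists n, `[< exhaust (st n).2 z >] by exists N; apply/asboolP.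
  case: (ex_minnP ex) => N0 /asboolP N0z N0min.
  have [|L hL] := @geometric_cauchy_plane (fun k => (st k).1 z) N0.
    by move=> k Nk; apply: std; apply: exhaustS N0z; exact: stmono'.
  by exists L => n nz k nk; apply: hL; apply: leq_trans nk; apply: N0min; apply/asboolP.
have [h hE] := choice limP.
have hh : holo Omega h.
  apply: weierstrass => // K cK KO e e0; have [j hj] := exhaust_cofinal cK KO.
  have [n hn] := half_small 4 e0; exists (st (maxn j n)).1 => // z /hj jz.
  rewrite (le_trans (hE z (maxn j n) _ _ (leqnn _)))// ?hn ?leq_maxr//.
  by apply: exhaustS jz; apply: leq_trans (stk _); exact: leq_maxl.
exists h => // g K e hg cK KO e0; have [j hj] := exhaust_cofinal cK KO.
have e20 : 0 < e / 2 by lra.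
have [i hi] := dgs g j (e / 2) hg e20; have [n hn] := half_small 5 e20.
(* The component [m] makes every target recur at arbitrarily late stages. *)
have [|m hm] := @injective_unbounded (fun m => pickle (m, i)) (maxn j n).
  by move=> x y /(pcan_inj pickleK)[].
set k := pickle (m, i) in hm; have [_ _ _ _ [l hl]] := stepE (k, st k) (hst k).
exists l => z Kz; have jk : (j <= k)%N by rewrite (leq_trans _ hm)// leq_maxl.
have [h1 h3] := hl z (exhaustS jk (hj _ Kz)).
have h4 := hE _ k.+1 h1 _ (leqnn _).
have tE : tgt k = gs i by rewrite /tgt /k pickleK.
rewrite /= tE in h3; have h5 := hi _ (hj _ Kz).
have h6 := hn k ltac:(by rewrite (leq_trans _ hm)// leq_maxr).
have := nm_triangle ((st k.+1).1 (u l z)) (h (u l z)) (g z).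
have := nm_triangle (gs i z) ((st k.+1).1 (u l z)) (g z).
rewrite exprS in h4; rewrite /= in h4 *; lra.
Qed.

End Birkhoff.

(** * Run-away property of hypercyclic symbols *)

Section Exponential.
Context {R : realType}.
Local Notation C := (plane R).
Implicit Types (z w : C).

Definition cexp z : C := rc (expR (re z)) * mk (cos (im z)) (sin (im z)).

Lemma nm_cexp z : nm (cexp z) = expR (re z).
Proof.
rewrite /cexp nmM nm_rc ger0_norm ?expR_ge0// -[RHS]mulr1; congr (_ * _).
by apply/eqP; rewrite -sqrp_eq1 ?nm_ge0// nm_sqr re_mk im_mk cos2Dsin2.
Qed.

Lemma cexpD z w : cexp (z + w) = cexp z * cexp w.
Proof.
rewrite /cexp reD imD expRD cosD sinD rcM !mkE !(rcD, rcB, rcM, rcN).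
have := @cI_sqr R; set i := cI => ii.
rewrite [RHS](_ : _ = rc (expR (re z)) * rc (expR (re w)) *
  (rc (cos (im z)) * rc (cos (im w)) + i * i * (rc (sin (im z)) * rc (sin (im w))) +
   i * (rc (sin (im z)) * rc (cos (im w)) + rc (cos (im z)) * rc (sin (im w))))); last by ring.
by rewrite ii mulN1r.
Qed.

Lemma cexp0 : cexp 0 = 1.
Proof. by rewrite /cexp re0 im0 expR0 cos0 sin0 mul1r mkE rc0 mulr0 addr0. Qed.

Lemma cexp_period z : cexp (z + mk 0 (pi *+ 2)) = cexp z.
Proof.
by rewrite cexpD {2}/cexp re_mk im_mk expR0 cos2pi sin2pi mul1r mkE rc0 mulr0 addr0 mulr1.
Qed.

Lemma hasd_cexp0 : hasd cexp 0 1.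
Proof.
(* The factor 9 adds up 1 from [A], 2 from [B] and 6 from a product of factors of size at most
   [2 * nm w] and [3 * nm w]. *)
move=> e e0; pose h := Num.min 1 (e / 9).
have h0 : 0 < h by rewrite lt_min ltr01 divr_gt0.
have h1 : h <= 1 by rewrite ge_min lexx.
have he : h <= e / 9 by rewrite ge_min lexx orbT.
clearbody h.
have [r1 r10 e1] := is_derive_real_eps (is_derive_expR (0 : R)) h0.
have [r2 r20 e2] := is_derive_real_eps (is_derive_cos (0 : R)) h0.
have [r3 r30 e3] := is_derive_real_eps (is_derive_sin (0 : R)) h0.
exists (Num.min h (Num.min r1 (Num.min r2 r3))); first by rewrite !lt_min h0 r10 r20 r30.
move=> w; rewrite !subr0 cexp0 mul1r !lt_min => /andP[wh /andP[w1 /andP[w2 w3]]].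
have rw := re_le_nm w; have iw := im_le_nm w.
have a1 := e1 (re w); rewrite !subr0 expR0 mul1r in a1.
have a2 := e2 (im w); rewrite !subr0 cos0 sin0 oppr0 mul0r subr0 in a2.
have a3 := e3 (im w); rewrite !subr0 cos0 sin0 mul1r !subr0 in a3.
have {a1}a1 := a1 (le_lt_trans rw w1); have {a2}a2 := a2 (le_lt_trans iw w2).
have {a3}a3 := a3 (le_lt_trans iw w3).
pose A : C := rc (expR (re w) - 1 - re w).
pose B : C := mk (cos (im w) - 1) (sin (im w) - im w).
have nA : nm A <= h * nm w.
  by rewrite /A nm_rc (le_trans a1)// ler_wpM2l// ltW.
have nB : nm B <= 2 * h * nm w.
  rewrite (le_trans (nm_le_reim _))// /B re_mk im_mk.
  have := ler_wpM2l (ltW h0) iw; lra.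
have wE : w = rc (re w) + cI * rc (im w) by rewrite -mkE mk_re_im.
rewrite (_ : _ - _ = A + B + (rc (re w) + A) * (cI * rc (im w) + B)); last first.
  rewrite /cexp {4}wE /A /B !mkE !rcB rc1; ring.
have nr : nm (rc (re w)) <= nm w by rewrite nm_rc.
have ni : nm (cI * rc (im w)) <= nm w by rewrite nmM nm_cI mul1r nm_rc.
rewrite (le_trans (nmD _ _))//.
have h3 := nmD A B.
have n0 := nm_ge0 w.
have hw : h * nm w <= nm w by rewrite ler_piMl.
have h4 : nm ((rc (re w) + A) * (cI * rc (im w) + B)) <= (2 * nm w) * (3 * nm w).
  by rewrite nmM ler_pM ?nm_ge0// (le_trans (nmD _ _))//; clear -nr ni nA nB hw; lra.
have h5 : nm w * nm w <= h * nm w by rewrite ler_wpM2r// ltW.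
have h6 : h * nm w <= e / 9 * nm w by rewrite ler_wpM2r.
have h7 : (2 * nm w) * (3 * nm w) = 6 * (nm w * nm w) by ring.
have h8 : e / 9 * nm w = e * nm w / 9 by ring.
clear -h3 h4 h5 h6 h7 h8 nA nB; lra.
Qed.

Lemma hasd_cexp z : hasd cexp z (cexp z).
Proof.
have h0 : hasd cexp (z - z) 1 by rewrite subrr; exact: hasd_cexp0.
have h1 : hasd (fun w => w - z) z 1.
  by apply: hasd_eq; first exact: hasdB (hasd_id z) (hasd_cst z z); rewrite subr0.
have := hasdMl (cexp z) (hasd_comp h1 h0); rewrite !mulr1 => h.
apply: (hasd_near h); exists 1 => // w _.
by rewrite -cexpD addrC subrK.
Qed.

(** [h] is a primitive of the logarithmic derivative, and [g] times [cexp (- h)] has derivative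
    zero. *)
Lemma local_log (g : C -> C) (x : C) (r : R) : 0 < r -> holo (oball x r) g ->
  (forall z, oball x r z -> g z != 0) ->
  exists h, (forall z, oball x (r / 3) z -> hasd h z (der g z / g z)) /\
    forall z, oball x (r / 3) z -> g z = g x * cexp (h z - h x).
Proof.
move=> r0 hg g0; have hdg := holo_der (@oball_open R x r) hg.
have hq : holo (oball x r) (fun z => der g z / g z) by apply: holoM => //; exact: holoV.
have [h dh] := ball_primitive r0 (fun z zr => holo_ccont hq zr)
  (fun a b c d ab cd rU => goursat ab cd (holo_sub rU hq)).
exists h; split => // z zr.
have sub w : oball x (r / 3) w -> oball x r w.
  by rewrite /oball /= => wr; rewrite (lt_le_trans wr)// ler_pdivrMr// ler_peMr ?(ltW r0)//; lra.
pose F w := g w * cexp (h x - h w).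
have dF w : oball x (r / 3) w -> hasd F w 0.
  move=> wr; have g0w := g0 _ (sub _ wr).
  have dd : hasd (fun w => h x - h w) w (0 - der g w / g w).
    by apply: hasdB; [exact: hasd_cst|exact: dh].
  apply: hasd_eq; first exact: hasdM (derP hg (sub _ wr)) (hasd_comp dd (hasd_cexp _)).
  by rewrite /=; move: (cexp _) => E; field.
have : nm (F z - F x) <= 0 * nm (z - x).
  apply: (@mean_value_seg R F (fun=> 0)) => t /andP[t0 t1]; split; last by rewrite nm0.
  apply: dF; rewrite /oball /= addrC addKr nmM nm_rc ger0_norm//.
  move: zr; rewrite /oball /= => zr.
  by rewrite (le_lt_trans _ zr)// ler_piMl ?nm_ge0.
rewrite mul0r => F0; have {F0} : F z - F x == 0 by rewrite -nm_eq0 eq_le F0 nm_ge0.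
rewrite subr_eq0 /F subrr cexp0 mulr1 => /eqP <-.
rewrite -mulrA -cexpD (_ : _ + _ = 0) ?cexp0 ?mulr1//; ring.
Qed.

(** At a near-maximum [z0] of the weighted derivative, [der h] is at most [4 * m] on a disc of
    radius [p], so by Cauchy's estimate it varies by at most [m / 2] on the disc of radius [t].
    There [h] is nearly affine and covers a disc of radius [m * t / 4]. *)
Lemma bloch : exists2 k : R, 0 < k & forall h (V : set C) x (r : R), 0 < r -> open V ->
  holo V h -> cball x r `<=` V -> exists z0, cball x r z0 /\
    forall w, nm (w - h z0) < k * r * nm (der h x) -> exists2 z, cball x r z & h z = w.
Proof.
(* With [t = p / N], the term [16 * c] bounds the variation of the derivative by [m / 2] and the
   term 2 gives [t <= p / 2]. The final radius [m * t / 4] is [phi z0 / (8 * N)], and [phi z0] is at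
   least half of [r * nm (der h x)], whence 16. *)
have [c c0 hc] := @cauchy_estimate R; pose N := 16 * c + 2.
have N0 : 0 < N by rewrite /N; lra.
exists (1 / (16 * N)); first by rewrite divr_gt0// mulr_gt0.
move=> h V x r r0 oV hh xV.
have xx : cball x r x by rewrite /cball /= subrr nm0 ltW.
have [d0|dx] := eqVneq (der h x) 0.
  by exists x; split => // w; rewrite d0 nm0 mulr0 ltNge nm_ge0.
have hd := holo_der oV hh.
have [M M0 hM] := compact_cont_bound (@cball_compact R x r) (fun z zr => holo_ccont hd (xV _ zr)).
(* [z0] is chosen to maximize [phi] up to a factor 2. *)
pose phi z := (r - nm (z - x)) * nm (der h z).
pose A := [set phi z | z in cball x r].
have hA : has_sup A.
  split; first by exists (phi x), x.
  exists (r * M) => _ [z zr <-]; rewrite /phi ler_pM ?nm_ge0//; last exact: hM.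
    by rewrite subr_ge0.
  by rewrite lerBlDr lerDl nm_ge0.
have Sx : r * nm (der h x) <= sup A.
  by apply: ub_le_sup; [case: hA|exists x => //; rewrite /phi subrr nm0 subr0].
have n0 : 0 < nm (der h x) by rewrite nm_gt0.
have S0 : 0 < sup A by rewrite (lt_le_trans _ Sx)// mulr_gt0.
have [|_ [z0 z0r <-] hz0] := sup_adherent (_ : 0 < sup A / 2) hA; first by rewrite divr_gt0.
have phiS z : cball x r z -> phi z <= sup A.
  by move=> zr; apply: ub_le_sup; [case: hA|exists z].
set S := sup A in Sx S0 hz0 phiS.
have phi0 : 0 < phi z0 by clear -hz0 S0; lra.
pose p := (r - nm (z0 - x)) / 2; pose m := nm (der h z0).
have m0 : 0 <= m by exact: nm_ge0.
have phiE : phi z0 = 2 * p * m by rewrite /phi /p /m; field.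
have p0 : 0 < p.
  rewrite ltNge; apply/negP => p0; move: phi0; rewrite phiE ltNge => /negP; apply.
  by rewrite -mulrA pmulr_rle0// mulr_le0_ge0.
have pV z : nm (z - z0) < p -> cball x r z /\ p <= r - nm (z - x).
  have := z0r; rewrite /cball /= /p => zx zp; have := nm_triangle z0 z x; clear -zx zp; split; lra.
have b1 z : oball z0 p z -> nm (der h z) <= 4 * m.
  move=> /pV[zr zp]; rewrite -(ler_pM2l p0).
  have : p * nm (der h z) <= phi z by rewrite /phi ler_wpM2r ?nm_ge0.
  have := phiS _ zr; have : p * (4 * m) = 2 * phi z0 by rewrite phiE; ring.
  clear -hz0; lra.
have p20 : 0 < p / 2 by rewrite divr_gt0.
have b2 z : nm (z - z0) <= p / 2 -> nm (der (der h) z) <= 8 * c * m / p.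
  move=> zp; have sub w : oball z (p / 2) w -> oball z0 p w.
    by rewrite /oball /= => wz; have := nm_triangle z w z0; clear -wz zp; lra.
  have := hc (der h) z (p / 2) (4 * m) p20 _ (fun w wz => b1 _ (sub _ wz)).
  rewrite (_ : c * (4 * m) / (p / 2) = 8 * c * m / p); last by field; rewrite gt_eqF.
  by apply; apply: holo_sub hd => w /sub/pV[/xV].
pose t := p / N; have t0 : 0 < t by rewrite divr_gt0.
have tN : t * N = p by rewrite /t divfK// gt_eqF.
have t2 : t <= p / 2.
  rewrite -tN /N; have := mulr_gt0 t0 c0; nra.
have b3 z : nm (z - z0) <= t -> nm (der h z - der h z0) <= m / 2.
  move=> zt; apply: (@le_trans _ _ (8 * c * m / p * t)); last first.
    rewrite -tN (_ : 8 * c * m / (t * N) * t = m * (8 * c / N)); last by field; rewrite !gt_eqF.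
    by rewrite ler_wpM2l// ler_pdivrMr// /N; lra.
  apply: (@le_trans _ _ (8 * c * m / p * nm (z - z0))); last first.
    by rewrite ler_wpM2l// !mulr_ge0 ?invr_ge0// ltW.
  apply: (@mean_value_seg R (der h) (der (der h))) => s /andP[s0 s1].
  have sz : nm (z0 + rc s * (z - z0) - z0) <= p / 2.
    rewrite addrC addKr nmM nm_rc ger0_norm//.
    by rewrite (le_trans _ (le_trans zt t2))// ler_piMl ?nm_ge0.
  split; last exact: b2.
  by apply: (derP hd); apply: xV; have [] := pV (z0 + rc s * (z - z0)); [clear -sz p20; lra|].
have b4 z : nm (z - z0) <= t -> nm (h z - h z0 - der h z0 * (z - z0)) <= m / 2 * nm (z - z0).
  move=> zt; pose F w := h w - der h z0 * (w - z0).
  rewrite (_ : _ - _ = F z - F z0); last by rewrite /F; ring.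
  apply: (@mean_value_seg R F (fun w => der h w - der h z0)) => s /andP[s0 s1].
  have sz : nm (z0 + rc s * (z - z0) - z0) <= t.
    rewrite addrC addKr nmM nm_rc ger0_norm//.
    by rewrite (le_trans _ zt)// ler_piMl ?nm_ge0.
  split; last exact: b3.
  have [sr _] := pV (z0 + rc s * (z - z0)) ltac:(clear -sz t2 p20; lra).
  apply: hasdB; first exact: (derP hh (xV _ sr)).
  apply: hasd_eq; first exact: hasdMl _ (hasdB (hasd_id _) (hasd_cst z0 _)).
  by rewrite subr0 mulr1.
have d0 : 0 < m * t / 4.
  rewrite divr_gt0// mulr_gt0// lt_neqAle m0 andbT; apply/eqP => m00.
  by move: phi0; rewrite phiE -m00 mulr0 ltxx.
have sub z : nm (z - z0) <= t -> cball x r z.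
  by move=> zt; have [] := pV z; [clear -zt t2 p20; lra|].
exists z0; split => // w wz.
have [|||z zt zw] := @min_modulus R V h z0 w t (m * t / 4) t0 d0 hh _ _ _.
- by move=> z /sub/xV.
- move=> z zt; have := b4 z; rewrite zt => /(_ (lexx _)).
  have := nmD (h z - h z0) (- (h z - h z0 - der h z0 * (z - z0))).
  rewrite nmN (_ : h z - h z0 + _ = der h z0 * (z - z0)); last by ring.
  rewrite nmM zt -/m; clear; lra.
- apply: lt_le_trans wz _.
  rewrite (_ : m * t / 4 = 1 / (8 * N) * phi z0); last first.
    by rewrite phiE /t; field; rewrite gt_eqF.
  apply: (@le_trans _ _ (1 / (16 * N) * S)); first by rewrite -mulrA ler_wpM2l// ltW// divr_gt0// mulr_gt0.
  rewrite (_ : 1 / (16 * N) * S = 1 / (8 * N) * (S / 2)); last by field; rewrite gt_eqF.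
  by rewrite ler_wpM2l ?(ltW hz0)//; [rewrite ltW// divr_gt0// mulr_gt0|lra].
by exists z => //; apply: sub; exact: ltW.
Qed.

(* The image under [log g] of a disc contains no disc of radius [2 pi], since [g] is injective. *)
Lemma univalent_log_der : exists2 B : R, 0 < B & forall (g : C -> C) (x : C) (r : R), 0 < r ->
  holo (oball x r) g -> (forall z, oball x r z -> g z != 0) ->
  (forall z w, oball x r z -> oball x r w -> g z = g w -> z = w) ->
  nm (der g x / g x) <= B / r.
Proof.
have [k k0 hk] := bloch; have pi0 := pi_gt0 R.
(* If the bound failed, Bloch's theorem on the disc of radius [r / 6] would give a disc of radius
   [3 * pi], larger than the period. *)
exists (18 * pi / k); first by rewrite divr_gt0// mulr_gt0.
move=> g x r r0 hg g0 ig; have [h [dh hE]] := local_log r0 hg g0.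
have r60 : 0 < r / 6 by rewrite divr_gt0.
have sub : cball x (r / 6) `<=` oball x (r / 3) by move=> z; rewrite /cball /oball /=; lra.
have sub' : oball x (r / 3) `<=` oball x r by move=> z; rewrite /oball /=; lra.
have hh : holo (oball x (r / 3)) h by move=> z /dh; exists (der g z / g z).
have [z0 [z0r hz0]] := hk h _ x _ r60 (@oball_open R x (r / 3)) hh sub.
have xr : oball x (r / 3) x by apply: oball_center; rewrite divr_gt0.
rewrite -(derE (dh _ xr)) leNgt; apply/negP => big.
have [|z1 z1r hz1] := hz0 (h z0 + mk 0 (pi *+ 2)).
  rewrite addrC addKr; apply: (@lt_trans _ _ (3 * pi)).
    rewrite (le_lt_trans (nm_le_reim _))// re_mk im_mk normr0 add0r ger0_norm; last by lra.
    by rewrite mulr2n; lra.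
  rewrite (_ : 3 * pi = k * (r / 6) * (18 * pi / k / r)); last by field; rewrite !gt_eqF.
  by rewrite ltr_pM2l// mulr_gt0.
have g01 : g z1 = g z0.
  rewrite (hE _ (sub _ z1r)) (hE _ (sub _ z0r)) hz1; congr (_ * _).
  by rewrite addrAC cexp_period.
have z01 := ig _ _ (sub' _ (sub _ z1r)) (sub' _ (sub _ z0r)) g01.
move: hz1; rewrite z01 => /esym/eqP; rewrite -subr_eq0 addrC addKr => /eqP h0.
have : im (mk (0 : R) (pi *+ 2)) = 0 by rewrite h0 im0.
by rewrite im_mk mulr2n; lra.
Qed.

(** The logarithmic derivative is integrated along a segment, each point of which is the centre of a
    disc of radius [r / 2] inside the given one; hence the factor 2. *)
Lemma harnack : exists2 B : R, 0 < B & forall (g : C -> C) (x : C) (r : R), 0 < r ->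
  holo (oball x r) g -> (forall z, oball x r z -> g z != 0) ->
  (forall z w, oball x r z -> oball x r w -> g z = g w -> z = w) ->
  forall y, nm (y - x) <= r / 6 -> `|ln (nm (g y)) - ln (nm (g x))| <= B / r * nm (y - x).
Proof.
have [B B0 hB] := univalent_log_der; exists (2 * B); first by rewrite mulr_gt0.
move=> g x r r0 hg g0 ig y yr; have [h [dh hE]] := local_log r0 hg g0.
have yr3 : oball x (r / 3) y by rewrite /oball /=; lra.
have gx : g x != 0 by apply: g0; exact: oball_center.
rewrite (hE _ yr3) nmM nm_cexp lnM ?posrE ?expR_gt0 ?nm_gt0// expRK addrC addKr.
rewrite (le_trans (re_le_nm _))//.
apply: (@mean_value_seg R h (fun z => der g z / g z)) => t /andP[t0 t1].
have tr : nm (x + rc t * (y - x) - x) <= r / 6.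
  by rewrite addrC addKr nmM nm_rc ger0_norm// (le_trans _ yr)// ler_piMl ?nm_ge0.
split; first by apply: dh; rewrite /oball /=; lra.
set z := x + _ in tr *; have r20 : 0 < r / 2 by rewrite divr_gt0.
have sub w : oball z (r / 2) w -> oball x r w.
  by rewrite /oball /= => wz; have := nm_triangle z w x; lra.
rewrite (_ : 2 * B / r = B / (r / 2)); last by field; rewrite gt_eqF.
apply: hB => //; [exact: holo_sub hg|by move=> w /sub/g0|].
by move=> w w' /sub wr /sub w'r; exact: ig.
Qed.

End Exponential.

(** * A contracted distance and Calka's argument *)

Section RunAway.
Context {R : realType}.
Local Notation C := (plane R).
Variable Omega : set C.
Hypotheses (oO : open Omega) (coO : connected Omega).
Implicit Types (x y z w : C) (K : set C) (f g h : C -> C) (s t : R).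

(* A pseudodistance on [Omega], decreased by injective holomorphic self-maps, whose balls are
   relatively compact in [Omega] when [Omega] is not the plane. *)
Definition dle x y s := forall g, holo Omega g -> (forall z, Omega z -> g z != 0) ->
  (forall z w, Omega z -> Omega w -> g z = g w -> z = w) ->
  `|ln (nm (g x)) - ln (nm (g y))| <= s.

Lemma dle_refl x s : 0 <= s -> dle x x s.
Proof. by move=> s0 g _ _ _; rewrite subrr normr0. Qed.

Lemma dle_sym x y s : dle x y s -> dle y x s.
Proof. by move=> h g h1 h2 h3; rewrite distrC; exact: h. Qed.

Lemma dle_trans x y z s t : dle x y s -> dle y z t -> dle x z (s + t).
Proof.
move=> h h' g h1 h2 h3; have H1 := h g h1 h2 h3; have H2 := h' g h1 h2 h3.
rewrite (le_trans _ (lerD H1 H2))//.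
by rewrite (le_trans _ (ler_normD _ _))// addrA subrK.
Qed.

Lemma dle_le x y s t : s <= t -> dle x y s -> dle x y t.
Proof. by move=> st h g h1 h2 h3; rewrite (le_trans (h g h1 h2 h3)). Qed.

Lemma dle_near x (e : R) : Omega x -> 0 < e ->
  exists2 r : R, 0 < r & forall y, nm (y - x) < r -> Omega y /\ dle y x e.
Proof.
move=> Ox e0; have [B B0 hB] := @harnack R; have [r r0 rO] := open_cball oO Ox.
have rO' z : oball x r z -> Omega z by move=> zr; apply: rO; exact: ltW.
exists (Num.min (r / 6) (e * r / B)); first by rewrite lt_min !divr_gt0// mulr_gt0.
move=> y; rewrite lt_min => /andP[y1 y2]; split.
  by apply: rO'; rewrite /oball /=; lra.
move=> g h1 h2 h3; have := hB g x r r0 (holo_sub rO' h1) (fun z zr => h2 _ (rO' _ zr))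
  (fun z w zr wr => h3 _ _ (rO' _ zr) (rO' _ wr)) y (ltW y1).
move=> /le_trans; apply; rewrite mulrC mulrA ler_pdivrMr// -ler_pdivlMr//.
by rewrite ltW.
Qed.

Lemma dle_finite x y : Omega x -> Omega y -> exists s, dle y x s.
Proof.
move=> Ox Oy; pose A := [set y | Omega y /\ exists s, dle y x s].
suff AE : A = Omega by have [] : A y by rewrite AE.
apply: coO.
- by exists x; split => //; exists 0; exact: dle_refl.
- exists A; last by apply/seteqP; split => [z [] //|z [] //].
  apply/open_planeP => z [Oz [s hs]]; have [r r0 hr] := dle_near Oz ltr01.
  by exists r => // w /hr[Ow wz]; split => //; exists (1 + s); exact: dle_trans wz hs.
- exists (closure A); first exact: closed_closure.
  apply/seteqP; split => z.
    by move=> Az; split; [case: Az|exact: subset_closure].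
  move=> [Oz cz]; split => //; have [r r0 hr] := dle_near Oz ltr01.
  have [w [[Ow [s hs]] wz]] := cz [set w | nm (w - z) < r] ltac:(by apply/nbhs_planeP; exists r).
  have [_ wz'] := hr _ wz; exists (1 + s); apply: dle_trans hs; exact: dle_sym.
Qed.

Lemma dle_compact K x : Omega x -> compact K -> K `<=` Omega ->
  exists s, forall y, K y -> dle y x s.
Proof.
move=> Ox cK KO.
have rP z : exists rs : R * R, Omega z -> 0 < rs.1 /\ forall y, nm (y - z) < rs.1 -> dle y x rs.2.
  have [Oz|?] := pselect (Omega z); last by exists (0, 0).
  have [r r0 hr] := dle_near Oz ltr01; have [s hs] := dle_finite Ox Oz.
  by exists (r, 1 + s) => _; split => // y /hr[_ yz]; exact: dle_trans yz hs.
have [r rE] := choice rP.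
have [l lK Kl] := compact_ball_cover cK (fun z Kz => proj1 (rE z (KO _ Kz))).
have [M _ hM] := @seq_max_bound R _ l (fun z => (r z).2).
exists M => y /Kl[z zl yz]; apply: (@dle_le _ _ (r z).2); first exact: hM.
by have [_] := rE _ (KO _ (lK _ zl)); apply.
Qed.

(** The test functions [z - b], with [b] off [Omega], compare [nm (y - b)] and [nm (x - b)] up to
    the factor [expR s]: [a] gives boundedness, all [b] together a positive distance to the
    complement. *)
Lemma dle_bounded a x s : ~ Omega a -> Omega x ->
  exists Q, [/\ compact Q, Q `<=` Omega & forall y, Omega y -> dle y x s -> Q y].
Proof.
move=> na Ox; have [d d0 hd] : exists2 d : R, 0 < d & forall b, ~ Omega b -> d <= nm (x - b).
  have /open_planeP/(_ _ Ox)[d d0 hd] := oO; exists d => // b nb; rewrite leNgt nmB.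
  by apply/negP => /hd.
have key y b : Omega y -> ~ Omega b -> dle y x s ->
    expR (- s) * nm (x - b) <= nm (y - b) <= expR s * nm (x - b).
  move=> Oy nb h.
  have nz z : Omega z -> z - b != 0.
    by move=> Oz; rewrite subr_eq0; apply: contra_not_neq nb => <-.
  have := h (fun z => z - b) ltac:(by apply: holoB; [exact: holo_id|exact: holo_cst]) nz
    (fun z w _ _ => addIr _ (x1 := z) (x2 := w)).
  rewrite ler_norml => /andP[h1 h2].
  have px : 0 < nm (x - b) by rewrite nm_gt0 nz.
  have py : 0 < nm (y - b) by rewrite nm_gt0 nz.
  rewrite -{1}[nm (x - b)]lnK ?posrE// -{1 2}[nm (y - b)]lnK ?posrE// -{2}[nm (x - b)]lnK ?posrE//.
  by rewrite -!expRD !ler_expR; apply/andP; split; lra.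
pose M := nm a + expR s * nm (x - a); pose m := expR (- s) * d.
have m0 : 0 < m by rewrite mulr_gt0// expR_gt0.
exists (inner Omega M m); split; [exact: inner_compact|exact: inner_sub|].
move=> y Oy yx; split.
  have /andP[_ h] := key y a Oy na yx; have := nmD (y - a) a; rewrite subrK /M; lra.
move=> b nb; have /andP[h _] := key y b Oy nb yx; rewrite nmB (le_trans _ h)//.
by rewrite /m ler_wpM2l ?expR_ge0// hd.
Qed.

Section SelfMap.
Variable p : C -> C.
Hypotheses (hp : holo Omega p) (pO : forall z, Omega z -> Omega (p z))
  (ip : forall x y, Omega x -> Omega y -> p x = p y -> x = y).

(** Precomposition with an iterate of [p] keeps test functions univalent and zero-free. *)
Lemma dle_iter n x y s : Omega x -> Omega y -> dle x y s -> dle (iter n p x) (iter n p y) s.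
Proof.
move=> Ox Oy h g h1 h2 h3; have [hn nO] := iter_holo n hp pO.
apply: (h (fun z => g (iter n p z))).
- exact: holo_comp nO hn h1.
- by move=> z /nO/h2.
- move=> z w Oz Ow gzw; apply: (iter_inj (n := n) pO ip) => //; apply: h3 => //; exact: nO.
Qed.

Lemma infinitely_often_cluster (x : nat -> C) (P : nat -> Prop) Q : compact Q ->
  (forall N, exists2 n, (N <= n)%N & P n) -> (forall n, P n -> Q (x n)) ->
  exists2 y, Q y & forall (e : R) N, 0 < e -> exists2 n, (N <= n)%N & P n /\ nm (x n - y) < e.
Proof.
move=> cQ inf PQ; apply: contrapT => no.
have eP y : exists eN : R * nat, Q y -> 0 < eN.1 /\
    forall n, (eN.2 <= n)%N -> P n -> ~ nm (x n - y) < eN.1.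
  have [Qy|?] := pselect (Q y); last by exists (0, 0%N).
  apply: contrapT => h; apply: no; exists y => // e N e0; apply: contrapT => h'.
  apply: h; exists (e, N) => _; split => // n Nn Pn xn; apply: h'; exists n => //.
have [r rE] := choice eP.
have [l lQ Ql] := compact_ball_cover cQ (fun z Qz => proj1 (rE z Qz)).
have [n nl Pn] := inf (\max_(z <- l) (r z).2).
have [z zl xz] := Ql _ (PQ _ Pn); have [_ /(_ n)] := rE _ (lQ _ zl); apply => //.
by rewrite (leq_trans _ nl)//; apply: (@leq_bigmax_seq _ l xpredT (fun z => (r z).2)).
Qed.

(* Calka: an orbit that returns infinitely often to a ball of finite radius accumulates at a
   point that is recurrent, and the orbit of a recurrent point is bounded. *)
Lemma bounded_orbit a x0 s0 : ~ Omega a -> Omega x0 ->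
  (forall N, exists2 n, (N <= n)%N & dle (iter n p x0) x0 s0) ->
  exists y Q, [/\ Omega y, compact Q, Q `<=` Omega & forall n, Q (iter n p y)].
Proof.
move=> na Ox0 inf; have nO n := (iter_holo n hp pO).2.
have [Q [cQ QO hQ]] := dle_bounded s0 na Ox0.
have [|y Qy hy] := @infinitely_often_cluster (fun n => iter n p x0)
  (fun n => dle (iter n p x0) x0 s0) Q cQ inf.
  by move=> n h; apply: hQ => //; exact: nO.
have Oy := QO _ Qy.
(* For two visits close to [y], at times [n1] and [n2], the iterate of order [n2 - n1] carries the
   first to the second, so it moves [y] only slightly. *)
have rec e N : 0 < e -> exists2 m, (N <= m)%N & dle (iter m p y) y e.
  move=> e0; have e20 : 0 < e / 2 by rewrite divr_gt0.
  have [r r0 hr] := dle_near Oy e20.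
  have [n1 _ [_ y1]] := hy r 0%N r0; have [n2 n12 [_ y2]] := hy r (n1 + N)%N r0.
  have [_ d1] := hr _ y1; have [_ d2] := hr _ y2.
  exists (n2 - n1)%N; first by rewrite leq_subRL// (leq_trans _ n12)// leq_addr.
  have := dle_iter (n2 - n1) (nO n1 _ Ox0) Oy d1; rewrite -iterD subnK.
    by move=> d3; rewrite [e]splitr; apply: dle_trans d2; exact: dle_sym.
  by rewrite (leq_trans _ n12)// leq_addr.
pose T n := dle (iter n p y) y 2.
have infT N : exists2 n, (N <= n)%N & T n by apply: rec.
have [Q2 [cQ2 Q2O hQ2]] := dle_bounded 2 na Oy.
have h20 : (0 : R) < 1 / 2 by lra.
have [r rE] : exists r : C -> R, forall z, Q2 z -> 0 < r z /\ forall w, nm (w - z) < r z -> dle w z (1 / 2).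
  have rP z : exists r : R, Q2 z -> 0 < r /\ forall w, nm (w - z) < r -> dle w z (1 / 2).
    have [Qz|?] := pselect (Q2 z); last by exists 0.
    by have [r r0 hr] := dle_near (Q2O _ Qz) h20; exists r => _; split => // w /hr[].
  by have [r rE] := choice rP; exists r.
have [l lQ Ql] := compact_ball_cover cQ2 (fun z Qz => proj1 (rE z Qz)).
pose near z n := [/\ (0 < n)%N, T n & dle (iter n p y) z (1 / 2)].
(* By compactness, the positions at positive return times are represented, up to distance 1, by
   those at times at most [N]. *)
have [N hN] : exists N, forall k, (0 < k)%N -> T k -> exists n, [/\ (0 < n <= N)%N, T n &
    dle (iter k p y) (iter n p y) 1].
  have [rep hrep] : exists rep : C -> nat, forall z n, near z n -> near z (rep z).
    have repP z : exists m, forall n, near z n -> near z m.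
      have [[n zn]|nz] := pselect (exists n, near z n); first by exists n.
      by exists 0%N => n zn; exfalso; apply: nz; exists n.
    by have [rep hrep] := choice repP; exists rep.
  exists (\max_(z <- l) rep z) => k k0 Tk.
  have [z zl kz] := Ql _ (hQ2 _ (nO k _ Oy) Tk).
  have [_ hz] := rE _ (lQ _ zl).
  have [r1 r2 r3] := hrep z k (And3 k0 Tk (hz _ kz)).
  exists (rep z); split => //.
    rewrite r1; apply: (@leq_bigmax_seq _ l xpredT rep) => //.
  rewrite (_ : (1 : R) = 1 / 2 + 1 / 2); last by lra.
  by apply: dle_trans (hz _ kz) _; exact: dle_sym.
(* A late return can be moved back by at most [N]: through a very close return at time [m], the
   position at time [k - n] is within 1/2 + 1 + 1/2 of [y]. *)
have desc k : (0 < k)%N -> (N <= k)%N -> T k -> exists n, (0 < n <= N)%N /\ T (k - n)%N.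
  move=> k0 Nk Tk; have [n [/andP[n0 nN] Tn kn]] := hN k k0 Tk.
  exists n; split; first by rewrite n0.
  have [m nm dm] := rec (1 / 2) n h20; have nk := leq_trans nN Nk.
  have d1 := dle_iter (m - n) (nO k _ Oy) (nO n _ Oy) kn; rewrite -!iterD subnK// in d1.
  have d2 := dle_iter (k - n) (nO m _ Oy) Oy dm; rewrite -!iterD in d2.
  rewrite (_ : k - n + m = m - n + k)%N in d2; last by lia.
  rewrite /T (_ : (2 : R) = 1 / 2 + 1 + 1 / 2); last by lra.
  by apply: dle_trans dm; apply: dle_trans d1; exact: dle_sym.
(* The first return after [n], moved back by [desc], falls at or before [n] by minimality. *)
have gap n : exists2 t, T t & (t <= n <= t + N)%N.
  have ex : exists k, `[< (n < k)%N /\ T k >].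
    by have [k nk Tk] := infT n.+1; exists k; apply/asboolP.
  case: (ex_minnP ex) => k /asboolP[nk Tk] kmin.
  have [kN|Nk] := ltnP k N.
    exists 0%N; first by apply: dle_refl.
    by rewrite leq0n/= add0n (leq_trans (ltnW nk))// ltnW.
  have [m [/andP[m0 mN] Tm]] := desc k ltac:(lia) Nk Tk.
  exists (k - m)%N => //; apply/andP; split; last by lia.
  rewrite leqNgt; apply/negP => h; have := kmin (k - m)%N (introT (asboolP _) (conj h Tm)).
  by lia.
have [S hS] : exists S, forall j, (j <= N)%N -> dle (iter j p y) y S.
  elim: N {hN desc gap} => [|N [S hS]].
    by exists 0 => j; rewrite leqn0 => /eqP ->; exact: dle_refl.
  have [S' hS'] := dle_finite Oy (nO N.+1 _ Oy).
  exists (Num.max S S') => j; rewrite leq_eqVlt => /orP[/eqP ->|jN].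
    by apply: dle_le hS'; rewrite le_max lexx orbT.
  by apply: (@dle_le _ _ S); [rewrite le_max lexx|exact: hS].
have [Q3 [cQ3 Q3O hQ3]] := dle_bounded (2 + S) na Oy.
exists y, Q3; split => // n; apply: hQ3; first exact: nO.
have [t Tt /andP[tn nt]] := gap n.
have := dle_iter (n - t) (nO t _ Oy) Oy Tt; rewrite -iterD subnK// => /dle_trans; apply.
by apply: hS; lia.
Qed.

Variable h0 : C -> C.
Hypothesis hh0 : holo Omega h0.
Hypothesis uni : forall g K (e : R), holo Omega g -> compact K -> K `<=` Omega -> 0 < e ->
  exists l, forall z, K z -> nm (h0 (iter l p z) - g z) <= e.

Lemma orbit_unbounded y (M : R) : Omega y -> exists n, M < nm (h0 (iter n p y)).
Proof.
move=> Oy; have [l hl] := uni (K := [set y]) (@holo_cst R Omega (rc (`|M| + 2)))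
  (@compact_set1 _ y) ltac:(by move=> _ ->) ltr01.
exists l; have := hl y erefl; have := nmD (rc (`|M| + 2) - h0 (iter l p y)) (h0 (iter l p y)).
rewrite subrK nmB nm_rc ger0_norm ?addr_ge0//; have := ler_norm M; lra.
Qed.

Lemma run_away_hyperbolic a K : ~ Omega a -> compact K -> K `<=` Omega ->
  exists N, forall n, (N <= n)%N -> forall z, K z -> ~ (iter n p @` K) z.
Proof.
move=> na cK KO; apply: contrapT => no.
have inf N : exists2 n, (N <= n)%N & exists x, K x /\ K (iter n p x).
  apply: contrapT => h; apply: no; exists N => n Nn z Kz [x Kx xz]; apply: h.
  by exists n => //; exists x; split => //; rewrite xz.
have [n _ [x0 [Kx0 _]]] := inf 0%N; have Ox0 := KO _ Kx0.
have [s hs] := dle_compact Ox0 cK KO.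
have [|y [Q [Oy cQ QO hQ]]] := @bounded_orbit a x0 (s + s) na Ox0.
  move=> N; have [m Nm [x [Kx Kmx]]] := inf N; exists m => //.
  apply: dle_trans (hs _ Kmx); apply: dle_sym.
  exact: dle_iter (KO _ Kx) Ox0 (hs _ Kx).
have [M M0 hM] := compact_cont_bound cQ (fun z Qz => holo_ccont hh0 (QO _ Qz)).
have [m] := orbit_unbounded M Oy; have := hM _ (hQ m); lra.
Qed.

End SelfMap.
End RunAway.

(** * Injective entire functions *)

Section Entire.
Context {R : realType}.
Local Notation C := (plane R).
Implicit Types (x y z w : C) (f g : C -> C).

Lemma der0_const f (c : C) : (forall z, hasd f z c) -> forall z, f z = f 0 + c * z.
Proof.
move=> df z; pose F w := f w - c * w.
have : nm (F z - F 0) <= 0 * nm (z - 0).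
  apply: (@mean_value_seg R F (fun=> 0)) => t _; split; last by rewrite nm0.
  apply: hasd_eq; first exact: hasdB (df _) (hasdMl c (hasd_id _)).
  by rewrite mulr1 subrr.
rewrite mul0r => h; have {h} : F z - F 0 == 0 by rewrite -nm_eq0 eq_le h nm_ge0.
by rewrite subr_eq0 /F mulr0 subr0 => /eqP <-; rewrite subrK.
Qed.

(** Cauchy's estimate on discs of radius [nm z + 1] bounds the derivative; on arbitrarily large
    discs it then kills the second derivative. *)
Lemma linear_growth f (A B : R) : holo setT f -> (forall z, nm (f z) <= A * nm z + B) ->
  exists c, forall z, f z = f 0 + c * z.
Proof.
move=> hf fb; have [k k0 hk] := @cauchy_estimate R.
have hd := holo_der openT hf; have hdd := holo_der openT hd.
have B0 : 0 <= B by have := fb 0; rewrite nm0 mulr0 add0r; exact: le_trans (nm_ge0 _).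
pose A' := `|A|; have A'0 : 0 <= A' by exact: normr_ge0.
pose D := k * (2 * A' + B).
have b1 z : nm (der f z) <= D.
  have r0 : 0 < nm z + 1 by rewrite ltr_wpDl ?nm_ge0.
  have := hk f z (nm z + 1) (A' * (2 * nm z + 1) + B) r0 (holo_sub (@subsetT _ _) hf) _.
  move=> h; apply: le_trans (h _) _.
    move=> w; rewrite /oball /= => wz; rewrite (le_trans (fb w))// lerD2r.
    rewrite (le_trans (ler_wpM2r (nm_ge0 _) (ler_norm A)))// ler_wpM2l//.
    by have := nmD (w - z) z; rewrite subrK; lra.
  rewrite ler_pdivrMr// /D -mulrA ler_pM2l//.
  have := nm_ge0 z => nz; have := mulr_ge0 A'0 nz; have := mulr_ge0 B0 nz; lra.
have D0 : 0 <= D by exact: le_trans (nm_ge0 _) (b1 0).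
have b2 z : der (der f) z = 0.
  apply/eqP; rewrite -nm_eq0 eq_le nm_ge0 andbT; apply/ler_addgt0Pr => e e0; rewrite add0r.
  have r0 : 0 < (k * D + 1) / e by rewrite divr_gt0// ltr_wpDl// mulr_ge0// ltW.
  apply: le_trans (hk (der f) z _ D r0 (holo_sub (@subsetT _ _) hd) (fun w _ => b1 w)) _.
  rewrite ler_pdivrMr// [leRHS]mulrC divfK ?gt_eqF//; lra.
exists (der f 0); apply: der0_const => z.
have := @der0_const (der f) 0 (fun w => hasd_eq (derP hd I) (b2 w)) z.
by rewrite mul0r addr0 => <-; exact: (derP hf).
Qed.

(** By the open mapping property and injectivity, [p] stays away from [p 0] off the unit disc. So
    the zero-free quotient [q z = (p z - p 0) / z] has an inverse of linear growth, hence affine; an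
    affine function without zeros is constant. *)
Lemma injective_entire_affine p : holo setT p -> injective p ->
  exists a b : C, forall z, p z = a * z + b.
Proof.
move=> hp ip; have ip' x y : [set: C] x -> [set: C] y -> p x = p y -> x = y by move=> _ _; exact: ip.
have [q [hq q0 qE]] := diffquot openT hp (I : [set: C] 0).
have qn0 z : q z != 0.
  have [->|z0] := eqVneq z 0; first by rewrite q0; exact: (inj_der_neq0 openT hp ip').
  rewrite qE// mulf_neq0 ?invr_eq0 ?subr_eq0//.
  by apply: contra_neq z0 => /ip.
have hT : holo setT (fun z => (q z)^-1) by apply: holoV.
have [r [d [/andP[r0 r1] d0 _ hd]]] := inj_local openT hp ip' (I : [set: C] 0) ltr01.
have far z : 1 <= nm z -> d <= nm (p z - p 0).
  move=> z1; rewrite leNgt; apply/negP => /hd[w wr /ip wz].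
  by move: wr; rewrite subr0 wz; lra.
have [M M0 hM] := compact_cont_bound (@cball_compact R 0 1) (fun z _ => holo_ccont hT (I : [set: C] z)).
have [c hc] : exists c, forall z, (q z)^-1 = (q 0)^-1 + c * z.
  apply: (@linear_growth _ d^-1 M hT) => z; have d10 : 0 <= d^-1 by rewrite invr_ge0 ltW.
  have [z1|z1] := leP 1 (nm z); last first.
    rewrite (le_trans (hM z _))//; first by rewrite /cball /= subr0 ltW.
    by rewrite lerDr mulr_ge0 ?nm_ge0.
  have z0 : z != 0 by rewrite -nm_gt0; lra.
  rewrite qE// invf_div subr0 nmM nmV (le_trans _ (_ : nm z * d^-1 <= _))//.
    by rewrite ler_wpM2l ?nm_ge0// lef_pV2 ?posrE ?far// (lt_le_trans d0)// far.
  by rewrite mulrC lerDl.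
have c0 : c = 0.
  apply/eqP; apply/negPn/negP => c0; have := hc (- (q 0)^-1 / c).
  rewrite mulrCA divff// mulr1 subrr => /eqP; rewrite invr_eq0.
  by rewrite (negbTE (qn0 _)).
have qc z : q z = q 0 by apply: invr_inj; rewrite hc c0 mul0r addr0.
exists (q 0), (p 0) => z; have [->|z0] := eqVneq z 0; first by rewrite mulr0 add0r.
by rewrite -(qc z) qE// subr0 divfK// subrK.
Qed.

End Entire.

(** * Consequences of hypercyclicity for the symbol *)

Section Hypercyclic.
Context {R : realType}.
Local Notation C := (plane R).
Variable Omega : set C.
Hypotheses (oO : open Omega) (coO : connected Omega).
Implicit Types (x y z w : C) (K : set C) (f g h : C -> C).
Variable p : C -> C.
Hypotheses (hp : holo Omega p) (pO : forall z, Omega z -> Omega (p z)).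
Hypothesis uni : universal_maps Omega (fun n => iter n p).

(** The iterate of order 0 says nothing about [p]. If it serves for [g] with precision [e / 4], it
    cannot serve with precision [e / 8] for [g] shifted by [3 / 4 * e], and approximating the
    shifted target is enough for [g]. *)
Lemma universal_iter : exists2 h, holo Omega h & forall g K (e : R), holo Omega g ->
  compact K -> K `<=` Omega -> 0 < e ->
  exists l, forall z, K z -> nm (h (iter l.+1 p z) - g z) <= e.
Proof.
have [h hh un] := uni; exists h => // g K e hg cK KO e0.
have [K0|/set0P/negP/negPn/eqP K0] := pselect (K !=set0); last by exists 0%N => z; rewrite K0.
have [x Kx] := K0; have e40 : 0 < e / 4 by rewrite divr_gt0.
have [l hl] := un g K _ hg cK KO e40.
case: l hl => [|l] hl; last first.
  by exists l => z Kz; rewrite (le_trans (hl z Kz))//; lra.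
have hg' : holo Omega (fun z => g z + rc (3 / 4 * e)) by apply: holoD => //; exact: holo_cst.
have e80 : 0 < e / 8 by rewrite divr_gt0.
have nr : nm (rc (3 / 4 * e)) = 3 / 4 * e by rewrite nm_rc ger0_norm// mulr_ge0 ?ltW//; lra.
have [[|l'] hl'] := un _ K _ hg' cK KO e80.
  have := hl x Kx; have := hl' x Kx; rewrite /= => h1 h2.
  have := nmD (h x - g x) (- (h x - (g x + rc (3 / 4 * e)))).
  rewrite nmN (_ : h x - g x - _ = rc (3 / 4 * e)); last by ring.
  by rewrite nr; lra.
exists l' => z Kz; have h1 := hl' z Kz.
have := nmD (h (iter l'.+1 p z) - (g z + rc (3 / 4 * e))) (rc (3 / 4 * e)).
rewrite (_ : _ - _ + rc _ = h (iter l'.+1 p z) - g z); last by ring.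
rewrite nr; lra.
Qed.

(** Approximants of the form [h \o iter l.+1 p] are functions of [p]. Taking the identity as target
    separates points; an arbitrary target gives the Runge condition below. *)
Lemma universal_injective x y : Omega x -> Omega y -> p x = p y -> x = y.
Proof.
move=> Ox Oy pxy; have [h hh un] := universal_iter.
apply/eqP; rewrite -subr_eq0 -nm_eq0 eq_le nm_ge0 andbT; apply/ler_addgt0Pr => e e0; rewrite add0r.
have e20 : 0 < e / 2 by rewrite divr_gt0.
have [l hl] := un id ([set x] `|` [set y]) _ (@holo_id R Omega)
  ltac:(by apply: compactU; exact: compact_set1) ltac:(by move=> _ [->|->]) e20.
have := hl x (or_introl erefl); have := hl y (or_intror erefl); rewrite !iterSr pxy.
by have := nm_triangle (h (iter l p (p y))) x y; rewrite (nmB x (h _)); lra.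
Qed.

Lemma universal_runge : runge_map Omega p.
Proof.
move=> G K e hG cK KO e0; have [h hh un] := universal_iter.
have [l hl] := un G K e hG cK KO e0; have [hn nO] := iter_holo l hp pO.
exists (fun z => h (iter l p z)); first exact: holo_comp nO hn hh.
by move=> z /hl; rewrite iterSr.
Qed.

Lemma universal_run_away K : compact K -> K `<=` Omega ->
  exists N, forall n, (N <= n)%N -> forall z, K z -> ~ (iter n p @` K) z.
Proof.
move=> cK KO; have [h hh un] := uni.
have [[a na]|allO] := pselect (exists a, ~ Omega a).
  exact: (run_away_hyperbolic oO coO hp pO universal_injective hh un na).
have OT z : Omega z by apply: contrapT => nz; apply: allO; exists z.
have OE : Omega = setT by apply/seteqP; split.
have hpT : holo setT p by rewrite -OE.
have ipT : injective p by move=> x y; exact: universal_injective.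
have [a [b pE]] := injective_entire_affine hpT ipT.
have nofix y : p y <> y.
  move=> py; have [n] := orbit_unbounded un (nm (h y)) (OT y).
  by rewrite (_ : iter n p y = y) ?ltxx//; elim: n => //= n ->.
have a1 : a = 1.
  apply/eqP; apply/negPn/negP => a1; apply: (nofix (b / (1 - a))).
  by rewrite pE; field; rewrite subr_eq0 eq_sym.
have b0 : 0 < nm b.
  by rewrite nm_gt0; apply/eqP => b0; apply: (nofix 0); rewrite pE b0 mulr0 addr0.
have it n z : iter n p z = z + n%:R * b.
  elim: n => [|n IH]; first by rewrite mul0r addr0.
  by rewrite /= IH pE a1 mul1r -natr1 mulrDl mul1r addrA.
have [M M0 hM] := compact_bounded_plane cK.
exists (Num.truncn (2 * M / nm b)).+1 => n Nn z Kz [x Kx xz].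
have h1 := truncnS_gt (2 * M / nm b).
have h2 : 2 * M / nm b < n%:R by rewrite (lt_le_trans h1)// ler_nat.
rewrite ltr_pdivrMr// in h2.
have zx : z - x = n%:R * b by rewrite -xz it addrC addKr.
have := nmD z (- x); rewrite nmN zx nmM -rc_nat nm_rc ger0_norm//.
by have := hM _ Kx; have := hM _ Kz; lra.
Qed.

Lemma universal_subsequence (s : nat -> nat) :
  (forall u, (forall l, holo Omega (u l)) -> (forall l z, Omega z -> Omega (u l z)) ->
    (forall l x y, Omega x -> Omega y -> u l x = u l y -> x = y) ->
    (forall l, runge_map Omega (u l)) -> run_away_maps Omega u -> transitive_maps Omega u) ->
  increasing s -> universal_maps Omega (fun l => iter (s l) p).
Proof.
move=> tr si; have le l : (l <= s l)%N.
  by elim: l => // l IH; rewrite (leq_ltn_trans IH)// si.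
apply: transitive_universal => //.
- by move=> l; exact: (iter_holo _ hp pO).1.
- by move=> l; exact: (iter_holo _ hp pO).2.
- apply: tr.
  + by move=> l; exact: (iter_holo _ hp pO).1.
  + by move=> l; exact: (iter_holo _ hp pO).2.
  + by move=> l; exact: (iter_inj pO universal_injective).
  + by move=> l; apply: iter_runge => //; exact: universal_runge.
  + move=> K cK KO; have [N hN] := universal_run_away cK KO.
    by exists N; apply: hN.
Qed.

End Hypercyclic.

(** * The topology of uniform convergence on compact sets *)

Section FunctionSpace.
Context {R : realType}.
Local Notation C := (plane R).
Implicit Types (Omega : set C) (z w : C).

Lemma entourage_planeP (E : set (C * C)) : entourage E <->
  exists2 r : R, 0 < r & forall x y, nm (x - y) < r -> E (x, y).
Proof.
rewrite -entourage_ballE; split=> [[e /= e0 eE]|[r r0 rE]].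
  move: e0; rewrite lt_def lecE /= => /andP[e0 /andP[/eqP ie re]].
  have eE' : e = rc (complex.Re e) by rewrite -[LHS]mk_re_im /rc /mk /im ie.
  exists (complex.Re e).
    by rewrite lt_def re andbT; apply: contra_neq e0 => h; rewrite eE' h.
  by move=> x y xy; apply: eE; rewrite /ball /= nmE eE' ltcR.
exists (rc r); first by rewrite /= ltcR.
by move=> [x y] /=; rewrite /ball /= nmE ltcR => /rE.
Qed.

Section Family.
Variable T : topologicalType.
Local Notation fam := {family compact, T -> C}.

(** The filter generated by the basic sets converges to [f] for compact convergence, so it contains
    every neighbourhood of [f]. *)
Lemma nbhs_familyP (f : fam) (A : set fam) : nbhs f A <->
  exists K (e : R), [/\ compact K, 0 < e &
    forall g : fam, (forall t, K t -> nm (g t - f t) < e) -> A g].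
Proof.
pose base (Ke : set T * R) := [set g : fam | forall t, Ke.1 t -> nm (g t - f t) < Ke.2].
split=> [fA|[K [e [cK e0 KA]]]].
  pose F := filter_from [set Ke : set T * R | compact Ke.1 /\ 0 < Ke.2] base.
  have FF : Filter F.
    apply: filter_from_filter; first by exists (set0, 1); split => //; exact: compact0.
    move=> [K e] [K' e'] [/= cK e0] [/= cK' e'0].
    exists (K `|` K', Num.min e e').
      by split; [exact: compactU|rewrite /= lt_min e0].
    move=> g /= h; split => t Kt.
      by have := h t (or_introl Kt); rewrite lt_min => /andP[].
    by have := h t (or_intror Kt); rewrite lt_min => /andP[].
  have Ff : {family compact, F --> f}.
    apply/fam_cvgP => K cK P /uniform_nbhs[E [/entourage_planeP[e e0 eE] EP]].
    exists (K, e); first by split.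
    by move=> g /= h; apply: EP => t Kt; apply: eE; rewrite nmB; exact: h.
  have [[K e] [/= cK e0] KA] := Ff A fA.
  by exists K, e.
have ent : entourage [set xy : C * C | nm (xy.2 - xy.1) < e].
  by apply/entourage_planeP; exists e => // x y; rewrite nmB.
apply: filterS (fam_nbhs f ent cK) => g /= h.
by apply: KA.
Qed.

End Family.

Lemma nbhs_set_typeP (T : topologicalType) (S : set T) (x : S) (A : set S) : nbhs x A <->
  exists2 B : set T, nbhs (\val x) B & set_val @^-1` B `<=` A.
Proof.
split=> [|[B]]; last first.
  rewrite nbhsE => -[B0 [oB0 xB0] B0B] BA; rewrite nbhsE.
  exists (set_val @^-1` B0); last by move=> y /B0B; exact: BA.
  by split => //; exists B0.
rewrite {1}nbhsE => -[_ [[B oB <-] Bx] BA]; exists B => //.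
by exists B.
Qed.

Lemma compact_image_val Omega (K : set Omega) : compact K ->
  compact (set_val @` K) /\ set_val @` K `<=` Omega.
Proof.
move=> cK; split; last by move=> _ [u _ <-]; exact: set_valP.
apply: continuous_compact => //; apply: continuous_subspaceT; exact: initial_continuous.
Qed.

Lemma compact_preimage_val Omega (K : set C) : compact K -> K `<=` Omega ->
  compact (set_val @^-1` K : set Omega).
Proof.
move=> cK KO F PF FK.
have [|z [Kz cz]] := cK (set_val @ F) _; first by apply: filterS FK.
pose u : Omega := exist _ z (mem_set (KO _ Kz)); exists u; split => //.
move=> A B FA /nbhs_set_typeP[B0 zB0 BB0].
have [|_ [[y Ay <-] By]] := cz (set_val @` A) B0 _ zB0.
  suff : F (set_val @^-1` (set_val @` A)) by [].
  by apply: filterS FA => y Ay; exists y.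
by exists y; split => //; exact: BB0.
Qed.

Section Hol.
Variable Omega : set C.
Hypothesis oO : open Omega.

Lemma holomorphic_holo (f : Omega -> C) : holomorphic f ->
  exists2 g, holo Omega g & forall u : Omega, f u = g (\val u).
Proof. by move=> [g dg fg]; exists g => // z /dg/hasd_derivable. Qed.

Lemma holo_holomorphic (g : C -> C) : holo Omega g ->
  holomorphic (fun u : Omega => g (\val u)).
Proof. by move=> hg; exists g => // z /hg/hasd_derivable. Qed.

Definition to_hol g (hg : holo Omega g) : hol Omega :=
  exist _ (fun u : Omega => g (\val u)) (mem_set (holo_holomorphic hg)).

Lemma hol_holo (f : hol Omega) :
  exists2 g, holo Omega g & forall u : Omega, \val f u = g (\val u).
Proof. exact/holomorphic_holo/set_valP. Qed.

(** Passes from the topology of [hol Omega] to uniform approximation on compact subsets of the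
    plane, the form used in the analytic part. *)
Lemma dense_holP (S : set (hol Omega)) : dense S <->
  forall g K (e : R), holo Omega g -> compact K -> K `<=` Omega -> 0 < e ->
  exists2 x, S x & forall u : Omega, K (\val u) -> nm (\val x u - g (\val u)) <= e.
Proof.
split=> [dS g K e hg cK KO e0|H A [x Ax] oA].
  pose A := [set x : hol Omega | forall u : Omega, K (\val u) -> nm (\val x u - g (\val u)) < e].
  have nA : nbhs (to_hol hg) A.
    apply/nbhs_set_typeP; exists [set f : {family compact, Omega -> C} |
      forall u : Omega, K (\val u) -> nm (f u - g (\val u)) < e] => //.
    apply/nbhs_familyP; exists (set_val @^-1` K), e; split => //.
    exact: compact_preimage_val.
  have [|x [Ax Sx]] := dS (interior A) _ (@open_interior _ A).
    by exists (to_hol hg).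
  by exists x => // u /(interior_subset Ax)/ltW.
have nA : nbhs x A by exact: open_nbhs_nbhs.
move: nA => /nbhs_set_typeP[B /nbhs_familyP[K [e [cK e0 KB]]] BA].
have [g hg xg] := hol_holo x; have [cK' KO] := compact_image_val cK.
have e20 : 0 < e / 2 by rewrite divr_gt0.
have [y Sy yg] := H g _ _ hg cK' KO e20.
exists y; split => //; apply: BA; apply: KB => t Kt.
have h := yg t (ex_intro2 _ _ t Kt erefl).
by change (nm (\val y t - \val x t) < e); rewrite xg; lra.
Qed.

Section CompOp.
Variables (phi : Omega -> Omega) (hphi : hol_self phi) (p : C -> C).
Hypotheses (hp : holo Omega p) (pE : forall u : Omega, \val (phi u) = p (\val u)).

Lemma self_map z : Omega z -> Omega (p z).
Proof. by move=> Oz; rewrite -(pE (exist _ z (mem_set Oz))); exact: set_valP. Qed.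

Lemma iter_self n (u : Omega) : \val (iter n phi u) = iter n p (\val u).
Proof. by elim: n => //= n IH; rewrite pE; congr p. Qed.

Lemma iter_comp_op n (f : hol Omega) (u : Omega) :
  \val (iter n (comp_op hphi) f) u = \val f (iter n phi u).
Proof. by elim: n u => //= n IH u; rewrite IH -iterSr. Qed.

Lemma hypercyclic_universal (n : nat -> nat) :
  hypercyclic_wrt (comp_op hphi) n <-> universal_maps Omega (fun l => iter (n l) p).
Proof.
have eqn (f : hol Omega) h l u : (forall u : Omega, \val f u = h (\val u)) ->
    \val (iter (n l) (comp_op hphi) f) u = h (iter (n l) p (\val u)).
  by move=> fh; rewrite iter_comp_op fh iter_self.
split=> [[f /dense_holP df]|[h hh un]].
  have [h hh fh] := hol_holo f; exists h => // g K e hg cK KO e0.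
  have [_ [l _ <-] hl] := df g K e hg cK KO e0.
  exists l => z Kz; have := hl (exist _ z (mem_set (KO _ Kz))) Kz.
  by rewrite (eqn _ _ _ _ fh).
exists (to_hol hh); apply/dense_holP => g K e hg cK KO e0.
have [l hl] := un g K e hg cK KO e0; exists (iter (n l) (comp_op hphi) (to_hol hh)).
  by exists l.
by move=> u Ku; rewrite (eqn _ h)//; exact: hl.
Qed.

End CompOp.
End Hol.

(** * The Runge, run-away and Stein conditions in the plane *)

Section Domain.
Variable Omega : set C.
Hypothesis oO : open Omega.

(** The target [G] is carried to the image by the holomorphic inverse [psi], approximated there, and
    pulled back by [p]. *)
Lemma runge_domain_runge_map (phi : Omega -> Omega) (p : C -> C) : holo Omega p ->
  (forall u : Omega, \val (phi u) = p (\val u)) -> injective phi ->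
  runge_domain (range (fun z : Omega => \val (phi z))) Omega -> runge_map Omega p.
Proof.
move=> hp pE iphi; have VE : range (fun z : Omega => \val (phi z)) = p @` Omega.
  apply/seteqP; split => [_ [u _ <-]|_ [z Oz <-]].
    by exists (\val u); [exact: set_valP|rewrite pE].
  by exists (exist _ z (mem_set Oz)) => //; rewrite pE.
rewrite VE => -[[oV _ _] VO dS] G K e hG cK KO e0.
have ip x y : Omega x -> Omega y -> p x = p y -> x = y.
  move=> Ox Oy pxy.
  have : phi (exist _ x (mem_set Ox)) = phi (exist _ y (mem_set Oy)).
    by apply: val_inj; rewrite !pE.
  by move=> /iphi[].
have [psi hpsi psiE] := inj_inverse oO hp ip.
have hGp : holo (p @` Omega) (fun w => G (psi w)).
  by apply: holo_comp hpsi hG => _ [z Oz <-]; rewrite psiE.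
have KV : p @` K `<=` p @` Omega by move=> _ [z /KO Oz <-]; exists z.
have [f [g fg] fG] := (dense_holP _).1 dS _ _ e hGp (image_compact cK KO hp) KV e0.
have [h hh gh] := hol_holo g; exists h => // z Kz.
have Vz : (p @` Omega) (p z) by apply: KV; exists z.
pose v : (p @` Omega : set C) := exist _ (p z) (mem_set Vz).
pose w : Omega := exist _ (p z) (mem_set (VO _ Vz)).
have vE : \val f v = h (p z) by rewrite (fg v w) // gh.
have := fG v (ex_intro2 _ _ z Kz erefl).
by rewrite vE /= (psiE _ (KO _ Kz)).
Qed.

Lemma run_away_run_away_maps (phi : Omega -> Omega) (p : C -> C) (n : nat -> nat) :
  (forall u : Omega, \val (phi u) = p (\val u)) ->
  run_away (fun l => iter (n l) phi) -> run_away_maps Omega (fun l => iter (n l) p).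
Proof.
move=> pE ra K cK KO; have [l hl] := ra _ (compact_preimage_val cK KO).
exists l => z Kz [x Kx xz].
have : (iter (n l) phi @` (set_val @^-1` K) `&` (set_val @^-1` K))
    (exist _ z (mem_set (KO _ Kz)) : Omega).
  split => //; exists (exist _ x (mem_set (KO _ Kx))) => //.
  by apply: val_inj; rewrite (iter_self pE).
by rewrite hl.
Qed.

(** A removable pole at [u] gives the function [1 - (z - u) * h z], equal to 1 at [u] and at most
    1/2 on [K]; the other inclusion is the maximum principle on the hull. *)
Lemma hol_hullE (K : set Omega) : compact K ->
  hol_hull K = set_val @^-1` (hull Omega (set_val @` K)).
Proof.
move=> cK; have [cK' KO] := compact_image_val cK.
apply/seteqP; split => u.
  move=> hu [h hh hK]; have hF : holo Omega (fun z => 1 - (z - \val u) * h z).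
    apply: holoB; first exact: holo_cst.
    by apply: holoM => //; apply: holoB; [exact: holo_id|exact: holo_cst].
  have := hu (to_hol hF) (rc (1 / 2)) _.
  rewrite /= subrr mul0r subr0 nmE lecR nm1 => H.
  have : (1 : R) <= 1 / 2; last by lra.
  by apply: H => w Kw; rewrite nmE lecR; apply: hK; exists w.
move=> hu f M fM.
(* The bound [M] is a complex number, which a point of [K] forces to be real. Without such a point
   every pole is removable and the hull is empty. *)
have [[w Kw]|K0] := pselect (exists w : Omega, K w); last first.
  exfalso; apply: hu; exists (fun=> 0); first exact: holo_cst.
  by move=> z [w Kw]; exfalso; apply: K0; exists w.
have ME : M = rc (complex.Re M).
  have := fM w Kw; rewrite nmE lecE /= => /andP[/eqP iM _].
  by rewrite -[LHS]mk_re_im /rc /mk /im iM.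
have [g hg fg] := hol_holo f; rewrite fg ME nmE lecR.
apply: (hull_max cK' KO hg _ hu) => _ [v Kv <-].
by have := fM v Kv; rewrite fg {1}ME nmE lecR.
Qed.

Lemma stein_open : stein Omega.
Proof.
split => //.
  move=> K cK; rewrite hol_hullE//; have [cK' KO] := compact_image_val cK.
  apply: compact_preimage_val; first exact: hull_compact.
  exact: hull_sub.
move=> z w zw; exists (to_hol (@holo_id R Omega)) => /= zw'; apply: zw.
exact: val_inj.
Qed.

End Domain.
End FunctionSpace.

Theorem theorem6p2 (R : realType) (Omega : set (plane R))
    (domOmega : domain Omega)
    (connOmega : simply_connected Omega \/ infinitely_connected Omega) :
  class_S Omega /\
  (forall (phi : Omega -> Omega) (hphi : hol_self phi),
     hypercyclic (comp_op hphi) -> hereditarily_hypercyclic (comp_op hphi)).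
Proof.
have [oO coO _] := domOmega.
(* Both assertions rest on this criterion; they differ in where its conditions come from. *)
have tr (u : nat -> plane R -> plane R) : (forall l, holo Omega (u l)) ->
    (forall l z, Omega z -> Omega (u l z)) ->
    (forall l x y, Omega x -> Omega y -> u l x = u l y -> x = y) ->
    (forall l, runge_map Omega (u l)) -> run_away_maps Omega u -> transitive_maps Omega u.
  move=> hu uO iu ru ra; case: connOmega => conn.
    exact: simply_connected_transitive.
  exact: infinitely_connected_transitive.
split.
  split => //; first exact: stein_open.
  move=> phi hphi n incn iphi rd ra; have [p hp pE] := holomorphic_holo hphi.
  have pO := self_map pE.
  have ip x y : Omega x -> Omega y -> p x = p y -> x = y.
    move=> Ox Oy pxy.
    have : phi (exist _ x (mem_set Ox)) = phi (exist _ y (mem_set Oy)).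
      by apply: val_inj; rewrite !pE.
    by move=> /iphi[].
  have rp := runge_domain_runge_map oO hp pE iphi rd.
  apply/(hypercyclic_universal hphi pE).
  apply: transitive_universal => //; first by move=> l; exact: (iter_holo _ hp pO).1.
    by move=> l; exact: (iter_holo _ hp pO).2.
  apply: tr.
  - by move=> l; exact: (iter_holo _ hp pO).1.
  - by move=> l; exact: (iter_holo _ hp pO).2.
  - by move=> l; exact: (iter_inj pO ip).
  - by move=> l; exact: iter_runge.
  - exact: run_away_run_away_maps pE ra.
move=> phi hphi hyp s incs; have [p hp pE] := holomorphic_holo hphi.
have uni := (hypercyclic_universal hphi pE id).1 hyp.
apply/(hypercyclic_universal hphi pE s).
exact: (universal_subsequence oO coO hp (self_map pE) uni tr incs).
Qed.
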